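(* Let $m\ge 2$, let $a$ be an integer with $\gcd(a,m)=1$, and let $n\ge1$ be an integer. Define \[ \xi_n(s;m,a):=\sum_{\substack{k\ge1\\ k^n\equiv a \ (\mathrm{mod}\ m)}}\frac{\Lambda(k)}{k^s},\qquad \mathrm{Re}(s)>1. \] Then $\xi_n(s;m,a)$ is analytic for $\mathrm{Re}(s)>1$, admits a meromorphic continuation to $\mathbb{C}$, and \[ \mathrm{Res}_{s=0}\left(\frac1s\,\xi_n(s;m,a)\right)=-\mathscr{Q}_n^+(m;a)-\mathscr{Q}_n^-(m;a)-\mathscr{Q}_n^0(m;a). \]
   Context: $\Lambda$ is the von Mangoldt function. $\widehat{G(m)}$ is the group of Dirichlet characters modulo $m$ (with $\chi(k)=0$ if $\gcd(k,m)>1$), $\chi_0$ the principal character, $\varphi(m)=\#(\mathbb{Z}/m\mathbb{Z})^\times$. For $\psi\in\widehat{G(m)}$ (not necessarily primitive), $L(s,\psi)=\sum_{k\ge1}\psi(k)k^{-s}$, meromorphically continued to $\mathbb{C}$ (e.g. $L(s,\chi_0)=\zeta(s)\prod_{p\mid m}(1-p^{-s})$). Put $\rho(\psi):=\mathrm{Res}_{s=0}\frac{L'(s,\psi)}{s\,L(s,\psi)}$. Then $\mathscr{Q}_n^0(m;a):=\frac{1}{\varphi(m)}\sum_{\chi:\,\chi^n=\chi_0}\chi^{-1}(a)\rho(\chi^n)$, $\mathscr{Q}_n^-(m;a):=\frac{1}{\varphi(m)}\sum_{\chi:\,\chi^n(-1)=-1}\chi^{-1}(a)\rho(\chi^n)$,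 $\mathscr{Q}_n^+(m;a):=\frac{1}{\varphi(m)}\sum_{\chi:\,\chi^n(-1)=1,\ \chi^n\neq\chi_0}\chi^{-1}(a)\rho(\chi^n)$, all sums over $\chi\in\widehat{G(m)}$ (an empty sum is $0$). *)

(* Defs.v *)
From HB Require Import structures.
From mathcomp Require Import all_boot all_order all_algebra.
From mathcomp Require Import complex.
From mathcomp Require Import all_classical all_reals all_analysis.

Set Implicit Arguments.
Unset Strict Implicit.
Unset Printing Implicit Defensive.

Import Order.TTheory GRing.Theory Num.Theory.
Import numFieldNormedType.Exports.

Local Open Scope classical_set_scope.
Local Open Scope ring_scope.
Local Open Scope complex_scope.

(* R[i] receives its topology, given by the modulus, through the alias ^o. *)
Notation Cplx R := ((R[i])^o) (only parsing).

Section ComplexAnalysis.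
Variable R : realType.
Local Notation C := (Cplx R).
Implicit Types (f F : C -> C) (z : C).

Definition expC (z : C) : C :=
  (expR (complex.Re z))%:C * (cos (complex.Im z) +i* sin (complex.Im z)).

(* k ^ s for k > 0, with the real logarithm of k. *)
Definition npowC (k : nat) (s : C) : C := expC (s * (ln (k%:R : R))%:C).

Definition analytic_at f z0 : Prop :=
  exists c : nat -> C, \forall z \near z0,
    series (fun k => c k * (z - z0) ^+ k) @ \oo --> f z.

(* f has around z0 a Laurent expansion whose term of exponent k - N
   has coefficient c k. *)
Definition laurent_at f z0 (N : nat) (c : nat -> C) : Prop :=
  \forall z \near z0^',
    series (fun k => c k * (z - z0) ^+ k) @ \oo --> (z - z0) ^+ N * f z.

Definition meromorphic f : Prop :=
  forall z0, exists N c, laurent_at f z0 N c.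

Definition is_residue f z0 (r : C) : Prop :=
  exists N c, laurent_at f z0 N c /\ r = (if N is N'.+1 then c N' else 0).

Definition residue f z0 : C := xget 0 [set r | is_residue f z0 r].

(* F is a meromorphic continuation to the plane of a function f given on the
   half-plane Re s > 1; the values of f elsewhere, and those of F at its poles,
   are irrelevant. *)
Definition meromorphic_continuation f F : Prop :=
  meromorphic F /\ forall s, 1 < complex.Re s -> F s = f s.

Definition dirichlet_term (c : nat -> C) (s : C) (k : nat) : C :=
  c k.+1 * npowC k.+1 (- s).

Definition dirichlet_series (c : nat -> C) (s : C) : C :=
  limn (series (dirichlet_term c s)).

End ComplexAnalysis.

Section DirichletCharacters.
Variable R : realType.
Local Notation C := (Cplx R).
Implicit Types (chi psi : int -> C) (m n : nat) (a : int).

Definition dirichlet_char m chi : Prop :=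
  [/\ forall k l, chi (k * l) = chi k * chi l,
      forall k, chi (k + m%:Z) = chi k
    & forall k, chi k != 0 <-> coprimez k m].

Definition principal_char m : int -> C := fun k => (coprimez k m)%:R.

Definition char_exp chi n : int -> C := fun k => chi k ^+ n.

Definition Lfun psi : C -> C :=
  xget (fun=> 0) [set F |
    meromorphic_continuation (dirichlet_series (fun k => psi k%:Z)) F].

Definition rho psi : C :=
  residue (fun s => derive1 (Lfun psi) s / (s * Lfun psi s)) 0.

Definition Q_sum m n a (A : set (int -> C)) : C :=
  (totient m)%:R^-1 *
  \sum_(chi \in [set chi | dirichlet_char m chi /\ A (char_exp chi n)])
    (chi a)^-1 * rho (char_exp chi n).

Definition Q0 m n a : C := Q_sum m n a [set psi | psi = principal_char m].

Definition Qminus m n a : C := Q_sum m n a [set psi | psi (-1) = -1].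

Definition Qplus m n a : C :=
  Q_sum m n a [set psi | psi (-1) = 1 /\ psi <> principal_char m].

End DirichletCharacters.

Section Xi.
Variable R : realType.
Local Notation C := (Cplx R).

(* k is a positive power of a prime p exactly when p is its only prime
   divisor. *)
Definition von_mangoldt (k : nat) : R :=
  if primes k is [:: p] then ln p%:R else 0.

Definition xi_coef (m n : nat) (a : int) (k : nat) : C :=
  if (k%:Z ^+ n == a %[mod m])%Z then (von_mangoldt k)%:C else 0.

Definition xi (m n : nat) (a : int) : C -> C :=
  dirichlet_series (xi_coef m n a).

End Xi.

(* Main.v *)
(* By orthogonality of the characters modulo [m], on [Re s > 1],
     xi(s) = - 1/phi(m) * sum over chi of chi(a)^-1 * (L'/L)(s, chi^n),
   because [Lambda * 1 = ln] gives [sum psi(k) Lambda(k) k^-s * L(s, psi) =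
   - L'(s, psi)]. The right-hand side is meromorphic on the plane, hence by the
   identity theorem it agrees with any continuation of [xi] near 0, and the
   residue follows by linearity.

   The continuation of a Dirichlet series [D] with [m]-periodic coefficients is
   reduced to an entire function: with [q = m + 1], the coefficients of
   [D(s) * (1 - q^(1-s))] are periodic with mean value zero, so the sum can be
   summed by parts as often as one likes. Since [k^-s] is the power series in
   [s] with coefficients [(- ln k)^i / i!], whose p-th differences in [k] are
   summable with weight [r^i] as soon as [p >= r + 2], the result is a power
   series in [s] with infinite radius of convergence. *)
Require Import Defs.
From HB Require Import structures.
From mathcomp Require Import all_boot all_order all_algebra.
From mathcomp Require Import fingroup cyclic separable cyclotomic mxrepresentation.
From mathcomp Require Import complex ring lra zify.
From mathcomp Require Import all_classical all_reals all_analysis.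

Set Implicit Arguments.
Unset Strict Implicit.
Unset Printing Implicit Defensive.

Import Order.TTheory GRing.Theory Num.Theory.
Import numFieldNormedType.Exports.

Local Open Scope classical_set_scope.
Local Open Scope ring_scope.
Local Open Scope complex_scope.

(** * Unordered sums of complex families *)

(** Since [meromorphic] is stated through Laurent expansions, all of the function theory is done on
    coefficients: products, reciprocals, derivatives and changes of centre are rearrangements of
    absolutely convergent families, and this is why sums are unordered. A Laurent expansion says
    nothing about the value at its centre, and [Lfun psi] is whichever continuation [xget] returns;
    identities between continuations are therefore stated, and residues compared, on punctured
    neighbourhoods. Division by [Lfun psi] is legitimate once it vanishes identically near no point.
    This comes from one nonzero value, that of the series at [s = 3], spread over the plane by the
    identity theorem. Division by [1 - q^(1-s)] is harmless for a different reason: its zeros all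
    lie on [Re s = 1], so only poles on that line can arise. *)

Section Modulus.
Variable R : realType.
Local Notation C := (Cplx R).
Implicit Types (x y z : C).

(** The norm of [R[i]] takes its values in [R[i]]; this is the same modulus as a real number, to
    which suprema and [lra] apply. *)
Definition absC (z : C) : R := ComplexField.Normc.normc z.

Lemma absC_norm z : `|z| = (absC z)%:C :> R[i].
Proof. by []. Qed.

Lemma absC0 : absC 0 = 0. Proof. exact: ComplexField.Normc.normc0. Qed.
Lemma absC1 : absC 1 = 1. Proof. exact: ComplexField.Normc.normc1. Qed.

Lemma absCD x y : absC (x + y) <= absC x + absC y.
Proof. exact: le_normcD. Qed.

Lemma absCN x : absC (- x) = absC x. Proof. exact: normcN. Qed.

Lemma absCM x y : absC (x * y) = absC x * absC y.
Proof. exact: ComplexField.Normc.normcM. Qed.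

Lemma absCV x : absC x^-1 = (absC x)^-1.
Proof. exact: ComplexField.Normc.normcV. Qed.

Lemma absC_ge0 x : 0 <= absC x.
Proof. by case: x => a b; exact: sqrtr_ge0. Qed.

Hint Resolve absC_ge0 : core.

Lemma absC_eq0 x : (absC x == 0) = (x == 0).
Proof.
apply/eqP/eqP => [|->]; last exact: absC0.
exact: ComplexField.Normc.eq0_normc.
Qed.

Lemma absC_gt0 x : (0 < absC x) = (x != 0).
Proof. by rewrite lt_neqAle absC_ge0 andbT eq_sym absC_eq0. Qed.

Lemma absCX x n : absC (x ^+ n) = absC x ^+ n.
Proof. by elim: n => [|n IHn]; rewrite ?expr0 ?absC1// !exprS absCM IHn. Qed.

Lemma absC_distC x y : absC (x - y) = absC (y - x).
Proof. by rewrite -absCN opprB. Qed.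

Lemma absC_sum (I : Type) (s : seq I) (P : pred I) (F : I -> C) :
  absC (\sum_(i <- s | P i) F i) <= \sum_(i <- s | P i) absC (F i).
Proof.
elim/big_ind2 : _ => [|x1 x2 y1 y2 h1 h2|//]; first by rewrite absC0.
exact: le_trans (absCD _ _) (lerD h1 h2).
Qed.

Lemma absC_real (a : R) : absC a%:C = `|a|.
Proof. by rewrite /absC /= expr0n /= addr0 sqrtr_sqr. Qed.

Lemma absC_nat n : absC n%:R = n%:R.
Proof.
have -> : n%:R = (n%:R : R)%:C :> C by rewrite rmorph_nat.
by rewrite absC_real ger0_norm.
Qed.

Lemma ReD x y : complex.Re (x + y) = complex.Re x + complex.Re y.
Proof. by case: x y => [? ?] [? ?]. Qed.
Lemma ImD x y : complex.Im (x + y) = complex.Im x + complex.Im y.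
Proof. by case: x y => [? ?] [? ?]. Qed.
Lemma ReN x : complex.Re (- x) = - complex.Re x.
Proof. by case: x. Qed.
Lemma ImN x : complex.Im (- x) = - complex.Im x.
Proof. by case: x. Qed.
Lemma Re_sum (I : Type) (s : seq I) (P : pred I) (F : I -> C) :
  complex.Re (\sum_(i <- s | P i) F i) = \sum_(i <- s | P i) complex.Re (F i).
Proof. by elim/big_rec2 : _ => // i ? ? _ <-; rewrite ReD. Qed.
Lemma Im_sum (I : Type) (s : seq I) (P : pred I) (F : I -> C) :
  complex.Im (\sum_(i <- s | P i) F i) = \sum_(i <- s | P i) complex.Im (F i).
Proof. by elim/big_rec2 : _ => // i ? ? _ <-; rewrite ImD. Qed.

Lemma Re_le_absC z : `|complex.Re z| <= absC z.
Proof.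
by case: z => a b /=; rewrite /absC /= -sqrtr_sqr ler_wsqrtr // lerDl sqr_ge0.
Qed.

Lemma Im_le_absC z : `|complex.Im z| <= absC z.
Proof.
by case: z => a b /=; rewrite /absC /= -sqrtr_sqr ler_wsqrtr // lerDr sqr_ge0.
Qed.

Lemma absC_le_ReIm z : absC z <= `|complex.Re z| + `|complex.Im z|.
Proof.
have -> : z = (complex.Re z)%:C + 'i%C * (complex.Im z)%:C by exact: complexE.
have -> : complex.Re ((complex.Re z)%:C + 'i%C * (complex.Im z)%:C) =
   complex.Re z by rewrite -complexE.
have -> : complex.Im ((complex.Re z)%:C + 'i%C * (complex.Im z)%:C) =
   complex.Im z by rewrite -complexE.
apply: le_trans (absCD _ _) _; rewrite absCM !absC_real.
have -> : absC 'i%C = 1 by rewrite /absC /= expr0n /= add0r expr1n sqrtr1.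
by rewrite mul1r.
Qed.

Lemma near_absCP (z0 : C) (P : C -> Prop) :
  (\forall z \near z0, P z) <->
  exists2 r : R, 0 < r & forall z : C, absC (z - z0) < r -> P z.
Proof.
split.
  move=> /nbhs_ballP[e /= e0 he].
  have [e1 eE] : exists e1, e = e1%:C.
    by apply/complex_realP; rewrite ger0_real// ltW.
  exists e1; first by rewrite -ltcR -eE.
  by move=> z hz; apply: he; rewrite /ball/= eE absC_norm ltcR absC_distC.
move=> [r r0 hr]; apply/nbhs_ballP; exists r%:C; rewrite /= ?ltcR//.
by move=> z; rewrite /ball/= absC_norm ltcR absC_distC => /hr.
Qed.

Lemma dnear_absCP (z0 : C) (P : C -> Prop) :
  (\forall z \near z0^', P z) <->
  exists2 r : R, 0 < r & forall z : C, z != z0 -> absC (z - z0) < r -> P z.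
Proof.
rewrite near_withinE; split.
  by move=> /near_absCP[r r0 h]; exists r => // z ? ?; apply: h.
by move=> [r r0 h]; apply/near_absCP; exists r => // z ? ?; apply: h.
Qed.

Lemma cvg_absCP (u : nat -> C) (l : C) :
  (u @ \oo --> l) <->
  forall e : R, 0 < e -> exists N, forall n, (N <= n)%N -> absC (u n - l) < e.
Proof.
split.
  move=> /cvgrPdist_lt h e e0.
  have /h[N _ hN] : (0 : R[i]) < e%:C by rewrite ltcR.
  by exists N => n /hN /=; rewrite absC_norm ltcR absC_distC.
move=> h; apply/cvgrPdist_lt => e e0.
have [e1 eE] : exists e1, e = e1%:C.
  by apply/complex_realP; rewrite ger0_real// ltW.
have [|N hN] := h e1; first by rewrite -ltcR -eE.
by exists N => // n /hN; rewrite /= absC_norm eE ltcR absC_distC.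
Qed.

End Modulus.
#[global] Hint Extern 0 (is_true (0 <= absC _)) => solve [exact: absC_ge0] : core.

Section UnorderedSums.
Variable R : realType.
Local Notation C := (Cplx R).

(** Convergence along the directed set of finite subsets, encoded as duplicate-free sequences. As no
    enumeration of the index type is chosen, pairs and fibres are summed without a bijection with
    [nat]. *)
Definition has_sum (T : eqType) (f : T -> C) (S : C) : Prop :=
  forall e : R, 0 < e -> exists s0 : seq T, forall s, uniq s ->
    {subset s0 <= s} -> absC (\sum_(x <- s) f x - S) < e.

Definition abs_summable (T : eqType) (f : T -> C) : Prop :=
  exists M : R, forall s : seq T, uniq s -> \sum_(x <- s) absC (f x) <= M.

Lemma sub_sum_le (T : eqType) (g : T -> R) (s t : seq T) :
  (forall x, 0 <= g x) -> uniq s -> uniq t -> {subset s <= t} ->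
  \sum_(x <- s) g x <= \sum_(x <- t) g x.
Proof.
move=> g0 us ut st.
rewrite [leRHS](bigID (mem s))/= -[X in _ <= X + _]big_filter.
have -> : \sum_(x <- [seq x <- t | x \in s]) g x = \sum_(x <- s) g x.
  apply: perm_big; apply: uniq_perm => //; first exact: filter_uniq.
  by move=> x; rewrite mem_filter andb_idr//; exact: st.
by rewrite lerDl sumr_ge0.
Qed.

Lemma has_sum_unique (T : eqType) (f : T -> C) S S' :
  has_sum f S -> has_sum f S' -> S = S'.
Proof.
move=> h h'; apply/eqP; rewrite -subr_eq0 -absC_eq0 eq_le absC_ge0 andbT.
apply/ler_addgt0Pl => e e0; rewrite addr0.
have e2 : 0 < e / 2 by rewrite divr_gt0.
have [s0 hs0] := h _ e2; have [s1 hs1] := h' _ e2.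
pose s := undup (s0 ++ s1).
have us : uniq s by exact: undup_uniq.
have /(hs0 _ us) a0 : {subset s0 <= s}.
  by move=> x; rewrite mem_undup mem_cat => ->.
have /(hs1 _ us) a1 : {subset s1 <= s}.
  by move=> x; rewrite mem_undup mem_cat => ->; rewrite orbT.
rewrite (_ : S - S' = (\sum_(x <- s) f x - S') - (\sum_(x <- s) f x - S)).
  by apply: le_trans (absCD _ _) _; rewrite absCN [leRHS]splitr lerD ?ltW.
by ring.
Qed.

Lemma has_sumD (T : eqType) (f g : T -> C) S S' :
  has_sum f S -> has_sum g S' -> has_sum (fun x => f x + g x) (S + S').
Proof.
move=> h h' e e0.
have e2 : 0 < e / 2 by rewrite divr_gt0.
have [s0 hs0] := h _ e2; have [s1 hs1] := h' _ e2.
exists (s0 ++ s1) => s us ss.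
rewrite big_split /= opprD addrACA [e]splitr.
apply: le_lt_trans (absCD _ _) _; rewrite ltrD//.
  by apply: hs0 => // x xs; apply: ss; rewrite mem_cat xs.
by apply: hs1 => // x xs; apply: ss; rewrite mem_cat xs orbT.
Qed.

Lemma has_sumZ (T : eqType) (f : T -> C) S a :
  has_sum f S -> has_sum (fun x => a * f x) (a * S).
Proof.
move=> h e e0; have [|s0 hs0] := h (e / (absC a + 1)); first by rewrite divr_gt0// ltr_wpDl.
exists s0 => s us ss; rewrite -mulr_sumr -mulrBr absCM.
have := hs0 _ us ss; rewrite ltr_pdivlMr ?ltr_wpDl// mulrDr mulr1 mulrC.
by apply: le_lt_trans; rewrite lerDl.
Qed.

Lemma eq_has_sum (T : eqType) (f g : T -> C) S :
  f =1 g -> has_sum f S -> has_sum g S.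
Proof. by move=> /funext ->. Qed.

Lemma has_sumN (T : eqType) (f : T -> C) S :
  has_sum f S -> has_sum (fun x => - f x) (- S).
Proof.
move=> h; rewrite -mulN1r; apply: eq_has_sum (has_sumZ (-1) h) => x.
by rewrite mulN1r.
Qed.

Lemma has_sum_finite (T : eqType) (f : T -> C) (s : seq T) :
  uniq s -> (forall x, x \notin s -> f x = 0) -> has_sum f (\sum_(x <- s) f x).
Proof.
move=> us fs e e0; exists s => t ut st.
rewrite (bigID (mem s) _ f)/= [X in _ + X - _]big1; last by move=> i /fs.
rewrite addr0 -big_filter (perm_big s) ?subrr ?absC0//.
apply: uniq_perm => //; first exact: filter_uniq.
by move=> x; rewrite mem_filter andb_idr//; exact: st.
Qed.

Lemma sub_abs_summable (T : eqType) (f g : T -> C) (k : R) :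
  (forall x, absC (g x) <= k * absC (f x)) -> abs_summable f -> abs_summable g.
Proof.
move=> gf [M hM]; exists (`|k| * M) => s us.
apply: le_trans (_ : \sum_(x <- s) `|k| * absC (f x) <= _).
  apply: ler_sum => x _; apply: le_trans (gf x) _.
  by rewrite ler_wpM2r// ler_norm.
by rewrite -mulr_sumr ler_wpM2l// hM.
Qed.

Lemma abs_summableD (T : eqType) (f g : T -> C) :
  abs_summable f -> abs_summable g -> abs_summable (fun x => f x + g x).
Proof.
move=> [M hM] [N hN]; exists (M + N) => s us.
apply: le_trans (lerD (hM s us) (hN s us)); rewrite -big_split /=.
by apply: ler_sum => x _; exact: absCD.
Qed.

Lemma has_sum_big (I T : eqType) (t : seq I) (f : I -> T -> C) (S : I -> C) :
  (forall i, i \in t -> has_sum (f i) (S i)) ->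
  has_sum (fun k => \sum_(i <- t) f i k) (\sum_(i <- t) S i).
Proof.
elim: t => [|i t IHt] h.
  rewrite big_nil; have := @has_sum_finite T (fun=> 0) [::] isT.
  by rewrite big_nil => /(_ (fun _ _ => erefl)); apply: eq_has_sum => k; rewrite big_nil.
rewrite big_cons.
have h1 := h i (mem_head _ _).
have h2 : has_sum (fun k => \sum_(i <- t) f i k) (\sum_(i <- t) S i).
  by apply: IHt => j jt; apply: h; rewrite inE jt orbT.
by apply: eq_has_sum (has_sumD h1 h2) => k; rewrite big_cons.
Qed.

Lemma sup_adherent_sum (T : eqType) (g : T -> R) (M : R) :
  (forall x, 0 <= g x) -> (forall s, uniq s -> \sum_(x <- s) g x <= M) ->
  exists S : R, forall e, 0 < e -> exists s0 : seq T, forall s, uniq s ->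
    {subset s0 <= s} -> `|\sum_(x <- s) g x - S| < e.
Proof.
move=> g0 gM; pose E := [set r | exists2 s : seq T, uniq s & r = \sum_(x <- s) g x].
have supE : has_sup E.
  split; first by exists 0, [::] => //; rewrite big_nil.
  by exists M => _ [s us ->]; exact: gM.
exists (sup E) => e e0; have [_ [s0 us0 ->] hs0] := sup_adherent e0 supE.
exists s0 => s us ss; rewrite distrC ger0_norm.
  rewrite ltrBlDl -ltrBlDr; apply: lt_le_trans hs0 _.
  exact: sub_sum_le.
rewrite subr_ge0; apply: ub_le_sup; first by case: supE.
by exists s.
Qed.

(** Completeness is reduced to suprema: the real and the imaginary parts are each a difference of
    the nonnegative families [|p f| + p f] and [|p f|], whose finite sums are bounded. *)
Lemma abs_summable_sum (T : eqType) (f : T -> C) :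
  abs_summable f -> exists S, has_sum f S.
Proof.
move=> fs.
have real (p : C -> R) : (forall z, `|p z| <= absC z) ->
  (forall s, p (\sum_(x <- s) f x) = \sum_(x <- s) p (f x)) ->
  exists S : R, forall e, 0 < e -> exists s0 : seq T, forall s, uniq s ->
    {subset s0 <= s} -> `|p (\sum_(x <- s) f x) - S| < e.
  move=> pz psum; have [M hM] := fs.
  have [S1 hS1] : exists S : R, forall e, 0 < e -> exists s0 : seq T, forall s, uniq s ->
    {subset s0 <= s} -> `|\sum_(x <- s) (`|p (f x)| + p (f x)) - S| < e.
    apply: (@sup_adherent_sum _ _ (M + M)) => [x|s us].
      by have := ler_norm (- p (f x)); rewrite normrN; lra.
    apply: le_trans (lerD (hM s us) (hM s us)); rewrite -big_split/=.
    apply: ler_sum => x _; rewrite lerD//.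
    exact: le_trans (ler_norm _) (pz _).
  have [S2 hS2] : exists S : R, forall e, 0 < e -> exists s0 : seq T, forall s, uniq s ->
    {subset s0 <= s} -> `|\sum_(x <- s) (`|p (f x)|) - S| < e.
    apply: (@sup_adherent_sum _ _ M) => [x|s us]; first exact: normr_ge0.
    by apply: le_trans (hM s us); apply: ler_sum => x _; exact: pz.
  exists (S1 - S2) => e e0; have e2 : 0 < e / 2 by rewrite divr_gt0.
  have [s1 h1] := hS1 _ e2; have [s2 h2] := hS2 _ e2.
  exists (s1 ++ s2) => s us ss; rewrite psum.
  have /(h1 _ us) a1 : {subset s1 <= s}.
    by move=> x xs; apply: ss; rewrite mem_cat xs.
  have /(h2 _ us) a2 : {subset s2 <= s}.
    by move=> x xs; apply: ss; rewrite mem_cat xs orbT.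
  have -> : \sum_(x <- s) p (f x) - (S1 - S2) =
    (\sum_(x <- s) (`|p (f x)| + p (f x)) - S1) -
      (\sum_(x <- s) `|p (f x)| - S2).
    by rewrite big_split /=; lra.
  apply: le_lt_trans (ler_normB _ _) _.
  by rewrite [e]splitr ltrD.
have [a ha] := real (@complex.Re R) (@Re_le_absC R) (fun s => Re_sum s _ f).
have [b hb] := real (@complex.Im R) (@Im_le_absC R) (fun s => Im_sum s _ f).
exists (a +i* b) => e e0; have e2 : 0 < e / 2 by rewrite divr_gt0.
have [s1 h1] := ha _ e2; have [s2 h2] := hb _ e2.
exists (s1 ++ s2) => s us ss.
have /(h1 _ us) a1 : {subset s1 <= s}.
  by move=> x xs; apply: ss; rewrite mem_cat xs.
have /(h2 _ us) a2 : {subset s2 <= s}.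
  by move=> x xs; apply: ss; rewrite mem_cat xs orbT.
apply: le_lt_trans (absC_le_ReIm _) _.
by rewrite ReD ImD ReN ImN [e]splitr ltrD.
Qed.

(* Sums over the fibres of a map: this is Fubini's theorem for projections, the
   Cauchy product for addition and the Dirichlet convolution for
   multiplication. *)
Lemma fibre_sum (T U : eqType) (p : T -> U) (f : T -> C) (g : U -> C) S :
  abs_summable f -> has_sum f S ->
  (forall u, has_sum (fun x => if p x == u then f x else 0) (g u)) ->
  has_sum g S.
Proof.
move=> fs fS fg e e0; have e3 : 0 < e / 3 by rewrite divr_gt0.
have [s0 hs0] := fS _ (divr_gt0 e0 (ltr0n R 2)).
exists (map p s0) => t ut st.
pose d := e / 2 / (size t).+1%:R.
have d0 : 0 < d by rewrite /d !divr_gt0.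
have hE : forall u, exists s : seq T, forall s', uniq s' -> {subset s <= s'} ->
    absC (\sum_(x <- s') (if p x == u then f x else 0) - g u) < d.
  by move=> u; have [s ?] := fg u _ d0; exists s.
have [h hh] := choice hE.
(* Every point of [s0] lies over [t] and is kept, so [hs0] applies. No point of [s] lies outside the
   fibres over [t], so its sum splits over [t]; the points from [h u] bring each fibre sum within
   [d] of [g u], and the [size t] errors add up to at most [e / 2]. *)
pose s := [seq x <- undup (s0 ++ flatten (map h t)) | p x \in t].
have us : uniq s by rewrite filter_uniq// undup_uniq.
have hs : absC (\sum_(x <- s) f x - S) < e / 2.
  apply: hs0 => // x xs0.
  by rewrite mem_filter mem_undup mem_cat xs0 /= st//; apply/mapP; exists x.
have sE : \sum_(x <- s) f x =
    \sum_(u <- t) \sum_(x <- s) (if p x == u then f x else 0).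
  rewrite exchange_big /=; rewrite big_seq [RHS]big_seq.
  apply: eq_bigr => x; rewrite mem_filter => /andP[pxt _].
  rewrite (bigD1_seq (p x))//= eqxx big1 ?addr0// => u.
  by rewrite eq_sym => /negPf ->.
have -> : \sum_(u <- t) g u - S = (\sum_(x <- s) f x - S) -
    \sum_(u <- t) (\sum_(x <- s) (if p x == u then f x else 0) - g u).
  by rewrite sumrB -sE; ring.
apply: le_lt_trans (absCD _ _) _; rewrite absCN [e]splitr ltr_leD//.
apply: le_trans (absC_sum _ _ _) _.
apply: le_trans (_ : \sum_(u <- t) d <= _); last first.
  rewrite big_const_seq count_predT iter_addr_0 -[leLHS]mulr_natl /d mulrCA.
  apply: ler_piMr; first by rewrite ltW// divr_gt0.
  by rewrite ler_pdivrMr// mul1r ler_nat.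
rewrite big_seq [leRHS]big_seq; apply: ler_sum => u ut'.
(* All points of [h u] lying over [u] are already in [s], so adding [h u] leaves the sum over the
   fibre unchanged. *)
pose s' := undup (s ++ h u).
have -> : \sum_(x <- s) (if p x == u then f x else 0) =
   \sum_(x <- s') (if p x == u then f x else 0).
  rewrite -!big_mkcond /=.
  rewrite -big_filter -[RHS]big_filter; apply: perm_big; apply: uniq_perm.
  - exact: filter_uniq.
  - by rewrite filter_uniq// undup_uniq.
  move=> x; rewrite !(mem_filter _ x) /=; case: eqP => //= pxu.
  rewrite pxu ut' mem_undup [RHS]mem_undup [RHS]mem_cat mem_filter /= pxu ut'.
  rewrite mem_undup mem_cat; case: (x \in s0) => //=.
  case hux : (x \in h u); rewrite ?orbT ?orbF//.
  by apply/flattenP; exists (h u) => //; exact: map_f.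
apply/ltW/hh; first exact: undup_uniq.
by move=> x xh; rewrite mem_undup mem_cat xh orbT.
Qed.

(** Each [g u] is within [1 / (size t).+1] of a finite sum over its fibre. The fibres are disjoint,
    so the moduli in these sums total at most [M], and the errors at most [1]. *)
Lemma fibre_abs_summable (T U : eqType) (p : T -> U) (f : T -> C) (g : U -> C) :
  abs_summable f ->
  (forall u, has_sum (fun x => if p x == u then f x else 0) (g u)) ->
  abs_summable g.
Proof.
move=> [M hM] fg; exists (M + 1) => t ut.
pose d : R := 1 / (size t).+1%:R.
have d0 : 0 < d by rewrite /d !divr_gt0.
have hE : forall u, exists s : seq T, uniq s /\
    absC (\sum_(x <- s) (if p x == u then f x else 0) - g u) < d.
  move=> u; have [s hs] := fg u _ d0; exists (undup s); split.
    exact: undup_uniq.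
  by apply: hs; [exact: undup_uniq|move=> x; rewrite mem_undup].
have [h hh] := choice hE.
pose s := undup (flatten (map h t)).
have us : uniq s by exact: undup_uniq.
apply: le_trans (_ : \sum_(u <- t) (\sum_(x <- s | p x == u) absC (f x) + d) <= _).
  rewrite big_seq [leRHS]big_seq; apply: ler_sum => u ut'.
  have [uh hu] := hh u; rewrite -lerBlDl.
  apply: le_trans (_ : absC (g u) - absC
    (\sum_(x <- h u) (if p x == u then f x else 0)) <= _).
    rewrite lerD2l lerN2 -big_mkcond; apply: le_trans (absC_sum _ _ _) _.
    rewrite -big_filter -[leRHS]big_filter; apply: sub_sum_le => //.
    - exact: filter_uniq.
    - exact: filter_uniq.
    move=> x; rewrite !mem_filter => /andP[-> xh] /=; rewrite mem_undup.
    by apply/flattenP; exists (h u) => //; exact: map_f.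
  apply/ltW; apply: le_lt_trans hu.
  set Z := \sum_(x <- h u) _; rewrite absC_distC lerBlDr.
  by have := absCD (g u - Z) Z; rewrite subrK.
rewrite big_split /= lerD//.
  apply: le_trans (hM s us).
  rewrite (exchange_big_dep predT)//=; apply: ler_sum => x _.
  rewrite big_const_seq iter_addr_0.
  have: (count (fun u => p x == u) t <= 1)%N.
    by rewrite (@eq_count _ _ (pred1 (p x))) ?count_uniq_mem ?leq_b1// => u /=; exact: eq_sym.
  by case: (count _ _) => [|[|//]] _; rewrite ?mulr0n ?mulr1n.
rewrite big_const_seq count_predT iter_addr_0 -[leLHS]mulr_natl /d mulrA mulr1.
by rewrite ler_pdivrMr// mul1r ler_nat.
Qed.

Lemma has_sum_le (T : eqType) (f : T -> C) S (M : R) :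
  has_sum f S -> (forall s, uniq s -> \sum_(x <- s) absC (f x) <= M) ->
  absC S <= M.
Proof.
move=> fS fM; apply/ler_addgt0Pl => e e0; have [s0 hs0] := fS _ e0.
have us := undup_uniq s0.
have h : absC (\sum_(x <- undup s0) f x - S) < e.
  by apply: hs0 => // x; rewrite mem_undup.
have := absCD (S - \sum_(x <- undup s0) f x) (\sum_(x <- undup s0) f x).
rewrite subrK => /le_trans; apply; rewrite lerD//.
  by rewrite absC_distC ltW.
exact: le_trans (absC_sum _ _ _) (fM _ us).
Qed.

(** The partial inverse [k] recognises the range of [h], outside which [F] vanishes, and [pmap k]
    pulls a finite subset of [T] back to [U]. *)
Lemma has_sum_inj (T U : eqType) (h : U -> T) (k : T -> option U) (F : T -> C) S :
  pcancel h k -> (forall x, if k x is Some u then h u = x else F x = 0) ->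
  has_sum (F \o h) S -> has_sum F S.
Proof.
move=> hk kF hS e e0; have [s0 hs0] := hS e e0.
exists (map h s0) => s us ss.
have -> : \sum_(x <- s) F x = \sum_(u <- pmap k s) (F \o h) u.
  elim: s {us ss} => [|x s IHs]; first by rewrite !big_nil.
  rewrite big_cons /= IHs; case E: (k x) (kF x) => [u|] /=.
    by rewrite big_cons /= => ->.
  by move=> ->; rewrite add0r.
apply: hs0.
  have kI x y u : k x = Some u -> k y = Some u -> x = y.
    by move=> Ex Ey; have := kF x; have := kF y; rewrite Ex Ey => <- <-.
  elim: s us {ss} => //= x s IHs /andP[xs /IHs us].
  case E: (k x) => [u|] //=; rewrite us andbT; apply: contra xs.
  by rewrite mem_pmap => /mapP[y ys /esym Ey]; rewrite (kI _ _ _ E Ey).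
move=> u us0; rewrite mem_pmap; apply/mapP; exists (h u); last by rewrite hk.
by apply: ss; apply/mapP; exists u.
Qed.

Lemma has_sum_row (T U : eqType) (F : T * U -> C) i S :
  has_sum (fun j => F (i, j)) S ->
  has_sum (fun x => if x.1 == i then F x else 0) S.
Proof.
move=> h; apply: (@has_sum_inj _ _ (fun j => (i, j))
  (fun x => if x.1 == i then Some x.2 else None)) => [j|[i' j] /=|].
- by rewrite /= eqxx.
- by case: eqP => // ->.
- by apply: eq_has_sum h => j /=; rewrite eqxx.
Qed.

Lemma has_sum_col (T U : eqType) (F : T * U -> C) j S :
  has_sum (fun i => F (i, j)) S ->
  has_sum (fun x => if x.2 == j then F x else 0) S.
Proof.
move=> h; apply: (@has_sum_inj _ _ (fun i => (i, j))
  (fun x => if x.2 == j then Some x.1 else None)) => [i|[i j'] /=|].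
- by rewrite /= eqxx.
- by case: eqP => // ->.
- by apply: eq_has_sum h => i /=; rewrite eqxx.
Qed.

Lemma abs_summable_pair (T U : eqType) (F : T * U -> C) (b : T -> R) (M : R) :
  (forall i s, uniq s -> \sum_(j <- s) absC (F (i, j)) <= b i) ->
  (forall s, uniq s -> \sum_(i <- s) b i <= M) ->
  abs_summable F.
Proof.
move=> Fb bM; exists M => s us.
pose s1 := undup (map fst s); pose s2 := undup (map snd s).
apply: le_trans (_ : \sum_(x <- [seq (i, j) | i <- s1, j <- s2]) absC (F x) <= _).
  apply: sub_sum_le => //.
    by apply: allpairs_uniq; rewrite ?undup_uniq// => -[? ?] [? ?].
  move=> [i j] ij; apply/allpairsP; exists (i, j) => /=; rewrite !mem_undup.
  by split => //; apply/mapP; exists (i, j).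
rewrite big_allpairs; apply: le_trans (bM s1 (undup_uniq _)).
by apply: ler_sum => i _; apply: Fb; exact: undup_uniq.
Qed.

Lemma abs_summable_le (T : eqType) (f : T -> C) :
  abs_summable f ->
  exists2 M : R, 0 <= M & forall s, uniq s -> \sum_(x <- s) absC (f x) <= M.
Proof. by move=> [M hM]; exists M => //; have := hM [::] isT; rewrite big_nil. Qed.

(** Both iterated sums equal the sum over pairs. The recentring of power series, the expansion of a
    Dirichlet series around a point and that of the regularised series are all instances. *)
Lemma has_sum_row_col (T U : eqType) (F : T * U -> C) (f : T -> C) (g : U -> C) S :
  abs_summable F -> (forall i, has_sum (fun j => F (i, j)) (f i)) ->
  (forall j, has_sum (fun i => F (i, j)) (g j)) -> has_sum f S ->
  abs_summable g /\ has_sum g S.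
Proof.
move=> Fs Ff Fg fS; have [S' FS'] := abs_summable_sum Fs.
have fS' : has_sum f S'.
  by apply: (fibre_sum Fs FS' (p := fst)) => i; exact: has_sum_row.
rewrite (has_sum_unique fS fS'); split.
  by apply: (fibre_abs_summable Fs (p := snd)) => j; exact: has_sum_col.
by apply: (fibre_sum Fs FS' (p := snd)) => j; exact: has_sum_col.
Qed.

Lemma abs_summable_col (T U : eqType) (F : T * U -> C) j :
  abs_summable F -> abs_summable (fun i => F (i, j)).
Proof.
move=> [M hM]; exists M => s us.
have := hM (map (fun i => (i, j)) s); rewrite big_map map_inj_uniq; first exact.
by move=> ? ? [].
Qed.

Lemma abs_summableM (T U : eqType) (f : T -> C) (g : U -> C) :
  abs_summable f -> abs_summable g -> abs_summable (fun x : T * U => f x.1 * g x.2).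
Proof.
move=> /abs_summable_le[M M0 hM] /abs_summable_le[N N0 hN].
apply: (@abs_summable_pair _ _ _ (fun i => absC (f i) * N) (M * N)) => [i s us|s us].
  rewrite (eq_bigr (fun j => absC (f i) * absC (g j))) => [|j _]; last first.
    by rewrite /= absCM.
  by rewrite -mulr_sumr ler_wpM2l// hN.
by rewrite -mulr_suml ler_wpM2r// hM.
Qed.

Lemma has_sumM (T U : eqType) (f : T -> C) (g : U -> C) S S' :
  abs_summable f -> abs_summable g -> has_sum f S -> has_sum g S' ->
  has_sum (fun x : T * U => f x.1 * g x.2) (S * S').
Proof.
move=> fs gs fS gS; have Fs := abs_summableM fs gs.
have [X FX] := abs_summable_sum Fs.
suff -> : S * S' = X by [].
apply: (@has_sum_unique _ (fun i => f i * S')).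
  rewrite mulrC; apply: eq_has_sum (has_sumZ S' fS) => i.
  by rewrite mulrC.
apply: (fibre_sum Fs FX (p := fst)) => i.
by apply: (@has_sum_row _ _ (fun x => f x.1 * g x.2)); exact: (has_sumZ (f i) gS).
Qed.

Lemma has_sum_series (f : nat -> C) S : has_sum f S -> series f @ \oo --> S.
Proof.
move=> fS; apply/cvg_absCP => e e0; have [s0 hs0] := fS e e0.
exists (\max_(i <- s0) i).+1 => n hn; apply: hs0; first exact: iota_uniq.
move=> i is0; rewrite mem_index_iota /=.
by apply: leq_trans hn; rewrite ltnS; exact: (@leq_bigmax_seq _ s0 xpredT id).
Qed.

Lemma series_lim (f : nat -> C) S : series f @ \oo --> S -> limn (series f) = S.
Proof. by move=> h; apply/cvg_lim => //; exact: norm_hausdorff. Qed.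

Lemma cvgC_unique (u : nat -> C) (l l' : C) : u @ \oo --> l -> u @ \oo --> l' -> l = l'.
Proof.
move=> h h'; have hd : hausdorff_space C by exact: norm_hausdorff.
by rewrite -(cvg_lim hd h) -(cvg_lim hd h').
Qed.

Lemma sum_nat_seq_le (g : nat -> R) (s : seq nat) : (forall i, 0 <= g i) ->
  uniq s -> \sum_(i <- s) g i <= \sum_(0 <= i < (\max_(i <- s) i).+1) g i.
Proof.
move=> g0 us; apply: sub_sum_le => //; first exact: iota_uniq.
move=> i is0; rewrite mem_index_iota /= ltnS.
exact: (@leq_bigmax_seq _ s xpredT id).
Qed.

Lemma abs_summable_nat (f : nat -> C) (M : R) :
  (forall n, \sum_(0 <= i < n) absC (f i) <= M) -> abs_summable f.
Proof.
by move=> h; exists M => s us; apply: le_trans (h _); exact: sum_nat_seq_le.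
Qed.

Lemma has_sum_of_series (f : nat -> C) S :
  abs_summable f -> series f @ \oo --> S -> has_sum f S.
Proof.
move=> /abs_summable_sum[S' fS'] fS.
by rewrite (cvgC_unique fS (has_sum_series fS')).
Qed.

End UnorderedSums.

(** * Power series *)

Section PowerSeries.
Variable R : realType.
Local Notation C := (Cplx R).
Implicit Types (c d : nat -> C) (w z : C) (f g : C -> C).

Definition psum c w : C := limn (series (fun k => c k * w ^+ k)).

(** A lower bound for the radius of convergence, not its exact value; an entire series satisfies
    this for all [r]. *)
Definition conv_radius c (r : R) : Prop :=
  forall w, absC w < r -> abs_summable (fun k => c k * w ^+ k).

Lemma conv_radiusW c r s : s <= r -> conv_radius c r -> conv_radius c s.
Proof. by move=> sr h w ws; apply: h; exact: lt_le_trans sr. Qed.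

Lemma psum_has_sum c r w : conv_radius c r -> absC w < r ->
  has_sum (fun k => c k * w ^+ k) (psum c w).
Proof.
move=> h /h/abs_summable_sum[S hS].
by rewrite /psum (series_lim (has_sum_series hS)).
Qed.

Lemma psumE c w S : has_sum (fun k => c k * w ^+ k) S -> psum c w = S.
Proof. by move=> hS; rewrite /psum (series_lim (has_sum_series hS)). Qed.

Lemma psum_cvg c r w : conv_radius c r -> absC w < r ->
  series (fun k => c k * w ^+ k) @ \oo --> psum c w.
Proof. by move=> h /(psum_has_sum h)/has_sum_series. Qed.

Lemma geometric_sum_le (q : R) n : 0 <= q < 1 ->
  \sum_(0 <= i < n) q ^+ i <= (1 - q)^-1.
Proof.
move=> /andP[q0 q1]; rewrite -[leRHS]mul1r ler_pdivlMr ?subr_gt0//.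
rewrite mulr_suml; have -> : \sum_(0 <= i < n) q ^+ i * (1 - q) = 1 - q ^+ n.
  elim: n => [|n IHn]; first by rewrite big_nil expr0 subrr.
  by rewrite big_nat_recr//= IHn exprS; ring.
by rewrite gerBl exprn_ge0.
Qed.

(** Abel's lemma: the terms at [w] are at most [M] times the powers of [|w| / r < 1]. *)
Lemma conv_radius_bounded c (r M : R) : 0 < r ->
  (forall k, absC (c k) * r ^+ k <= M) -> conv_radius c r.
Proof.
move=> r0 hM w wr; pose q := absC w / r.
have q01 : 0 <= q < 1.
  by rewrite /q divr_ge0 ?(ltW r0)//= ltr_pdivrMr// mul1r.
have M0 : 0 <= M by apply: le_trans (hM 0); rewrite expr0 mulr1.
apply: (@abs_summable_nat _ _ (M * (1 - q)^-1)) => n.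
apply: le_trans (_ : \sum_(0 <= i < n) M * q ^+ i <= _).
  apply: ler_sum => i _; rewrite absCM absCX.
  rewrite (_ : absC w ^+ i = r ^+ i * q ^+ i).
    by rewrite mulrA ler_wpM2r ?exprn_ge0//; case/andP: q01.
  by rewrite -exprMn /q mulrCA divff ?mulr1// gt_eqF.
by rewrite -mulr_sumr ler_wpM2l// geometric_sum_le.
Qed.

Lemma conv_radius_cvg c (r : R) (S : C) : 0 < r ->
  series (fun k => c k * r%:C ^+ k) @ \oo --> S -> conv_radius c r.
Proof.
move=> r0 /cvg_absCP hS; have [N hN] := hS 1 ltr01.
(* The finite sum covers the terms before [N]; a later term is the difference of two partial sums
   within [1] of [S], hence the [2]. *)
pose M := \sum_(0 <= i < N) absC (c i) * r ^+ i + 2.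
apply: (@conv_radius_bounded c r M) => // k.
have -> : absC (c k) * r ^+ k = absC (c k * r%:C ^+ k).
  by rewrite absCM absCX absC_real gtr0_norm.
have [kN|Nk] := ltnP k N.
  rewrite /M (bigD1_seq k) ?mem_index_iota ?iota_uniq//=.
  rewrite absCM absCX absC_real gtr0_norm// -addrA lerDl addr_ge0//.
  by apply: sumr_ge0 => i _; rewrite mulr_ge0 ?exprn_ge0// ltW.
have -> : c k * r%:C ^+ k = (series (fun k => c k * r%:C ^+ k) k.+1 - S) -
    (series (fun k => c k * r%:C ^+ k) k - S).
  by rewrite /series /= big_nat_recr//=; ring.
apply: le_trans (absCD _ _) _; rewrite absCN.
have h1 := hN k.+1 (leqW Nk); have h2 := hN k Nk.
have : 0 <= \sum_(0 <= i < N) absC (c i) * r ^+ i.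
  by apply: sumr_ge0 => i _; rewrite mulr_ge0 ?exprn_ge0// ltW.
rewrite /M; lra.
Qed.

Lemma conv_radius_summable c r (rho : R) : conv_radius c r ->
  0 <= rho < r -> exists2 M : R, 0 <= M &
    forall n, \sum_(0 <= i < n) absC (c i) * rho ^+ i <= M.
Proof.
move=> h /andP[rho0 rhor].
have [|M M0 hM] := abs_summable_le (h rho%:C _).
  by rewrite absC_real ger0_norm.
exists M => // n; have := hM (index_iota 0 n) (iota_uniq _ _).
by under eq_bigr do rewrite absCM absCX absC_real ger0_norm//.
Qed.

Definition laurent_on f z0 (N : nat) c (r : R) : Prop :=
  [/\ 0 < r, conv_radius c r &
    forall w, w != 0 -> absC w < r -> w ^+ N * f (z0 + w) = psum c w].

(** By Abel's lemma, convergence at one point at distance [r / 2] from [z0] gives absolute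
    convergence in the open disc of that radius. The sequential limit in [laurent_at] thus becomes
    an unordered sum. *)
Lemma laurent_atP f z0 N c :
  laurent_at f z0 N c <-> exists r, laurent_on f z0 N c r.
Proof.
split=> [/dnear_absCP[r r0 h]|[r [r0 hc h]]].
  have r20 : 0 < r / 2 by rewrite divr_gt0.
  have hc : conv_radius c (r / 2).
    have := h (z0 + (r / 2)%:C); rewrite [z0 + _]addrC addrK => /(_ _ _)/conv_radius_cvg.
    apply=> //; last by rewrite absC_real gtr0_norm//; lra.
    rewrite -subr_eq0 addrK; apply/eqP => /(congr1 (@complex.Re R)) /=; lra.
  exists (r / 2); split => // w w0 wr.
  apply: (@cvgC_unique _ (series (fun k => c k * w ^+ k))); last exact: psum_cvg wr.
  have := h (z0 + w); rewrite [z0 + w]addrC addrK; apply; last by lra.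
  by rewrite -subr_eq0 addrK.
apply/dnear_absCP; exists r => // z zz0 zr.
have := h (z - z0); rewrite subr_eq0 [z0 + _]addrC subrK => -> //.
exact: psum_cvg zr.
Qed.

Lemma psum0 w : psum (fun=> 0) w = 0.
Proof.
apply: psumE; have := @has_sum_finite R _ (fun k => 0 * w ^+ k) [::] isT.
by rewrite big_nil; apply => k _; rewrite mul0r.
Qed.

Lemma conv_radius_poly c n r : (forall k, (n <= k)%N -> c k = 0) -> conv_radius c r.
Proof.
move=> h w _; apply: (@abs_summable_nat _ _
  (\sum_(0 <= i < n) absC (c i * w ^+ i))) => m.
have [mn|nm] := leqP m n.
  by rewrite [leRHS](big_cat_nat _ mn)//= lerDl sumr_ge0.
rewrite (big_cat_nat _ (ltnW nm))//= gerDl big_nat big1// => i /andP[/h -> _].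
by rewrite mul0r absC0.
Qed.

Lemma psum_poly c n w : (forall k, (n <= k)%N -> c k = 0) ->
  psum c w = \sum_(0 <= i < n) c i * w ^+ i.
Proof.
move=> h; apply: psumE; apply: has_sum_finite; first exact: iota_uniq.
by move=> k; rewrite mem_index_iota /= -leqNgt => /h ->; rewrite mul0r.
Qed.

Lemma conv_radiusD c d r : conv_radius c r -> conv_radius d r ->
  conv_radius (fun k => c k + d k) r.
Proof.
move=> h h' w wr; have := abs_summableD (h w wr) (h' w wr).
by apply: sub_abs_summable (1) _ => k; rewrite mul1r mulrDl.
Qed.

Lemma psumD c d r w : conv_radius c r -> conv_radius d r -> absC w < r ->
  psum (fun k => c k + d k) w = psum c w + psum d w.
Proof.
move=> h h' wr; apply: psumE.
apply: eq_has_sum (has_sumD (psum_has_sum h wr) (psum_has_sum h' wr)) => k.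
by rewrite mulrDl.
Qed.

Lemma conv_radiusZ a c r : conv_radius c r -> conv_radius (fun k => a * c k) r.
Proof.
move=> h w wr; apply: sub_abs_summable (absC a) _ (h w wr) => k.
by rewrite -mulrA absCM.
Qed.

Lemma psumZ a c r w : conv_radius c r -> absC w < r ->
  psum (fun k => a * c k) w = a * psum c w.
Proof.
move=> h wr; apply: psumE; apply: eq_has_sum (has_sumZ a (psum_has_sum h wr)) => k.
by rewrite mulrA.
Qed.

Definition cauchy_prod c d n : C := \sum_(0 <= i < n.+1) c i * d (n - i)%N.

Lemma cauchy_prod_fibre c d w n :
  has_sum (fun x : nat * nat => if (x.1 + x.2)%N == n then
    (c x.1 * w ^+ x.1) * (d x.2 * w ^+ x.2) else 0) (cauchy_prod c d n * w ^+ n).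
Proof.
pose s := [seq (i, (n - i)%N) | i <- index_iota 0 n.+1].
have := @has_sum_finite R _ (fun x : nat * nat => if (x.1 + x.2)%N == n then
    (c x.1 * w ^+ x.1) * (d x.2 * w ^+ x.2) else 0) s.
rewrite big_map big_nat; rewrite /cauchy_prod [in X in _ -> X]big_nat mulr_suml.
rewrite (eq_bigr (fun i => c i * d (n - i)%N * w ^+ n)); last first.
  move=> i /andP[_ /=]; rewrite ltnS => iln; rewrite /= subnKC // eqxx.
  have -> : w ^+ n = w ^+ i * w ^+ (n - i) by rewrite -exprD subnKC.
  by ring.
apply; first by rewrite map_inj_uniq ?iota_uniq// => ? ? [].
move=> [i j] /= ijs; case: eqP => // E; case/negP: ijs.
apply/mapP; exists i; first by rewrite mem_index_iota /=; lia.
by congr pair; lia.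
Qed.

Lemma conv_radiusM c d r : conv_radius c r -> conv_radius d r ->
  conv_radius (cauchy_prod c d) r.
Proof.
move=> h h' w wr; have := abs_summableM (h w wr) (h' w wr).
move/(fibre_abs_summable (p := fun x : nat * nat => (x.1 + x.2)%N)); apply.
exact: cauchy_prod_fibre.
Qed.

Lemma psumM c d r w : conv_radius c r -> conv_radius d r -> absC w < r ->
  psum (cauchy_prod c d) w = psum c w * psum d w.
Proof.
move=> h h' wr; apply: psumE.
apply: (fibre_sum (p := fun x : nat * nat => (x.1 + x.2)%N)).
- exact: abs_summableM (h w wr) (h' w wr).
- exact: has_sumM (h w wr) (h' w wr) (psum_has_sum h wr) (psum_has_sum h' wr).
- exact: cauchy_prod_fibre.
Qed.

Definition shift_coef n c k : C := if (k < n)%N then 0 else c (k - n)%N.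

Lemma shift_coef_fibre n c w S :
  has_sum (fun k => c k * w ^+ k) S ->
  has_sum (fun k => shift_coef n c k * w ^+ k) (w ^+ n * S).
Proof.
move=> h; apply: (@has_sum_inj _ _ _ (fun k => (k + n)%N)
  (fun k => if (k < n)%N then None else Some (k - n)%N)) => [k|k|].
- by rewrite ltnNge leq_addl /= addnK.
- by rewrite /shift_coef; case: ltnP => kn; rewrite ?mul0r// subnK.
apply: eq_has_sum (has_sumZ (w ^+ n) h) => k /=.
by rewrite /shift_coef ltnNge leq_addl /= addnK exprD; ring.
Qed.

Lemma conv_radius_shift n c r : conv_radius c r -> conv_radius (shift_coef n c) r.
Proof.
move=> h w wr; have [M hM] := h w wr.
apply: (@abs_summable_nat _ _ (absC (w ^+ n) * M)) => m.
apply: le_trans (_ : \sum_(0 <= i < m + n) absC (shift_coef n c i * w ^+ i) <= _).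
  by rewrite [leRHS](big_cat_nat _ (leq_addr n m))//= lerDl sumr_ge0.
rewrite (big_cat_nat _ (leq_addl m n))//= [X in X + _]big_nat big1 ?add0r; last first.
  by move=> i /andP[_ h']; rewrite /shift_coef h' mul0r absC0.
rewrite -{1}[n]add0n big_addn addnK.
apply: le_trans (ler_wpM2l (absC_ge0 _) (hM (index_iota 0 m) (iota_uniq _ _))).
rewrite mulr_sumr; apply: ler_sum => i _.
rewrite -absCM /shift_coef ltnNge leq_addl /= addnK exprD.
by rewrite [X in absC X <= _](_ : _ = w ^+ n * (c i * w ^+ i))//; ring.
Qed.

Lemma psum_shift n c r w : conv_radius c r -> absC w < r ->
  psum (shift_coef n c) w = w ^+ n * psum c w.
Proof. by move=> h /(psum_has_sum h)/(shift_coef_fibre n)/psumE. Qed.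

Lemma conv_radius_drop n c r : conv_radius c r -> 
  conv_radius (fun k => c (k + n)%N) r.
Proof.
move=> h w wr; have [->|w0] := eqVneq w 0.
  apply: (@abs_summable_nat _ _ (absC (c n))) => m.
  case: m => [|m]; first by rewrite big_nil.
  rewrite big_nat_recl//= big1 ?addr0 ?expr0 ?mulr1 ?add0n// => i _.
  by rewrite exprS mul0r mulr0 absC0.
have [M hM] := h w wr.
apply: (@abs_summable_nat _ _ ((absC (w ^+ n))^-1 * M)) => m.
have wn0 : absC (w ^+ n) != 0 by rewrite absC_eq0 expf_neq0.
rewrite -ler_pdivrMl ?invr_gt0 ?lt_neqAle 1?eq_sym ?wn0 ?absC_ge0// invrK.
have := hM (map (fun k => (k + n)%N) (index_iota 0 m)).
rewrite big_map map_inj_uniq; last exact: addIn.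
move=> /(_ (iota_uniq _ _)); apply: le_trans.
rewrite mulr_sumr; apply: ler_sum => i _.
rewrite -absCM exprD.
by rewrite [X in absC X <= _](_ : _ = c (i + n)%N * (w ^+ i * w ^+ n))//; ring.
Qed.

(** Once [w] is factored out, the remaining series is bounded on the half disc by its absolute sum
    at [r / 2]. The estimate yields both nonvanishing near [0] and, applied to the shifted series,
    the derivative. *)
Lemma psum_near0 c r : 0 < r -> conv_radius c r ->
  exists K : R, forall w, absC w <= r / 2 -> absC (psum c w - c 0) <= absC w * K.
Proof.
move=> r0 h; have h1 := conv_radius_drop 1 h.
have [|K K0 hK] := conv_radius_summable (rho := r / 2) h1; first by lra.
exists K => w wr.
have wr' : absC w < r by lra.
have -> : psum c w - c 0 = w * psum (fun k => c (k + 1)%N) w.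
  have -> : psum c w = psum (fun k => c 0 *+ (k == 0) +
      shift_coef 1 (fun k => c (k + 1)%N) k) w.
    congr psum; apply/funext => -[|k] /=; rewrite /shift_coef /= ?addr0//.
    by rewrite add0r subn1 addn1.
  have p0 : forall k, (1 <= k)%N -> c 0 *+ (k == 0) = 0 by case.
  rewrite (psumD (r := r)) ?(psum_shift 1 h1)//.
  - rewrite (psum_poly _ p0) big_nat1 expr0 expr1 /=; ring.
  - exact: conv_radius_poly p0.
  - exact: conv_radius_shift.
rewrite absCM ler_wpM2l//; apply: (has_sum_le (psum_has_sum h1 wr')) => s us.
apply: le_trans (sum_nat_seq_le _ us) _ => //.
apply: le_trans (hK _); apply: ler_sum => i _.
by rewrite absCM absCX ler_wpM2l// lerXn2r// nnegrE// ltW// divr_gt0.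
Qed.

Lemma psum_neq0_near c r : 0 < r -> conv_radius c r -> c 0 != 0 ->
  exists2 d : R, 0 < d & forall w, absC w < d -> psum c w != 0.
Proof.
move=> r0 h c0; have [K hK] := psum_near0 r0 h.
have c0' : 0 < absC (c 0) by rewrite absC_gt0.
exists (Num.min (r / 2) (absC (c 0) / (`|K| + 1))).
  by rewrite lt_min !divr_gt0// ltr_wpDl.
move=> w; rewrite lt_min => /andP[wr]; rewrite ltr_pdivlMr ?ltr_wpDl// => wK.
apply/eqP => E; have := hK w (ltW wr); rewrite E sub0r absCN leNgt => /negP; apply.
apply: le_lt_trans wK; apply: ler_wpM2l => //.
by apply: le_trans (ler_norm _) _; rewrite lerDl.
Qed.

Lemma psum_factor c r : conv_radius c r ->
  (forall k, c k = 0) \/ exists n e, [/\ conv_radius e r, e 0%N != 0,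
     c = shift_coef n e & forall w, absC w < r -> psum c w = w ^+ n * psum e w].
Proof.
move=> h; have [/existsNP[k /eqP ck]|/contrapT] := pselect (~ forall k, c k = 0);
  last by left.
have ex : exists k, c k != 0 by exists k.
have [n cn nmin] := ex_minnP ex.
right; exists n, (fun k => c (k + n)%N).
have cE : c = shift_coef n (fun k => c (k + n)%N).
  apply/funext => i; rewrite /shift_coef; case: ltnP => [ni|ni]; last by rewrite subnK.
  by apply/eqP; apply: contraTT ni => /nmin; rewrite -leqNgt.
have h' := conv_radius_drop n h.
by split => // w wr; rewrite [in LHS]cE (psum_shift n h').
Qed.

(** Otherwise [psum c w] is a power of [w] times a series without zeros near [0], which is refuted
    at a small real point. *)
Lemma psum_eq0 c r : 0 < r -> conv_radius c r ->
  (forall w, w != 0 -> absC w < r -> psum c w = 0) -> forall k, c k = 0.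
Proof.
move=> r0 h c0; have [//|[n [e [he e0 _ ce]]]] := psum_factor h.
have [d d0 hd] := psum_neq0_near r0 he e0.
pose t := Num.min (r / 2) (d / 2).
have t0 : 0 < t by rewrite lt_min !divr_gt0.
have tr : t < r by rewrite gt_min; apply/orP; left; lra.
have td : t < d by rewrite gt_min; apply/orP; right; lra.
have tC : absC t%:C = t by rewrite absC_real gtr0_norm.
have tC0 : t%:C != 0 :> C by rewrite -absC_eq0 tC gt_eqF.
have := c0 t%:C tC0; rewrite tC ce ?tC// => /(_ tr)/eqP.
by rewrite mulf_eq0 expf_eq0 (negPf tC0) andbF /= (negPf (hd _ _))// tC.
Qed.

(** The coefficients of the reciprocal series are solved for one at a time, each from all the
    earlier ones; hence the recursion returns their list. *)
Fixpoint inv_coefs c (n : nat) : seq C :=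
  if n is n'.+1 then
    rcons (inv_coefs c n') (- (c 0%N)^-1 *
      \sum_(0 <= i < n'.+1) c i.+1 * nth 0 (inv_coefs c n') (n' - i)%N)
  else [:: (c 0%N)^-1].

Definition inv_coef c n := nth 0 (inv_coefs c n) n.

Lemma size_inv_coefs c n : size (inv_coefs c n) = n.+1.
Proof. by elim: n => //= n IHn; rewrite size_rcons IHn. Qed.

Lemma nth_inv_coefs c n k : (k <= n)%N -> nth 0 (inv_coefs c n) k = inv_coef c k.
Proof.
elim: n => [|n IHn]; first by rewrite leqn0 => /eqP ->.
rewrite leq_eqVlt => /predU1P[->//|]; rewrite ltnS => kn /=.
by rewrite nth_rcons size_inv_coefs ltnS kn IHn.
Qed.

Lemma inv_coefS c n : inv_coef c n.+1 =
  - (c 0%N)^-1 * \sum_(0 <= i < n.+1) c i.+1 * inv_coef c (n - i)%N.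
Proof.
rewrite /inv_coef /= nth_rcons size_inv_coefs ltnn eqxx; congr (_ * _).
by apply: eq_bigr => i _; rewrite nth_inv_coefs// leq_subr.
Qed.

Lemma psumV c r : 0 < r -> conv_radius c r -> c 0%N != 0 ->
  exists2 d : R, 0 < d <= r & conv_radius (inv_coef c) d /\
    forall w, absC w < d -> psum c w * psum (inv_coef c) w = 1.
Proof.
move=> r0 h c0; pose c0a := absC (c 0%N).
have c0' : 0 < c0a by rewrite absC_gt0.
have h1 := conv_radius_drop 1 h.
have [|M M0 hM] := conv_radius_summable (rho := r / 2) h1; first by lra.
(* [t <= r / 2] lets [M] bound the shifted coefficients, and [t * M <= |c 0|] closes the induction
   for [|inv_coef c n| * t ^ n <= 1 / |c 0|]. The denominator [M + 1] cannot be zero. *)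
pose t := Num.min (r / 2) (c0a / (M + 1)).
have t0 : 0 < t by rewrite lt_min !divr_gt0// ltr_wpDl.
have tr : t <= r / 2 by rewrite ge_min lexx.
have tM : t * M <= c0a.
  apply: le_trans (_ : t * (M + 1) <= _); first by rewrite ler_wpM2l ?(ltW t0)//; lra.
  by rewrite -ler_pdivlMr ?ltr_wpDl// ge_min lexx orbT.
have bnd n : absC (inv_coef c n) * t ^+ n <= c0a^-1.
  elim/ltn_ind: n => -[_|n IHn]; first by rewrite /inv_coef /= expr0 mulr1 absCV.
  rewrite inv_coefS absCM absCN absCV -/c0a -mulrA ler_piMr ?invr_ge0 ?(ltW c0')//.
  apply: le_trans (ler_wpM2r (exprn_ge0 _ (ltW t0)) (absC_sum _ _ _)) _.
  apply: le_trans (_ : \sum_(0 <= i < n.+1)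
      t * c0a^-1 * (absC (c (i + 1)%N) * (r / 2) ^+ i) <= _).
    rewrite mulr_suml big_nat [leRHS]big_nat; apply: ler_sum => i /andP[_ /= iln].
    have := IHn (n - i)%N; rewrite ltnS leq_subr => /(_ isT) hi.
    rewrite absCM addn1 (_ : t ^+ n.+1 = t * t ^+ i * t ^+ (n - i)); last first.
      by rewrite -exprS -exprD; congr (_ ^+ _); lia.
    rewrite [leLHS](_ : _ = (t * (absC (c i.+1) * t ^+ i)) *
      (absC (inv_coef c (n - i)) * t ^+ (n - i))); last by ring.
    rewrite [leRHS](_ : _ = (t * (absC (c i.+1) * (r / 2) ^+ i)) * c0a^-1); last by ring.
    have ti : t ^+ i <= (r / 2) ^+ i by rewrite lerXn2r// nnegrE ltW// divr_gt0.
    apply: ler_pM => //.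
    - by rewrite !mulr_ge0 ?exprn_ge0// ltW.
    - by rewrite mulr_ge0 ?exprn_ge0// ltW.
    - by apply: ler_wpM2l; [exact: ltW|exact: ler_wpM2l].
  rewrite -mulr_sumr -mulrA mulrCA -ler_pdivlMl ?invr_gt0// invrK mulr1.
  apply: le_trans tM; apply: ler_wpM2l; [exact: ltW|exact: hM].
have hd : conv_radius (inv_coef c) t by exact: conv_radius_bounded bnd.
exists t; first by rewrite t0 /=; lra.
split=> // w wt; have hc : conv_radius c t by apply: conv_radiusW h; lra.
rewrite -(psumM hc hd wt).
have cE n : cauchy_prod c (inv_coef c) n = (n == 0%N)%:R.
  rewrite /cauchy_prod big_nat_recl// subn0; case: n => [|n].
    by rewrite big_nil addr0 /inv_coef /= divff.
  rewrite inv_coefS mulrA mulrN mulfV// mulN1r.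
  under [X in _ + X]eq_bigr do rewrite subSS.
  by rewrite addNr.
rewrite (@psum_poly _ 1); last by case=> // n _; rewrite cE.
by rewrite big_nat1 cE expr0 mulr1.
Qed.

End PowerSeries.

(** * Derivatives and changes of centre *)

Lemma is_derive_quot_pow (K : numFieldType) (p : K -> K) (z z0 dp : K) N :
  z != z0 -> is_derive z 1 p dp ->
  is_derive z 1 (fun y => p y / (y - z0) ^+ N)
    (dp / (z - z0) ^+ N - N%:R * p z / (z - z0) ^+ N.+1).
Proof.
move=> zz0 pd; have z0' : z - z0 != 0 by rewrite subr_eq0.
have ld : is_derive z 1 (fun y : K => y - z0) 1 by exact: is_derive_shift.
pose q : K -> K := (fun y => y - z0) ^+ N.
have qE y : q y = (y - z0) ^+ N by rewrite /q fctE.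
have qd : is_derive z 1 q ((N%:R * (z - z0) ^+ N.-1) *: (1 : K)) by exact: is_deriveX.
have qz0 : q z != 0 by rewrite qE expf_neq0.
have qvd : is_derive z 1 (fun y => (q y)^-1)
    (- (q z) ^- 2 *: ((N%:R * (z - z0) ^+ N.-1) *: (1 : K))).
  apply: DeriveDef; first by apply: derivableV => //; exact: ex_derive.
  by rewrite deriveV ?derive_val//; exact: ex_derive.
have := is_deriveM pd qvd.
rewrite (_ : p * _ = fun y => p y / (y - z0) ^+ N); last first.
  by apply/funext => y; rewrite fctE qE.
set a := (X in is_derive _ _ _ X -> _); set b := (X in _ -> is_derive _ _ _ X).
rewrite (_ : a = b)// /a /b /GRing.scale /= qE.
case: N {ld q qE qd qz0 qvd a b} => [|N].
  by rewrite !mul0r !mulr0 add0r subr0 expr0 invr1 mul1r mulr1.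
rewrite /= !exprS; field.
by rewrite z0' expf_neq0.
Qed.

Section Derivative.
Variable R : realType.
Local Notation C := (Cplx R).
Implicit Types (c d : nat -> C) (w z : C) (f g : C -> C).

Lemma psum_at0 c : psum c 0 = c 0%N.
Proof.
apply: psumE; have := @has_sum_finite R _ (fun k => c k * 0 ^+ k) [:: 0%N] isT.
by rewrite big_seq1 expr0 mulr1; apply => -[//|k] _; rewrite exprS mul0r mulr0.
Qed.

Lemma is_derive_pow_expansion f z d r : 0 < r -> conv_radius d r ->
  (forall h, absC h < r -> f (z + h) = psum d h) ->
  is_derive z 1 f (d 1%N).
Proof.
move=> r0 hd fE.
have cv : (fun h : C => (h : R[i])^-1 *: ((f \o shift z) ((h : R[i]) *: (1 : C)) - f z))
    @ (0 : C)^' --> d 1%N.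
  apply/cvgrPdist_lt => e e0.
  have [e1 eE] : exists e1, e = e1%:C.
    by apply/complex_realP; rewrite ger0_real// ltW.
  have e10 : 0 < e1 by rewrite -ltcR -eE.
  have h1 := conv_radius_drop 1 hd.
  have [K hK] := psum_near0 r0 h1.
  apply/dnear_absCP; exists (Num.min (r / 2) (e1 / (`|K| + 1))).
    by rewrite lt_min !divr_gt0// ltr_wpDl.
  move=> h h0; rewrite subr0 lt_min => /andP[hr].
  rewrite ltr_pdivlMr ?ltr_wpDl// => hK1.
  have hr' : absC h < r by lra.
  have fz : f z = d 0%N.
    by rewrite -[z]addr0 fE ?absC0// psum_at0.
  have fzh : f (z + h) - f z = h * psum (fun k => d (k + 1)%N) h.
    rewrite fE// fz.
    have -> : psum d h = psum (fun k => d 0%N *+ (k == 0%N) +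
        shift_coef 1 (fun k => d (k + 1)%N) k) h.
      congr psum; apply/funext => -[|k] /=; rewrite /shift_coef /= ?addr0//.
      by rewrite add0r subn1 addn1.
    have p0 : forall k, (1 <= k)%N -> d 0%N *+ (k == 0%N) = 0 by case.
    rewrite (psumD (r := r)) ?(psum_shift 1 h1)//.
    - rewrite (psum_poly _ p0) big_nat1 expr0 expr1 /=; ring.
    - exact: conv_radius_poly p0.
    - exact: conv_radius_shift.
  rewrite /= scaler1 [h + z]addrC fzh.
  have -> : h^-1 *: (h * psum (fun k => d (k + 1)%N) h) = psum (fun k => d (k + 1)%N) h.
    by rewrite /GRing.scale /= mulKf.
  rewrite absC_norm eE ltcR absC_distC.
  apply: le_lt_trans (hK h (ltW hr)) _.
  apply: le_lt_trans hK1; rewrite ler_wpM2l//.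
  by apply: le_trans (ler_norm _) _; rewrite lerDl.
apply: DeriveDef; first exact: cvgP cv.
by apply/cvg_lim => //; exact: norm_hausdorff.
Qed.

Lemma sum_support_le (g : nat -> R) n (s : seq nat) : (forall i, 0 <= g i) ->
  (forall i, (n <= i)%N -> g i = 0) -> uniq s ->
  \sum_(i <- s) g i <= \sum_(0 <= i < n) g i.
Proof.
move=> g0 gn us; rewrite (bigID (fun i => i < n)%N)/= [X in _ + X]big1 ?addr0.
  rewrite -big_filter; apply: sub_sum_le => //; first exact: filter_uniq.
    exact: iota_uniq.
  by move=> i; rewrite mem_filter mem_index_iota /= => /andP[].
by move=> i; rewrite -leqNgt => /gn.
Qed.

(** The binomial expansion of [c i * (w + h) ^+ i], with [j] running over all of [nat]: for [j > i]
    the binomial coefficient is [0], whatever the truncated difference [i - j]. *)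
Definition recentre_fam c w h (x : nat * nat) : C :=
  c x.1 * (w ^+ (x.1 - x.2) * h ^+ x.2 *+ 'C(x.1, x.2)).

Lemma recentre_fam_summable c r w h : conv_radius c r -> absC w + absC h < r ->
  abs_summable (recentre_fam c w h).
Proof.
move=> hc whr; have [|M M0 hM] := conv_radius_summable (rho := absC w + absC h) hc.
  by rewrite addr_ge0.
apply: (@abs_summable_pair R _ _ _ (fun i => absC (c i) * (absC w + absC h) ^+ i) M).
  move=> i s us; apply: le_trans (sum_support_le (n := i.+1) _ _ us) _ => //.
    by move=> j ij; rewrite /recentre_fam /= bin_small// mulr0n mulr0 absC0.
  rewrite exprDn mulr_sumr big_mkord; apply: ler_sum => j _.
  rewrite /recentre_fam /= absCM ler_wpM2l// -mulr_natr absCM absC_nat.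
  by rewrite absCM !absCX mulr_natr.
move=> s us; apply: le_trans (hM (\max_(i <- s) i).+1); apply: sum_nat_seq_le => //.
by move=> i; rewrite mulr_ge0 ?exprn_ge0 ?addr_ge0.
Qed.

Lemma recentre_fam_row c w h i :
  has_sum (fun j => recentre_fam c w h (i, j)) (c i * (w + h) ^+ i).
Proof.
rewrite exprDn mulr_sumr -(big_mkord predT (fun j => recentre_fam c w h (i, j))).
apply: has_sum_finite; first exact: iota_uniq.
move=> j; rewrite mem_index_iota /= -leqNgt => ij.
by rewrite /recentre_fam /= bin_small// mulr0n mulr0.
Qed.

Definition recentre_coef c w j : C :=
  limn (series (fun i => c i * (w ^+ (i - j) *+ 'C(i, j)))).

Lemma recentre_coef_sum c r w j : conv_radius c r -> absC w < r ->
  abs_summable (fun i => c i * (w ^+ (i - j) *+ 'C(i, j))) /\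
  has_sum (fun i => c i * (w ^+ (i - j) *+ 'C(i, j))) (recentre_coef c w j).
Proof.
move=> hc wr; pose h0 : R := (r - absC w) / 2.
have h00 : 0 < h0 by rewrite /h0; lra.
have habs : absC h0%:C = h0 by rewrite absC_real gtr0_norm.
have Fs : abs_summable (recentre_fam c w h0%:C).
  by apply: recentre_fam_summable hc _; rewrite habs /h0; lra.
have s1 : abs_summable (fun i => c i * (w ^+ (i - j) *+ 'C(i, j))).
  apply: sub_abs_summable ((h0 ^+ j)^-1) _ (abs_summable_col j Fs) => i.
  rewrite /recentre_fam /= -[X in _ <= _ * absC (_ * X)]mulrnAl.
  rewrite [in leRHS]mulrA [in leRHS]absCM absCX habs mulrCA mulVf ?mulr1//.
  by rewrite expf_neq0// gt_eqF.
split=> //; have [S hS] := abs_summable_sum s1.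
by rewrite /recentre_coef (series_lim (has_sum_series hS)).
Qed.

Lemma psum_recentre c r w : conv_radius c r -> absC w < r ->
  conv_radius (recentre_coef c w) (r - absC w) /\
  forall h, absC h < r - absC w -> psum c (w + h) = psum (recentre_coef c w) h.
Proof.
move=> hc wr.
suff H h : absC h < r - absC w ->
    abs_summable (fun j => recentre_coef c w j * h ^+ j) /\
    has_sum (fun j => recentre_coef c w j * h ^+ j) (psum c (w + h)).
  by split=> h /H[h1 h2]; [exact: h1|rewrite (psumE h2)].
move=> hr; have whr : absC w + absC h < r by lra.
apply: (has_sum_row_col (F := recentre_fam c w h)).
- exact: recentre_fam_summable hc whr.
- exact: recentre_fam_row.
- move=> j; have [_ h2] := recentre_coef_sum j hc wr.
  rewrite mulrC; apply: eq_has_sum (has_sumZ (h ^+ j) h2) => i.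
  by rewrite /recentre_fam /= -mulrnAl mulrC -mulrA.
- apply: psum_has_sum hc _; apply: le_lt_trans whr; exact: absCD.
Qed.

Lemma recentre_coef1 c r w : conv_radius c r -> absC w < r ->
  abs_summable (fun k => k%:R * c k * w ^+ k) /\
  w * recentre_coef c w 1 = psum (fun k => k%:R * c k) w.
Proof.
move=> hc wr; have [h1 h2] := recentre_coef_sum 1 hc wr.
have E k : w * (c k * (w ^+ (k - 1) *+ 'C(k, 1))) = k%:R * c k * w ^+ k.
  rewrite bin1; case: k => [|k]; first by rewrite mulr0n !mulr0 !mul0r.
  by rewrite subn1 /= -mulr_natl exprS; ring.
split; last by apply/esym/psumE; apply: eq_has_sum (has_sumZ w h2) => k; exact: E.
by apply: sub_abs_summable (absC w) _ h1 => k; rewrite -E absCM.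
Qed.

Lemma conv_radius_natM c r : conv_radius c r -> conv_radius (fun k => k%:R * c k) r.
Proof. by move=> hc w wr; have [] := recentre_coef1 hc wr. Qed.

(** [w ^+ N.+1 * f'] is [w d/dw - N] applied to [w ^+ N * f], and [w d/dw] multiplies the [k]-th
    coefficient by [k] without shifting indices. *)
Lemma laurent_on_derive1 f z0 N c r : laurent_on f z0 N c r ->
  laurent_on (derive1 f) z0 N.+1 (fun k => k%:R * c k + (- N%:R) * c k) r.
Proof.
move=> [r0 hc fE]; split=> //.
  by apply: conv_radiusD; [exact: conv_radius_natM|exact: conv_radiusZ].
move=> w w0 wr; rewrite (psumD _ _ wr) ?(psumZ _ hc)//; last 2 first.
- exact: conv_radius_natM.
- exact: conv_radiusZ.
have [hd dE] := psum_recentre hc wr; have [_ <-] := recentre_coef1 hc wr.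
have wr0 : 0 < r - absC w by lra.
have pd : is_derive (z0 + w : C) 1 (fun z => psum c (z - z0)) (recentre_coef c w 1).
  apply: is_derive_pow_expansion wr0 hd _ => h hr.
  by rewrite -(dE _ hr) (_ : z0 + w + h - z0 = w + h); [|ring].
have zw0 : z0 + w != z0 by rewrite -subr_eq0 addrC addKr.
have fd := is_derive_quot_pow N zw0 pd.
have ffd : is_derive (z0 + w : C) 1 f (recentre_coef c w 1 / (z0 + w - z0) ^+ N -
    N%:R * psum c (z0 + w - z0) / (z0 + w - z0) ^+ N.+1).
  apply: near_eq_is_derive fd; apply/near_absCP.
  (* The expansion of [f] holds on a punctured disc only: the neighbourhood has to miss [z0] as well
     as stay within the radius [r]. *)
  exists (Num.min (absC w) (r - absC w)); first by rewrite lt_min wr0 absC_gt0 w0.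
  move=> z; rewrite lt_min => /andP[zw zr].
  pose v := z - z0.
  have v0 : v != 0.
    have wE : - (z - (z0 + w)) = w - v by rewrite /v; ring.
    by apply/eqP => v0; move: zw; rewrite -absCN wE v0 subr0 ltxx.
  have vr : absC v < r.
    have := absCD (z - (z0 + w)) w; rewrite (_ : z - (z0 + w) + w = v); last first.
      by rewrite /v; ring.
    by move=> /le_lt_trans; apply; lra.
  have zE : z0 + v = z by rewrite /v addrC subrK.
  rewrite -/v -(fE v v0 vr) zE mulrC; apply: mulKf.
  exact: expf_neq0.
have -> : derive1 f (z0 + w) = recentre_coef c w 1 / w ^+ N -
    N%:R * psum c w / w ^+ N.+1.
  by rewrite derive1E (@derive_val _ _ _ _ _ _ _ ffd) [z0 + w]addrC addrK.
have w0N n : w ^+ n != 0 by exact: expf_neq0.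
rewrite mulrBr [w ^+ N.+1 * (_ / w ^+ N.+1)]mulrC mulfVK// mulNr.
by rewrite exprS -mulrA [w ^+ N * _]mulrC mulfVK.
Qed.

End Derivative.

(** * Meromorphic functions, the identity theorem and residues *)

Section Meromorphic.
Variable R : realType.
Local Notation C := (Cplx R).
Implicit Types (c d : nat -> C) (w z : C) (f g : C -> C).

Definition mero_at f z0 := exists N c, laurent_at f z0 N c.

Lemma laurent_onW f z0 N c (r s : R) : 0 < s -> s <= r -> laurent_on f z0 N c r ->
  laurent_on f z0 N c s.
Proof.
move=> s0 sr [_ hc h]; split=> //; first exact: conv_radiusW hc.
by move=> w w0 ws; apply: h => //; exact: lt_le_trans sr.
Qed.

Lemma laurent_on_eq f g z0 N c r : laurent_on f z0 N c r ->
  (\forall z \near z0^', f z = g z) -> exists s, laurent_on g z0 N c s.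
Proof.
move=> [r0 hc h] /dnear_absCP[s s0 fg].
exists (Num.min r s); split; first by rewrite lt_min r0.
  by apply: conv_radiusW hc; rewrite ge_min lexx.
move=> w w0; rewrite lt_min => /andP[wr ws]; rewrite -fg ?h//.
  by rewrite -subr_eq0 addrC addKr.
by rewrite [z0 + w]addrC addrK.
Qed.

Lemma laurent_at_eq f g z0 N c : laurent_at f z0 N c ->
  (\forall z \near z0^', f z = g z) -> laurent_at g z0 N c.
Proof. by move=> /laurent_atP[r h] /(laurent_on_eq h)/laurent_atP. Qed.

Lemma mero_at_eq f g z0 : mero_at f z0 ->
  (\forall z \near z0^', f z = g z) -> mero_at g z0.
Proof. by move=> [N [c h]] fg; exists N, c; exact: laurent_at_eq fg. Qed.

Lemma laurent_at_pair f g z0 N c N' d : laurent_at f z0 N c -> laurent_at g z0 N' d ->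
  exists r, laurent_on f z0 N c r /\ laurent_on g z0 N' d r.
Proof.
move=> /laurent_atP[r h] /laurent_atP[s h']; exists (Num.min r s).
have [r0 _ _] := h; have [s0 _ _] := h'.
by split; [apply: laurent_onW h|apply: laurent_onW h'];
  rewrite ?lt_min ?r0 ?s0// ge_min lexx ?orbT.
Qed.

Lemma laurent_at_cst (a : C) z0 : laurent_at (fun=> a) z0 0 (fun k => a *+ (k == 0%N)).
Proof.
have p0 : forall k, (1 <= k)%N -> a *+ (k == 0%N) = 0 by case.
apply/laurent_atP; exists 1; split => //; first exact: conv_radius_poly p0.
by move=> w _ _; rewrite (psum_poly _ p0) big_nat1 !expr0 mul1r mulr1.
Qed.

Lemma laurent_atD f g z0 N c N' d : laurent_at f z0 N c -> laurent_at g z0 N' d ->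
  laurent_at (fun z => f z + g z) z0 (N + N')
    (fun k => shift_coef N' c k + shift_coef N d k).
Proof.
move=> h h'; have [r [[r0 hc hf] [_ hd hg]]] := laurent_at_pair h h'.
apply/laurent_atP; exists r; split => //.
  by apply: conv_radiusD; exact: conv_radius_shift.
move=> w w0 wr; rewrite (psumD (r := r))//; try exact: conv_radius_shift.
rewrite (psum_shift _ hc)// (psum_shift _ hd)// -hf// -hg// exprD; ring.
Qed.

Lemma laurent_atZ a f z0 N c : laurent_at f z0 N c ->
  laurent_at (fun z => a * f z) z0 N (fun k => a * c k).
Proof.
move=> /laurent_atP[r [r0 hc h]]; apply/laurent_atP; exists r; split => //.
  exact: conv_radiusZ.
by move=> w w0 wr; rewrite (psumZ _ hc)// -h// mulrCA.
Qed.

Lemma laurent_atM f g z0 N c N' d : laurent_at f z0 N c -> laurent_at g z0 N' d ->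
  laurent_at (fun z => f z * g z) z0 (N + N') (cauchy_prod c d).
Proof.
move=> h h'; have [r [[r0 hc hf] [_ hd hg]]] := laurent_at_pair h h'.
apply/laurent_atP; exists r; split => //; first exact: conv_radiusM.
by move=> w w0 wr; rewrite (psumM hc hd)// -hf// -hg// exprD; ring.
Qed.

Lemma mero_at_cst a z0 : mero_at (fun=> a) z0.
Proof. by exists 0%N, (fun k => a *+ (k == 0%N)); exact: laurent_at_cst. Qed.

Lemma mero_atD f g z0 : mero_at f z0 -> mero_at g z0 -> mero_at (fun z => f z + g z) z0.
Proof.
move=> [N [c h]] [N' [d h']]; exists (N + N')%N; eexists.
exact: laurent_atD h h'.
Qed.

Lemma mero_atM f g z0 : mero_at f z0 -> mero_at g z0 -> mero_at (fun z => f z * g z) z0.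
Proof.
move=> [N [c h]] [N' [d h']]; exists (N + N')%N; eexists.
exact: laurent_atM h h'.
Qed.

Lemma mero_at_sum (I : eqType) (t : seq I) (F : I -> C -> C) z0 :
  (forall i, i \in t -> mero_at (F i) z0) ->
  mero_at (fun z => \sum_(i <- t) F i z) z0.
Proof.
elim: t => [|i t IHt] h.
  rewrite (_ : (fun z => _) = (fun=> 0)); first exact: mero_at_cst.
  by apply/funext => z; rewrite big_nil.
rewrite (_ : (fun z => _) = (fun z => F i z + \sum_(i <- t) F i z)).
  apply: mero_atD (h i (mem_head _ _)) (IHt _) => j jt.
  by apply: h; rewrite inE jt orbT.
by apply/funext => z; rewrite big_cons.
Qed.

Lemma mero_at_derive1 f z0 : mero_at f z0 -> mero_at (derive1 f) z0.
Proof.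
move=> [N [c /laurent_atP[r h]]]; exists N.+1; eexists.
by apply/laurent_atP; exists r; exact: laurent_on_derive1 h.
Qed.

Lemma psum_recentre_on c r z1 : conv_radius c r -> absC z1 < r ->
  laurent_on (psum c) z1 0 (recentre_coef c z1) (r - absC z1).
Proof.
move=> hc zr; have [h1 h2] := psum_recentre hc zr.
by split=> [|//|w _ wr]; rewrite ?subr_gt0// expr0 mul1r h2.
Qed.

Lemma mero_at_entire c z0 : (forall r, conv_radius c r) -> mero_at (psum c) z0.
Proof.
move=> h; exists 0%N; eexists; apply/laurent_atP.
exists (absC z0 + 1 - absC z0); apply: psum_recentre_on (h _) _.
by rewrite ltrDl.
Qed.

Lemma analytic_mero_at f z0 : analytic_at f z0 -> mero_at f z0.
Proof.
move=> [c /near_absCP[r r0 h]]; exists 0%N, c.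
by apply/dnear_absCP; exists r => // z _ /h; rewrite expr0 mul1r.
Qed.

Definition zero_near f z0 := \forall z \near z0^', f z = 0.

(** The local normal form: apart from the identically zero case, [w ^+ N * f] is [w ^+ M] times a
    series without zeros in the disc. Isolated zeros and reciprocals both follow from it. *)
Lemma mero_zero_or_nonzero f z0 : mero_at f z0 ->
  zero_near f z0 \/ exists N c M e r, [/\ laurent_on f z0 N c r, conv_radius e r,
    forall w, absC w < r -> psum c w = w ^+ M * psum e w &
    forall w, absC w < r -> psum e w != 0].
Proof.
move=> [N [c /laurent_atP[r h]]]; have [r0 hc hf] := h.
have [c0|[M [e [he e0 _ ce]]]] := psum_factor hc.
  left; apply/dnear_absCP; exists r => // z zz0 zr.
  have z0' : z - z0 != 0 by rewrite subr_eq0.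
  have := hf _ z0' zr; rewrite [z0 + _]addrC subrK => /eqP.
  have -> : c = (fun=> 0) by apply/funext.
  by rewrite psum0 mulf_eq0 expf_eq0 (negPf z0') andbF /= => /eqP.
right; have [d d0 hd] := psum_neq0_near r0 he e0.
exists N, c, M, e, (Num.min r d).
have rd : 0 < Num.min r d by rewrite lt_min r0.
have rdr : Num.min r d <= r by rewrite ge_min lexx.
split=> [||w wr|w].
- exact: laurent_onW h.
- exact: conv_radiusW he.
- by rewrite ce//; exact: lt_le_trans rdr.
- by rewrite lt_min => /andP[_]; exact: hd.
Qed.

Lemma mero_dichotomy f z0 : mero_at f z0 ->
  zero_near f z0 \/ \forall z \near z0^', f z != 0.
Proof.
move=> /mero_zero_or_nonzero[|[N [c [M [e [r [[r0 hc hf] he ce e0]]]]]]]; first by left.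
right; apply/dnear_absCP; exists r => // z zz0 zr.
have z0' : z - z0 != 0 by rewrite subr_eq0.
have := hf _ z0' zr; rewrite [z0 + _]addrC subrK ce// => h.
apply/eqP => fz; move: h; rewrite fz mulr0 => /esym/eqP; apply/negP.
by rewrite mulf_neq0 ?expf_neq0 ?e0.
Qed.

(** The normal form gives [w ^+ M * f^-1 = w ^+ N * (psum e w)^-1]. If [f] vanishes near [z0], so
    does its inverse, by the convention [0^-1 = 0]. *)
Lemma mero_atV f z0 : mero_at f z0 -> mero_at (fun z => (f z)^-1) z0.
Proof.
move=> /mero_zero_or_nonzero[/dnear_absCP[r r0 f0]|].
  apply: mero_at_eq (mero_at_cst 0 z0) _; apply/dnear_absCP; exists r => // z zz0 zr.
  by rewrite f0// invr0.
move=> [N [c [M [e [r [[r0 hc hf] he ce e0]]]]]].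
have e00 : e 0%N != 0 by rewrite -psum_at0 e0// absC0.
have [d /andP[d0 dr] [hi ei]] := psumV r0 he e00.
exists M, (shift_coef N (inv_coef e)); apply/laurent_atP; exists d; split=> //.
  exact: conv_radius_shift.
move=> w w0 wd; have wr : absC w < r by exact: lt_le_trans dr.
rewrite (psum_shift _ hi)//.
have pe := e0 _ wr.
have -> : psum (inv_coef e) w = (psum e w)^-1.
  by apply: (mulfI pe); rewrite ei// mulfV.
have := hf _ w0 wr; rewrite ce// => E.
have f0 : f (z0 + w) != 0.
  apply/eqP => f0; move: E; rewrite f0 mulr0 => /esym/eqP; apply/negP.
  by rewrite mulf_neq0 ?expf_neq0.
apply: (mulIf f0); rewrite mulfVK// mulrAC E mulrAC; field.
exact: pe.
Qed.

Lemma zero_near_ball f z0 : zero_near f z0 ->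
  exists2 r : R, 0 < r & forall z, absC (z - z0) < r -> zero_near f z.
Proof.
move=> /[dup] f0 /dnear_absCP[r r0 h]; exists r => // z zr.
have [->//|zz0] := eqVneq z z0.
apply/dnear_absCP; exists (Num.min (r - absC (z - z0)) (absC (z - z0))).
  by rewrite lt_min subr_gt0 zr absC_gt0 subr_eq0.
move=> y yz; rewrite lt_min => /andP[y1 y2]; apply: h.
  by apply/eqP => yz0; rewrite yz0 absC_distC ltxx in y2.
have := absCD (y - z) (z - z0); rewrite (_ : y - z + (z - z0) = y - z0); last by ring.
by move=> /le_lt_trans; apply; lra.
Qed.

Lemma zero_near_not_nonzero f z0 (r : R) z1 : 0 < r ->
  (forall z, z != z0 -> absC (z - z0) < r -> f z != 0) ->
  absC (z1 - z0) < r -> ~ zero_near f z1.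
Proof.
move=> r0 h z1r /dnear_absCP[s s0 hs].
pose t := Num.min ((r - absC (z1 - z0)) / 2) (s / 2).
have t0 : 0 < t by rewrite lt_min !divr_gt0// subr_gt0.
have tr : t < r - absC (z1 - z0).
  by rewrite gt_min; apply/orP; left; move: z1r; lra.
have ts : t < s by rewrite gt_min; apply/orP; right; lra.
have habs (b : R) : absC b%:C = `|b| by exact: absC_real.
(* At a point [z1 + b] other than [z0], the two hypotheses would give opposite conclusions. Both
   [b = t] and [b = - t] then lead to [z0], which is absurd. *)
have key (b : R) : `|b| = t -> z1 + b%:C = z0.
  move=> bt; apply/eqP/negPn/negP => zz0.
  have b0 : z1 + b%:C != z1.
    by rewrite -subr_eq0 addrC addKr -absC_eq0 habs bt gt_eqF.
  have lt_r : absC (z1 + b%:C - z0) < r.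
    have := absCD (b%:C) (z1 - z0); rewrite habs bt.
    rewrite (_ : b%:C + (z1 - z0) = z1 + b%:C - z0); last by ring.
    by move=> /le_lt_trans; apply; lra.
  have fz : f (z1 + b%:C) = 0 by apply: hs; rewrite // [z1 + _]addrC addrK habs bt.
  by have := h _ zz0 lt_r; rewrite fz eqxx.
have k1 := key t (gtr0_norm t0).
have k2 : z1 + (- t)%:C = z0 by apply: key; rewrite normrN gtr0_norm.
have : z1 + t%:C = z1 + (- t)%:C by rewrite k1 k2.
move=> /addrI/complexI; lra.
Qed.

(* The points of the segment from [z1] to [z2] near which [f] vanishes form an
   open set by [zero_near_ball], and a closed one by [mero_dichotomy]. *)
Lemma mero_identity f z1 z2 : (forall z, mero_at f z) ->
  zero_near f z1 -> zero_near f z2.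
Proof.
move=> fm f1; pose G (t : R) : C := z1 + t%:C * (z2 - z1).
have G0 : G 0 = z1 by rewrite /G mul0r addr0.
have G1 : G 1 = z2 by rewrite /G mul1r addrC subrK.
have GB t s : absC (G t - G s) = `|t - s| * absC (z2 - z1).
  rewrite (_ : G t - G s = (t - s)%:C * (z2 - z1)) ?absCM ?absC_real//.
  by rewrite /G rmorphB /=; ring.
(* The added [1] keeps [D] positive when [z1 = z2]. *)
pose D := absC (z2 - z1) + 1.
have D0 : 0 < D by rewrite /D ltr_wpDl.
have GD t s e : `|t - s| < e / D -> absC (G t - G s) < e.
  rewrite GB ltr_pdivlMr// /D => /(le_lt_trans _); apply.
  by rewrite ler_wpM2l// lerDl.
pose A := [set t : R | 0 <= t <= 1 /\ forall s, 0 <= s <= t -> zero_near f (G s)].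
have A0 : A 0.
  split; first by rewrite lexx ler01.
  by move=> s /andP[s0 s0']; rewrite (_ : s = 0) ?G0//; apply/eqP; rewrite eq_le s0 s0'.
have supA : has_sup A by split; [exists 0|exists 1 => t [/andP[]]].
pose T := sup A.
have T0 : 0 <= T by apply: ub_le_sup => //; case: supA.
have T1 : T <= 1 by apply: ge_sup; [exists 0|move=> t [/andP[]]].
have below s : 0 <= s -> s < T -> zero_near f (G s).
  move=> s0 sT; have [t [_ ht] st] := sup_gt (proj1 supA) sT.
  by apply: ht; rewrite s0 ltW.
have GT : zero_near f (G T).
  have [//|/dnear_absCP[r r0 h]] := mero_dichotomy (fm (G T)).
  exfalso; have [T00|T00] := eqVneq T 0.
    apply: (zero_near_not_nonzero (z1 := G T) r0 h); first by rewrite subrr absC0.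
    by rewrite T00 G0.
  have Tp : 0 < T by rewrite lt_neqAle eq_sym T00.
  pose s := Num.max 0 (T - r / D / 2).
  have rD : 0 < r / D by rewrite divr_gt0.
  have s0 : 0 <= s by rewrite le_max lexx.
  have sT : s < T by rewrite gt_max Tp /=; lra.
  apply: (zero_near_not_nonzero (z1 := G s) r0 h); last exact: below.
  apply: GD; rewrite distrC gtr0_norm ?subr_gt0//.
  have : T - r / D / 2 <= s by rewrite le_max lexx orbT.
  lra.
have [r r0 h] := zero_near_ball GT.
have rD : 0 < r / D by rewrite divr_gt0.
have near s : `|s - T| < r / D -> zero_near f (G s) by move=> /GD /h.
have [T1'|T1'] := eqVneq T 1; first by rewrite -G1 -T1'.
have Tlt : T < 1 by rewrite lt_neqAle T1'.
pose u := Num.min 1 (T + r / D / 2).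
have Tu : T < u by rewrite lt_min Tlt /=; lra.
suff Au : A u by have := ub_le_sup (proj2 supA) Au; rewrite leNgt Tu.
split; first by rewrite ge_min lexx andbT ltW// (le_lt_trans T0 Tu).
move=> s /andP[s0 su]; have [sT|Ts] := ltP s T; first exact: below.
apply: near; rewrite ger0_norm ?subr_ge0//.
have : u <= T + r / D / 2 by rewrite ge_min lexx orbT.
lra.
Qed.

Definition residue_coef N c : C := if N is N'.+1 then c N' else 0.

(** Raising the declared pole order by [M] shifts the coefficients along with it, so the one of
    exponent [-1] is unchanged; two summands can thus be brought to the order [N + N']. *)
Lemma residue_coef_shift N M c :
  residue_coef (N + M) (shift_coef M c) = residue_coef N c.
Proof.
rewrite /residue_coef /shift_coef; case: N => [|N].
  by case: M => [//|M]; rewrite add0n ltnSn.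
by rewrite addSn ltnNge leq_addl addnK.
Qed.

Lemma residueP f z0 : mero_at f z0 -> is_residue f z0 (residue f z0).
Proof.
move=> [N [c h]]; have ex : [set r | is_residue f z0 r] (if N is N'.+1 then c N' else 0).
  by exists N, c.
exact: (xgetI _ ex).
Qed.

Lemma is_residue_eq f g z0 a : is_residue f z0 a ->
  (\forall z \near z0^', f z = g z) -> is_residue g z0 a.
Proof. by move=> [N [c [h ->]]] fg; exists N, c; split; [exact: laurent_at_eq h fg|]. Qed.

Lemma is_residue_cst (a : C) z0 : is_residue (fun=> a) z0 0.
Proof. by exists 0%N, (fun k => a *+ (k == 0%N)); split; [exact: laurent_at_cst|]. Qed.

Lemma is_residueD f g z0 a b : is_residue f z0 a -> is_residue g z0 b ->
  is_residue (fun z => f z + g z) z0 (a + b).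
Proof.
move=> [N [c [h ->]]] [N' [d [h' ->]]].
exists (N + N')%N; eexists; split; first exact: laurent_atD h h'.
rewrite -/(residue_coef N c) -/(residue_coef N' d).
rewrite -(residue_coef_shift N N') -(residue_coef_shift N' N) [(N' + N)%N]addnC.
by rewrite /residue_coef; case: (N + N')%N => [|//]; rewrite addr0.
Qed.

Lemma is_residueZ t f z0 a : is_residue f z0 a -> is_residue (fun z => t * f z) z0 (t * a).
Proof.
move=> [N [c [h ->]]]; exists N, (fun k => t * c k); split; first exact: laurent_atZ.
by case: N h => [|//] _; rewrite mulr0.
Qed.

Lemma is_residue_sum (I : eqType) (t : seq I) (F : I -> C -> C) (a : I -> C) z0 :
  (forall i, i \in t -> is_residue (F i) z0 (a i)) ->
  is_residue (fun z => \sum_(i <- t) F i z) z0 (\sum_(i <- t) a i).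
Proof.
elim: t => [|i t IHt] h.
  rewrite big_nil (_ : (fun z => _) = (fun=> 0)); first exact: is_residue_cst.
  by apply/funext => z; rewrite big_nil.
rewrite big_cons (_ : (fun z => _) = (fun z => F i z + \sum_(i <- t) F i z)).
  apply: is_residueD (h i (mem_head _ _)) (IHt _) => j jt.
  by apply: h; rewrite inE jt orbT.
by apply/funext => z; rewrite big_cons.
Qed.

Lemma near_seq (I : eqType) (t : seq I) (P : I -> C -> Prop) z :
  (forall i, i \in t -> \forall s \near z^', P i s) ->
  \forall s \near z^', forall i, i \in t -> P i s.
Proof.
elim: t => [|i t IHt] h; first by apply: nearW => s i; rewrite in_nil.
have /dnear_absCP[r r0 hr] := h i (mem_head _ _).
have /dnear_absCP[q q0 hq] : \forall s \near z^', forall i, i \in t -> P i s.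
  by apply: IHt => j jt; apply: h; rewrite inE jt orbT.
apply/dnear_absCP; exists (Num.min r q); first by rewrite lt_min r0.
move=> s sz; rewrite lt_min => /andP[sr sq] j; rewrite inE => /predU1P[->|jt].
  exact: hr.
exact: hq.
Qed.

(** Gluing along an open set, later the half-plane [1 < Re z]. Near a point outside [P], in
    particular on the boundary line, [f] agrees with [g] wherever it is used, so the glued function
    is [g] there off the point itself. *)
Lemma mero_patch (P : C -> bool) f g :
  (forall z, P z -> \forall y \near z, P y) ->
  (forall z, P z -> mero_at f z) -> (forall z, ~~ P z -> mero_at g z) ->
  (forall z, ~~ P z -> \forall y \near z^', P y -> f y = g y) ->
  forall z, mero_at (fun y => if P y then f y else g y) z.
Proof.
move=> Po fm gm fg z; have [Pz|Pz] := boolP (P z).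
  apply: mero_at_eq (fm z Pz) _; have /near_absCP[r r0 h] := Po z Pz.
  by apply/dnear_absCP; exists r => // y _ /h ->.
apply: mero_at_eq (gm z Pz) _; have /dnear_absCP[r r0 h] := fg z Pz.
apply/dnear_absCP; exists r => // y yz yr.
by case: ifP => // Py; rewrite h.
Qed.

End Meromorphic.

(** * Dirichlet series *)

Section ComplexExponential.
Variable R : realType.
Local Notation C := (Cplx R).
Implicit Types (s z : C).

Definition exp_term (z : C) (k : nat) : C := z ^+ k / k`!%:R.

Lemma exp_coeff_sum_le (x : R) n : 0 <= x ->
  \sum_(0 <= i < n) x ^+ i / i`!%:R <= expR x.
Proof.
move=> x0; apply: (@nondecreasing_cvgn_le _ (series (exp_coeff x)) _ _ n).
  by apply/nondecreasing_series => i _ _; exact: exp_coeff_ge0.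
exact: is_cvg_series_exp_coeff.
Qed.

Lemma absC_exp_term z i : absC (exp_term z i) = absC z ^+ i / i`!%:R.
Proof. by rewrite /exp_term absCM absCX absCV absC_nat. Qed.

Lemma exp_term_abs_le z n : \sum_(0 <= i < n) absC (exp_term z i) <= expR (absC z).
Proof.
under eq_bigr do rewrite absC_exp_term.
exact: exp_coeff_sum_le.
Qed.

Lemma exp_term_summable z : abs_summable (exp_term z).
Proof. by apply: abs_summable_nat => n; exact: exp_term_abs_le. Qed.

Lemma cvg_ReIm (u : nat -> C) (a b : R) :
  (fun n => complex.Re (u n)) @ \oo --> a ->
  (fun n => complex.Im (u n)) @ \oo --> b -> u @ \oo --> (a +i* b : C).
Proof.
move=> /cvgrPdist_lt ha /cvgrPdist_lt hb; apply/cvg_absCP => e e0.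
have e2 : 0 < e / 2 by rewrite divr_gt0.
have [N _ hN] := ha _ e2; have [M _ hM] := hb _ e2.
exists (maxn N M) => n; rewrite geq_max => /andP[Nn Mn].
apply: le_lt_trans (absC_le_ReIm _) _; rewrite ReD ImD ReN ImN [e]splitr ltrD//.
  by rewrite distrC; exact: hN.
by rewrite distrC; exact: hM.
Qed.

Lemma exp_term_real (x : R) k : exp_term x%:C k = (exp_coeff x k)%:C.
Proof.
rewrite /exp_term /exp_coeff /= rmorphM /= rmorphXn /= fmorphV /= rmorph_nat.
by [].
Qed.

Lemma exp_term_imag (y : R) k :
  exp_term (0 +i* y) k = (cos_coeff y k) +i* (sin_coeff y k).
Proof.
have -> : (0 +i* y : C) = 'i%C * y%:C.
  by rewrite [LHS]complexE /= (_ : 0%:C = 0)// add0r.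
have i2 : ('i%C : C) ^+ 2 = - 1 by exact: sqr_i.
have ik : ('i%C : C) ^+ k = if odd k then ((-1) ^+ k./2)%:C * 'i%C else ((-1) ^+ k./2)%:C.
  rewrite -{1}(odd_double_half k) exprD -muln2 mulnC exprM i2.
  rewrite rmorphXn /= rmorphN1; case: (odd k) => /=; rewrite ?expr1 ?expr0 ?mul1r//.
  by rewrite mulrC.
rewrite /exp_term exprMn -[y%:C ^+ k](rmorphXn (real_complex R)) /=.
have -> : (k`!%:R : C)^-1 = (k`!%:R^-1)%:C by rewrite fmorphV /= rmorph_nat.
rewrite ik /cos_coeff /sin_coeff /= -exprnP.
have ko : odd k -> k.-1./2 = k./2.
  by case: k {ik} => //= k; rewrite uphalf_half; case: (odd k).
have iE (x : R) : (0 +i* x : C) = x%:C * 'i%C.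
  by rewrite [LHS]complexE /= (_ : 0%:C = 0)// add0r mulrC.
case: ifP => kodd /=.
  rewrite ko// mul1r !mul0r [RHS]iE !(rmorphM (real_complex R)) /=; ring.
by rewrite mul1r !mul0r -[RHS]/((_)%:C) !(rmorphM (real_complex R)).
Qed.

Lemma series_Re (u : nat -> C) n :
  complex.Re (series u n) = series (fun k => complex.Re (u k)) n.
Proof. exact: Re_sum. Qed.

Lemma series_Im (u : nat -> C) n :
  complex.Im (series u n) = series (fun k => complex.Im (u k)) n.
Proof. exact: Im_sum. Qed.

Lemma exp_term_real_sum (x : R) : has_sum (exp_term x%:C) (expR x)%:C.
Proof.
apply: has_sum_of_series; first exact: exp_term_summable.
apply: cvg_ReIm; under eq_fun do rewrite ?series_Re ?series_Im.
  rewrite (_ : (fun n => _) = series (exp_coeff x)); first exact: is_cvg_series_exp_coeff.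
  apply/funext => n; rewrite /series /=; apply: eq_bigr => i _.
  by rewrite exp_term_real.
rewrite (_ : (fun n => _) = fun=> 0); first exact: cvg_cst.
apply/funext => n; rewrite /series /=; apply: big1 => i _.
by rewrite exp_term_real.
Qed.

Lemma exp_term_imag_sum (y : R) : has_sum (exp_term (0 +i* y)) (cos y +i* sin y).
Proof.
apply: has_sum_of_series; first exact: exp_term_summable.
apply: cvg_ReIm; under eq_fun do rewrite ?series_Re ?series_Im.
  rewrite (_ : (fun n => _) = series (cos_coeff y)).
    by rewrite unlock; exact: is_cvg_series_cos_coeff.
  apply/funext => n; rewrite /series /=; apply: eq_bigr => i _.
  by rewrite exp_term_imag.
rewrite (_ : (fun n => _) = series (sin_coeff y)).
  by rewrite unlock; exact: is_cvg_series_sin_coeff.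
apply/funext => n; rewrite /series /=; apply: eq_bigr => i _.
by rewrite exp_term_imag.
Qed.

Lemma exp_termD z s n :
  has_sum (fun x : nat * nat => if (x.1 + x.2)%N == n then
    exp_term z x.1 * exp_term s x.2 else 0) (exp_term (z + s) n).
Proof.
pose t := [seq (i, (n - i)%N) | i <- index_iota 0 n.+1].
have H := @has_sum_finite R _ (fun x : nat * nat => if (x.1 + x.2)%N == n then
    exp_term z x.1 * exp_term s x.2 else 0) t.
have <- : \sum_(x <- t) (if (x.1 + x.2)%N == n then
    exp_term z x.1 * exp_term s x.2 else 0) = exp_term (z + s) n.
  rewrite big_map /exp_term [z + s]addrC exprDn mulr_suml -(big_mkord predT (fun i =>
     s ^+ (n - i) * z ^+ i *+ 'C(n, i) / n`!%:R)) big_nat [RHS]big_nat.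
  apply: eq_bigr => i /andP[_ /=]; rewrite ltnS => iln; rewrite subnKC// eqxx.
  have fn k : (k`!%:R : C) != 0.
    by rewrite -absC_eq0 absC_nat pnatr_eq0 -lt0n fact_gt0.
  have bn : ('C(n, i)%:R : C) != 0 by rewrite -absC_eq0 absC_nat pnatr_eq0 -lt0n bin_gt0.
  have nf : n`!%:R = 'C(n, i)%:R * (i`!%:R * (n - i)`!%:R) :> C.
    by rewrite -!natrM bin_fact.
  rewrite /= [X in _ = X / _](_ : _ = s ^+ (n - i) * z ^+ i * 'C(n, i)%:R); last first.
    by rewrite mulr_natr.
  rewrite nf; move: (fn i) (fn (n - i)%N) bn; set a := i`!%:R; set b := (n - i)`!%:R.
  set c := 'C(n, i)%:R; set X := s ^+ _; set Y := z ^+ i => a0 b0 c0.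
  by rewrite !invfM [X * Y * c]mulrAC -!mulrA [c * (Y * _)]mulrCA mulVKf//; ring.
apply: H; first by rewrite map_inj_uniq ?iota_uniq// => ? ? [].
move=> [i j] /= ijs; case: eqP => // E; case/negP: ijs.
apply/mapP; exists i; first by rewrite mem_index_iota /=; lia.
by congr pair; lia.
Qed.

(** Used twice: to assemble the series of [expC z] from those of the real exponential, cosine and
    sine, and then, by uniqueness of sums, to obtain [expCD]. *)
Lemma exp_term_sumD z s a b : has_sum (exp_term z) a -> has_sum (exp_term s) b ->
  has_sum (exp_term (z + s)) (a * b).
Proof.
move=> ha hb; have hz := exp_term_summable z; have hs := exp_term_summable s.
apply: (fibre_sum (p := fun x : nat * nat => (x.1 + x.2)%N)).
- exact: abs_summableM hz hs.
- exact: has_sumM hz hs ha hb.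
- exact: exp_termD.
Qed.

Lemma expC_sum z : has_sum (exp_term z) (expC z).
Proof.
have {1}-> : z = (complex.Re z)%:C + (0 +i* complex.Im z).
  by case: z => a b; apply/eqP; rewrite eq_complex /= addr0 add0r !eqxx.
exact: exp_term_sumD (exp_term_real_sum _) (exp_term_imag_sum _).
Qed.

Lemma expCD z s : expC (z + s) = expC z * expC s.
Proof.
exact: has_sum_unique (expC_sum _) (exp_term_sumD (expC_sum z) (expC_sum s)).
Qed.

Lemma absC_expC z : absC (expC z) = expR (complex.Re z).
Proof.
rewrite /expC absCM absC_real gtr0_norm ?expR_gt0// /absC /=.
by rewrite cos2Dsin2 sqrtr1 mulr1.
Qed.

Lemma expC0 : expC (0 : C) = 1.
Proof. by rewrite /expC /= expR0 cos0 sin0 mul1r. Qed.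

Lemma ReM_real z (x : R) : complex.Re (z * x%:C) = complex.Re z * x.
Proof. by case: z => a b /=; rewrite mulr0 subr0. Qed.

Lemma npowCD k s z : npowC k (s + z) = npowC k s * npowC k z.
Proof. by rewrite /npowC mulrDl expCD. Qed.

Lemma npowC1 s : npowC 1 s = 1.
Proof. by rewrite /npowC ln1 mulr0 expC0. Qed.

Lemma npowCM k l s : (0 < k)%N -> (0 < l)%N ->
  npowC (k * l) s = npowC k s * npowC l s.
Proof.
move=> k0 l0; rewrite /npowC natrM lnM ?posrE ?ltr0n// rmorphD /= mulrDr.
exact: expCD.
Qed.

Lemma absC_npowC k s : absC (npowC k s) = expR (complex.Re s * ln k%:R).
Proof. by rewrite /npowC absC_expC ReM_real. Qed.

End ComplexExponential.

Section DirichletSeries.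
Variable R : realType.
Local Notation C := (Cplx R).
Implicit Types (c : nat -> C) (s z : C).

(** This is [k ^ (- x)]: the sign is built in, so that [rpow k (Re s)] is the modulus of
    [k ^ (- s)]. *)
Definition rpow (k : nat) (x : R) : R := expR (- x * ln k%:R).

Lemma rpow_ge0 k x : 0 <= rpow k x. Proof. exact: expR_ge0. Qed.

Lemma rpowD k x y : rpow k (x + y) = rpow k x * rpow k y.
Proof. by rewrite /rpow opprD mulrDl expRD. Qed.

Lemma ln_nat_ge0 k : 0 <= ln (k.+1%:R : R).
Proof. by apply: ln_ge0; rewrite ler1n. Qed.

(** The integral test in telescoping form, from [ln y - ln x >= 1 / y] for [y = x + 1] and
    [expR u >= 1 + u]. *)
Lemma rpow_telescope k (a : R) : 0 < a ->
  a * rpow k.+2 (a + 1) <= rpow k.+1 a - rpow k.+2 a.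
Proof.
move=> a0; set x : R := k.+1%:R; set y : R := k.+2%:R.
have x0 : 0 < x by rewrite ltr0n.
have y0 : 0 < y by rewrite ltr0n.
have yx : y = x + 1 by rewrite /y /x -natr1.
have -> : rpow k.+1 a = rpow k.+2 a * expR (a * (ln y - ln x)).
  by rewrite /rpow -expRD -/x -/y; congr expR; ring.
have -> : rpow k.+2 (a + 1) = rpow k.+2 a * y^-1.
  by rewrite rpowD {2}/rpow mulN1r expRN lnK// posrE.
have lb : y^-1 <= ln y - ln x.
  have : ln (1 + - y^-1) <= - y^-1.
    by apply: le_ln1Dx; rewrite ltrN2 invf_lt1// yx; lra.
  rewrite (_ : 1 + - y^-1 = x / y); last by rewrite yx; field; rewrite gt_eqF// ltr_wpDl// ltW.
  by rewrite ln_div ?posrE// => h; rewrite -[leRHS]opprB lerNr.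
have := expR_ge1Dx (a * (ln y - ln x)).
have h2 : a * y^-1 <= a * (ln y - ln x) by rewrite ler_wpM2l// ltW.
have p0 := rpow_ge0 k.+2 a.
set E := expR _; set P := rpow _ _ => h1.
rewrite (_ : a * (P / y) = P * (a * y^-1)); last by ring.
rewrite (_ : P * E - P = P * (E - 1)); last by ring.
by rewrite ler_wpM2l//; apply: (le_trans h2); rewrite lerBrDl.
Qed.

Lemma rpow_sum_le (a : R) n : 0 < a ->
  \sum_(0 <= k < n) rpow k.+2 (a + 1) <= a^-1.
Proof.
move=> a0; rewrite -[leRHS]mul1r ler_pdivlMr// mulrC mulr_sumr.
have : \sum_(0 <= k < n) a * rpow k.+2 (a + 1) <= 1 - rpow n.+1 a.
  elim: n => [|n IHn]; first by rewrite big_nil /rpow ln1 mulr0 expR0 subrr.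
  rewrite big_nat_recr//=; have := rpow_telescope n a0; lra.
by have := rpow_ge0 n.+1 a; lra.
Qed.

Definition dirichlet_abs c : Prop := forall x : R, 1 < x ->
  exists2 M, 0 <= M & forall n, \sum_(0 <= k < n) absC (c k.+1) * rpow k.+1 x <= M.

Lemma bounded_dirichlet_abs c (B : R) : (forall k, absC (c k) <= B) -> dirichlet_abs c.
Proof.
move=> hB x x1; have B0 : 0 <= B by exact: le_trans (hB 0%N).
have a0 : 0 < x - 1 by lra.
exists (B * (1 + (x - 1)^-1)).
  by rewrite mulr_ge0// addr_ge0// invr_ge0 ltW.
move=> n; apply: le_trans (_ : B * \sum_(0 <= k < n.+1) rpow k.+1 x <= _).
  rewrite mulr_sumr big_nat_recr//= -[leLHS]addr0 lerD//.
    by apply: ler_sum => i _; rewrite ler_wpM2r// rpow_ge0.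
  by rewrite mulr_ge0// rpow_ge0.
rewrite ler_wpM2l// big_nat_recl//= /rpow ln1 mulr0 expR0 lerD2l.
by have := rpow_sum_le n a0; rewrite subrK.
Qed.

(** Half of the distance from [x] to [1] pays for the logarithm, since [e * ln k <= k ^ e]. *)
Lemma dirichlet_abs_ln c : dirichlet_abs c ->
  dirichlet_abs (fun k => c k * (- ln k%:R)%:C).
Proof.
move=> hc x x1; pose e := (x - 1) / 2.
have e0 : 0 < e by rewrite /e; lra.
have [|M M0 hM] := hc (x - e); first by rewrite /e; lra.
exists (e^-1 * M); first by rewrite mulr_ge0// invr_ge0 ltW.
move=> n; apply: le_trans (ler_wpM2l _ (hM n)); last by rewrite invr_ge0 ltW.
rewrite mulr_sumr; apply: ler_sum => k _.
rewrite absCM absC_real normrN ger0_norm ?ln_nat_ge0//.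
rewrite mulrCA -mulrA; apply: ler_wpM2l => //.
have -> : rpow k.+1 (x - e) = expR (e * ln k.+1%:R) * rpow k.+1 x.
  by rewrite /rpow -expRD; congr expR; ring.
rewrite mulrA; apply: ler_wpM2r; first exact: rpow_ge0.
rewrite -[leRHS]mulrC ler_pdivlMr// mulrC.
by have := expR_ge1Dx (e * ln k.+1%:R); lra.
Qed.

Lemma dirichlet_abs_le c d (B : R) : (forall k, absC (d k) <= B * absC (c k)) ->
  dirichlet_abs c -> dirichlet_abs d.
Proof.
move=> h hc x /hc[M M0 hM]; exists (`|B| * M); first by rewrite mulr_ge0.
move=> n; apply: le_trans (ler_wpM2l (normr_ge0 _) (hM n)).
rewrite mulr_sumr; apply: ler_sum => k _; rewrite mulrA ler_wpM2r ?rpow_ge0//.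
by apply: le_trans (h _) _; rewrite ler_wpM2r// ler_norm.
Qed.

Lemma absC_dirichlet_term c s k :
  absC (dirichlet_term c s k) = absC (c k.+1) * rpow k.+1 (complex.Re s).
Proof. by rewrite /dirichlet_term absCM absC_npowC ReN. Qed.

Lemma dirichlet_summable c s : dirichlet_abs c -> 1 < complex.Re s ->
  abs_summable (dirichlet_term c s).
Proof.
move=> hc /hc[M _ hM]; apply: (@abs_summable_nat _ _ M) => n.
by under eq_bigr do rewrite absC_dirichlet_term.
Qed.

Lemma dirichlet_has_sum c s : dirichlet_abs c -> 1 < complex.Re s ->
  has_sum (dirichlet_term c s) (dirichlet_series c s).
Proof.
move=> hc hs; have [S hS] := abs_summable_sum (dirichlet_summable hc hs).
by rewrite /dirichlet_series (series_lim (has_sum_series hS)).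
Qed.

Lemma dirichlet_seriesE c s S : has_sum (dirichlet_term c s) S -> dirichlet_series c s = S.
Proof. by move=> hS; rewrite /dirichlet_series (series_lim (has_sum_series hS)). Qed.

Definition dirichlet_fam c s (h : C) (x : nat * nat) : C :=
  dirichlet_term c s x.1 * exp_term ((- ln x.1.+1%:R)%:C * h) x.2.

Lemma dirichlet_fam_row c s h k :
  has_sum (fun i => dirichlet_fam c s h (k, i)) (dirichlet_term c (s + h) k).
Proof.
have -> : dirichlet_term c (s + h) k =
    dirichlet_term c s k * expC ((- ln k.+1%:R)%:C * h).
  rewrite /dirichlet_term opprD npowCD mulrA; congr (_ * _).
  by rewrite /npowC rmorphN /=; congr expC; ring.
by apply: eq_has_sum (has_sumZ (dirichlet_term c s k) (expC_sum _)) => i.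
Qed.

(** In modulus, row [k] sums to at most [|c k.+1| * k.+1 ^ (|h| - Re s)], the exponential series
    being bounded by [exp (|h| ln k.+1)]. *)
Lemma dirichlet_fam_summable c s h : dirichlet_abs c ->
  1 < complex.Re s - absC h -> abs_summable (dirichlet_fam c s h).
Proof.
move=> hc hs; have [M M0 hM] := hc _ hs.
apply: (@abs_summable_pair R _ _ _
  (fun k => absC (c k.+1) * rpow k.+1 (complex.Re s - absC h)) M) => [k t ut|t ut].
  rewrite /dirichlet_fam /=; under eq_bigr do rewrite absCM.
  rewrite -mulr_sumr absC_dirichlet_term -mulrA ler_wpM2l//.
  have -> : rpow k.+1 (complex.Re s - absC h) =
      rpow k.+1 (complex.Re s) * expR (absC h * ln k.+1%:R).
    by rewrite /rpow -expRD; congr expR; ring.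
  rewrite ler_wpM2l ?rpow_ge0//.
  apply: le_trans (sum_nat_seq_le _ ut) _ => //.
  apply: le_trans (exp_term_abs_le _ _) _.
  by rewrite absCM absC_real normrN ger0_norm ?ln_nat_ge0// mulrC.
apply: le_trans (hM _); apply: sum_nat_seq_le => // k.
by rewrite mulr_ge0// rpow_ge0.
Qed.

Definition dirichlet_coef c s i : C :=
  limn (series (fun k => dirichlet_term c s k * exp_term (- ln k.+1%:R)%:C i)).

Lemma dirichlet_coef_sum c s i : dirichlet_abs c -> 1 < complex.Re s ->
  has_sum (fun k => dirichlet_term c s k * exp_term (- ln k.+1%:R)%:C i)
    (dirichlet_coef c s i).
Proof.
move=> hc hs; pose h0 : R := (complex.Re s - 1) / 2.
have h00 : 0 < h0 by rewrite /h0; lra.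
have habs : absC h0%:C = h0 by rewrite absC_real gtr0_norm.
have Fs : abs_summable (dirichlet_fam c s h0%:C).
  by apply: dirichlet_fam_summable hc _; rewrite habs /h0; lra.
have s1 : abs_summable (fun k => dirichlet_term c s k * exp_term (- ln k.+1%:R)%:C i).
  apply: sub_abs_summable ((h0 ^+ i)^-1) _ (abs_summable_col i Fs) => k.
  rewrite /dirichlet_fam /=; move: (dirichlet_term c s k) (- ln k.+1%:R)%:C => T L.
  rewrite !(absCM T) !absC_exp_term (absCM L) habs [(_ * h0) ^+ i]exprMn.
  rewrite [leRHS](_ : _ = h0 ^- i * h0 ^+ i * (absC T *
    (absC L ^+ i / i`!%:R))); last by ring.
  by rewrite mulVf ?mul1r// expf_neq0// gt_eqF.
have [S hS] := abs_summable_sum s1.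
by rewrite /dirichlet_coef (series_lim (has_sum_series hS)).
Qed.

Lemma dirichlet_recentre c s : dirichlet_abs c -> 1 < complex.Re s ->
  conv_radius (dirichlet_coef c s) (complex.Re s - 1) /\
  forall h, absC h < complex.Re s - 1 ->
    dirichlet_series c (s + h) = psum (dirichlet_coef c s) h.
Proof.
move=> hc hs.
suff H h : absC h < complex.Re s - 1 ->
    abs_summable (fun i => dirichlet_coef c s i * h ^+ i) /\
    has_sum (fun i => dirichlet_coef c s i * h ^+ i) (dirichlet_series c (s + h)).
  by split=> h /H[h1 h2]; [exact: h1|rewrite (psumE h2)].
move=> hr; apply: (has_sum_row_col (F := dirichlet_fam c s h)).
- by apply: dirichlet_fam_summable hc _; lra.
- exact: dirichlet_fam_row.
- move=> i; rewrite mulrC.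
  apply: eq_has_sum (has_sumZ (h ^+ i) (dirichlet_coef_sum i hc hs)) => k.
  by rewrite /dirichlet_fam /= /exp_term exprMn; ring.
- apply: dirichlet_has_sum hc _; rewrite ReD.
  by have := Re_le_absC h; rewrite ler_norml => /andP[]; lra.
Qed.

Lemma dirichlet_analytic c s : dirichlet_abs c -> 1 < complex.Re s ->
  analytic_at (dirichlet_series c) s.
Proof.
move=> hc hs; have [h1 h2] := dirichlet_recentre hc hs.
exists (dirichlet_coef c s); apply/near_absCP.
exists (complex.Re s - 1) => [|z zs]; first by rewrite subr_gt0.
have -> : dirichlet_series c z = psum (dirichlet_coef c s) (z - s).
  by rewrite -h2// [s + _]addrC subrK.
exact: psum_cvg zs.
Qed.

Lemma dirichlet_derive1 c s : dirichlet_abs c -> 1 < complex.Re s ->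
  derive1 (dirichlet_series c) s =
  dirichlet_series (fun k => c k * (- ln k%:R)%:C) s.
Proof.
move=> hc hs; have [h1 h2] := dirichlet_recentre hc hs.
have r0 : 0 < complex.Re s - 1 by rewrite subr_gt0.
have d := is_derive_pow_expansion r0 h1 h2.
rewrite derive1E (@derive_val _ _ _ _ _ _ _ d).
apply: has_sum_unique (dirichlet_coef_sum 1 hc hs) _.
apply: eq_has_sum (dirichlet_has_sum (dirichlet_abs_ln hc) hs) => k.
by rewrite /exp_term expr1 (_ : 1`! = 1%N)// divr1; exact: mulrAC.
Qed.

Definition dirichlet_conv c d n : C := \sum_(k <- divisors n) c k * d (n %/ k)%N.

Lemma dirichlet_convP c d s : dirichlet_abs c -> dirichlet_abs d -> 1 < complex.Re s ->
  has_sum (dirichlet_term (dirichlet_conv c d) s)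
    (dirichlet_series c s * dirichlet_series d s).
Proof.
move=> hc hd hs.
have cs := dirichlet_summable hc hs; have ds := dirichlet_summable hd hs.
(* The term of index [k] belongs to the integer [k.+1]; this is multiplication of integers read on
   indices. *)
apply: (fibre_sum (p := fun x : nat * nat => (x.1.+1 * x.2.+1).-1)%N).
- exact: abs_summableM cs ds.
- exact: has_sumM cs ds (dirichlet_has_sum hc hs) (dirichlet_has_sum hd hs).
move=> n; pose t := [seq (k.-1, (n.+1 %/ k).-1)%N | k <- divisors n.+1].
have H := @has_sum_finite R _ (fun x : nat * nat => if (x.1.+1 * x.2.+1).-1%N == n then
    dirichlet_term c s x.1 * dirichlet_term d s x.2 else 0) t.
have <- : \sum_(x <- t) (if (x.1.+1 * x.2.+1).-1%N == n then
    dirichlet_term c s x.1 * dirichlet_term d s x.2 else 0) =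
    dirichlet_term (dirichlet_conv c d) s n.
  rewrite big_map /dirichlet_term /dirichlet_conv mulr_suml big_seq [RHS]big_seq.
  apply: eq_bigr => k; rewrite -dvdn_divisors// => kn; cbn [fst snd].
  have k0 : (0 < k)%N by exact: dvdn_gt0 kn.
  have q0 : (0 < n.+1 %/ k)%N by rewrite divn_gt0// dvdn_leq.
  have nE : (k * (n.+1 %/ k))%N = n.+1 by rewrite mulnC divnK.
  have -> : npowC n.+1 (- s) = npowC k (- s) * npowC (n.+1 %/ k) (- s).
    by rewrite -(npowCM _ k0 q0) nE.
  by rewrite !prednK// nE eqxx; ring.
apply: H.
  rewrite map_inj_in_uniq ?divisors_uniq// => i j.
  rewrite -!dvdn_divisors// => iN jN [E _].
  by rewrite -(prednK (dvdn_gt0 _ iN))// -(prednK (dvdn_gt0 _ jN))// E.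
move=> [i j] /= ijt; case: eqP => // E; case/negP: ijt.
have nE : (i.+1 * j.+1 = n.+1)%N by rewrite -E; lia.
apply/mapP; exists i.+1; first by rewrite -dvdn_divisors// -nE dvdn_mulr.
by rewrite -nE mulKn.
Qed.

End DirichletSeries.

(** * The von Mangoldt function and logarithmic derivatives *)

Section VonMangoldt.
Variable R : realType.
Local Notation C := (Cplx R).
Implicit Types (c : nat -> C) (s z : C).

Lemma primes_singleton p d : primes d = [:: p] -> d = (p ^ logn p d)%N.
Proof.
move=> pd; have d0 : (0 < d)%N by case: d pd.
by rewrite {1}(prod_prime_decomp d0) prime_decompE pd big_seq1.
Qed.

Lemma von_mangoldt_ge0 k : 0 <= von_mangoldt R k.
Proof.
rewrite /von_mangoldt; case E: (primes k) => [//|p [|//]].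
have : p \in primes k by rewrite E mem_head.
by rewrite mem_primes => /andP[/prime_gt0 p0 _]; apply: ln_ge0; rewrite ler1n.
Qed.

Lemma von_mangoldt_le_ln k : von_mangoldt R k <= ln k%:R.
Proof.
case: k => [|k]; first by rewrite /von_mangoldt /= ln0.
rewrite /von_mangoldt; case E: (primes k.+1) => [|p [|q s]]; try exact: ln_nat_ge0.
have : p \in primes k.+1 by rewrite E mem_head.
rewrite mem_primes => /and3P[/prime_gt0 p0 k0 pk].
by rewrite ler_ln ?posrE ?ltr0n// ler_nat dvdn_leq.
Qed.

Lemma dirichlet_abs_cst (B : C) : dirichlet_abs (fun=> B).
Proof. exact: (@bounded_dirichlet_abs _ _ (absC B)). Qed.

Lemma dirichlet_abs_von_mangoldt c (B : R) : (forall k, absC (c k) <= B) ->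
  dirichlet_abs (fun k => (von_mangoldt R k)%:C * c k).
Proof.
move=> cB; have h := dirichlet_abs_ln (dirichlet_abs_cst 1).
apply: (@dirichlet_abs_le _ _ _ B) h => k.
rewrite mul1r absCM !absC_real normrN mulrC.
have l0 := le_trans (von_mangoldt_ge0 k) (von_mangoldt_le_ln k).
rewrite ger0_norm ?von_mangoldt_ge0// [`|ln _|]ger0_norm//.
by apply: ler_pM => //; [exact: von_mangoldt_ge0|exact: von_mangoldt_le_ln].
Qed.

Lemma ln_prime_decomp n : (0 < n)%N ->
  ln (n%:R : R) = \sum_(p <- primes n) (logn p n)%:R * ln p%:R.
Proof.
move=> n0; rewrite {1}(prod_prime_decomp n0) prime_decompE big_map /=.
have : all (fun p => 0 < p)%N (primes n).
  by apply/allP => p; rewrite mem_primes => /andP[/prime_gt0].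
elim: (primes n) => [|p s IHs] /=; first by rewrite !big_nil ln1.
move=> /andP[p0 s0]; rewrite !big_cons natrM lnM ?posrE ?ltr0n ?expn_gt0 ?p0//.
  by rewrite IHs// natrX lnXn ?ltr0n// mulr_natl.
rewrite lt0n; apply/eqP => /eqP.
elim: s s0 {IHs} => [|q s IHs] /=; first by rewrite big_nil.
move=> /andP[q0 s0]; rewrite big_cons muln_eq0 expn_eq0 => /orP[|/(IHs s0)//].
by rewrite -leqn0 leqNgt q0.
Qed.

(** The divisors counted are [p ^ 1, ..., p ^ (logn p n)]. *)
Lemma count_prime_powers n p : (0 < n)%N -> p \in primes n ->
  count (fun d => primes d == [:: p]) (divisors n) = logn p n.
Proof.
move=> n0; rewrite mem_primes => /and3P[pp _ pn].
rewrite -size_filter -[RHS](size_iota 1) -[RHS](size_map (expn p)).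
apply: perm_size; apply: uniq_perm.
- by rewrite filter_uniq// divisors_uniq.
- rewrite map_inj_in_uniq ?iota_uniq// => i j _ _ /eqP.
  by rewrite eqn_exp2l ?prime_gt1// => /eqP.
move=> d; rewrite mem_filter -dvdn_divisors//; apply/andP/mapP.
  move=> [/eqP pd dn]; exists (logn p d); last exact: primes_singleton.
  rewrite mem_iota add1n ltnS dvdn_leq_log// andbT logn_gt0.
  by rewrite pd mem_head.
move=> [j]; rewrite mem_iota add1n ltnS => /andP[j0 jn] ->.
rewrite pfactor_dvdn// jn; split=> //; apply/eqP.
by rewrite primesX// primes_prime.
Qed.

(** The case analysis in [von_mangoldt] is spread into a sum over the primes of [n]; after the
    exchange, each [ln p] is counted once per power of [p] dividing [n]. *)
Lemma sum_von_mangoldt n : (0 < n)%N ->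
  \sum_(d <- divisors n) von_mangoldt R d = ln n%:R.
Proof.
move=> n0; rewrite ln_prime_decomp//.
transitivity (\sum_(d <- divisors n) \sum_(p <- primes n)
    if primes d == [:: p] then ln (p%:R : R) else 0).
  rewrite big_seq [RHS]big_seq; apply: eq_bigr => d.
  rewrite -dvdn_divisors// => dn; rewrite /von_mangoldt.
  case E: (primes d) => [|p [|q s]].
  - by rewrite big1// => p _; case: ifP.
  - have pn : p \in primes n.
      have : p \in primes d by rewrite E mem_head.
      by rewrite !mem_primes n0 => /and3P[-> _ pd]; exact: dvdn_trans dn.
    rewrite (bigD1_seq p)//= ?primes_uniq// eqxx big1 ?addr0// => q qp.
    by case: eqP => // -[] /eqP; rewrite eq_sym (negPf qp).
  - by rewrite big1// => r _; case: eqP.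
rewrite exchange_big /= big_seq [RHS]big_seq; apply: eq_bigr => p pn.
by rewrite -big_mkcond /= big_const_seq iter_addr_0 count_prime_powers// mulr_natl.
Qed.

(** Complete multiplicativity gives [c d * c (k / d) = c k], so this factor leaves the divisor sum
    of the convolution. *)
Lemma dirichlet_log_derivative c s (B : R) : (forall k, absC (c k) <= B) ->
  (forall k l, c (k * l)%N = c k * c l) -> 1 < complex.Re s ->
  dirichlet_series (fun k => (von_mangoldt R k)%:C * c k) s * dirichlet_series c s =
  - derive1 (dirichlet_series c) s.
Proof.
move=> cB cM hs; have hc := bounded_dirichlet_abs cB.
have h := dirichlet_convP (dirichlet_abs_von_mangoldt cB) hc hs.
apply: has_sum_unique h _; rewrite dirichlet_derive1//.
apply: eq_has_sum (has_sumN (dirichlet_has_sum (dirichlet_abs_ln hc) hs)) => k.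
rewrite /dirichlet_term -mulNr; congr (_ * _).
rewrite /dirichlet_conv big_seq.
rewrite (eq_bigr (fun d => c k.+1 * (von_mangoldt R d)%:C)); last first.
  move=> d; rewrite -dvdn_divisors// => dk.
  by rewrite -mulrA -cM [(d * _)%N]mulnC divnK// mulrC.
rewrite -big_seq -mulr_sumr -(rmorph_sum (real_complex R)) /= sum_von_mangoldt//.
by rewrite rmorphN /= mulrN opprK.
Qed.

(** At [s = 3] the first term is [1], and the others have total modulus at most half the sum of
    [k ^ (-2)] over [k >= 2], hence at most [1/2]. *)
Lemma dirichlet_series_neq0 c : c 1%N = 1 -> (forall k, absC (c k) <= 1) ->
  exists2 s : C, 1 < complex.Re s & dirichlet_series c s != 0.
Proof.
move=> c1 cB; have s1 : 1 < complex.Re (3%:R%:C : C) by rewrite /= ltr1n.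
exists 3%:R%:C => //.
have h := dirichlet_has_sum (bounded_dirichlet_abs cB) s1.
have t0 : dirichlet_term c 3%:R%:C 0 = 1 by rewrite /dirichlet_term npowC1 c1 mulr1.
have h1 : has_sum (fun k => if k == 0%N then -1 : C else 0) (-1).
  have := @has_sum_finite R _ (fun k => if k == 0%N then -1 : C else 0) [:: 0%N] isT.
  by rewrite big_seq1 /=; apply => k; rewrite inE => /negPf ->.
have h2 := has_sumD h h1.
have : absC (dirichlet_series c 3%:R%:C + -1) <= 2^-1.
  apply: has_sum_le h2 _ => t ut.
  apply: le_trans (sum_nat_seq_le _ ut) _ => //.
  rewrite big_nat_recl//= t0 subrr absC0 add0r.
  apply: le_trans (_ : 2^-1 * \sum_(0 <= k < \max_(i <- t) i) rpow k.+2 (1 + 1 : R) <= _).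
    rewrite mulr_sumr; apply: ler_sum => k _; rewrite addr0 absC_dirichlet_term /=.
    rewrite (_ : 3%:R = 1 + (1 + 1) :> R); last by lra.
    rewrite rpowD mulrA ler_wpM2r ?rpow_ge0//.
    rewrite -[leRHS]mul1r; apply: ler_pM; rewrite ?rpow_ge0//.
    rewrite /rpow mulN1r expRN lnK ?posrE ?ltr0n//.
    by rewrite lef_pV2 ?posrE ?ltr0n// ler_nat.
  have := @rpow_sum_le R 1 (\max_(i <- t) i) ltr01; rewrite invr1 => l1.
  by rewrite -[leRHS]mulr1 ler_wpM2l.
move=> hle; apply/eqP => E; move: hle; rewrite E add0r absCN absC1.
lra.
Qed.

End VonMangoldt.

(** * Continuation of Dirichlet series with periodic coefficients *)

Section IteratedDifferences.
Variable R : realType.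
Implicit Types (x y : R) (h : R -> R).

Definition rdiff h x : R := h x - h (x + 1).

Lemma is_derive_comp_shift h x a d : is_derive (x + a) 1 h d ->
  is_derive x 1 (fun y => h (y + a)) d.
Proof.
move=> hd; have sd : is_derive x 1 (fun y : R => y + a) 1 by exact: is_derive_shift.
by have := @is_derive1_comp R h (fun y => y + a) x d 1 hd sd; rewrite mulr1.
Qed.

(* [H j] is the j-th derivative of [H 0], and the mean value theorem turns each
   difference into a derivative. *)
Lemma iter_rdiff_le p (H : nat -> R -> R) x (B : R) :
  (forall j y, 0 < y -> is_derive y 1 (H j) (H j.+1 y)) -> 0 < x ->
  (forall y, x <= y <= x + p%:R -> `|H p y| <= B) ->
  `|iter p rdiff (H 0%N) x| <= B.
Proof.
elim: p H x B => [|p IHp] H x B Hd x0 HB.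
  by apply: HB; rewrite lexx addr0 lexx.
rewrite iterSr; apply: (IHp (fun j => rdiff (H j))) => // [j y y0|y /andP[xy yx]].
  apply: is_deriveB; first exact: Hd.
  by apply: is_derive_comp_shift; apply: Hd; rewrite addr_gt0.
have y0 : 0 < y by exact: lt_le_trans xy.
have [c] : exists2 c, c \in `[y, y + 1] &
    H p (y + 1) - H p y = H p.+1 c * (y + 1 - y).
  apply: MVT_segment; first by rewrite lerDl.
    move=> t; rewrite in_itv /= => /andP[yt _]; apply: Hd; exact: lt_trans yt.
  apply: derivable_within_continuous => t; rewrite in_itv /= => /andP[yt _].
  have td := Hd p t (lt_le_trans y0 yt); exact: ex_derive.
rewrite in_itv /= => /andP[yc cy] E.
rewrite /rdiff distrC E [y + 1]addrC addrK mulr1; apply: HB.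
rewrite (le_trans xy yc) /= -natr1; lra.
Qed.

(* [lpoly j i] is the polynomial in [L = ln x] such that
   [(d/dx)^j x^-s] is the sum over [i] of [x^-j * (lpoly j i).[L] * s^i]. *)
Fixpoint lpoly j i : {poly R} :=
  if j is j'.+1 then
    - ((if i is i'.+1 then lpoly j' i' else 0) + j'%:R *: lpoly j' i)
  else ((-1) ^+ i / i`!%:R) *: 'X^i.

(** Differentiating [exp (- s L)] in [L] multiplies it by [- s], which shifts the exponent of [s];
    the recursion in [j] preserves this. *)
Lemma deriv_lpoly j i :
  (lpoly j i)^`() = - (if i is i'.+1 then lpoly j i' else 0).
Proof.
elim: j i => [|j IHj] i /=.
  rewrite derivZ derivXn; case: i => [|i]; first by rewrite mulr0n scaler0 oppr0.
  rewrite /= -[X in _ *: X = _]scaler_nat scalerA -scaleNr; congr (_ *: _).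
  rewrite factS natrM exprS invfM mulN1r !mulNr; congr (- _).
  by rewrite -mulrA; congr (_ * _); rewrite mulrC mulrA divff ?mul1r// pnatr_eq0.
rewrite derivN derivD derivZ !IHj; case: i => [|i].
  by rewrite deriv0 oppr0 scaler0 addr0 oppr0.
by rewrite IHj scalerN -opprD !opprK.
Qed.

(** The coefficient of [s ^ i] in the [j]-th derivative of [x ^ (- s)]. *)
Definition lfun i j x : R := (lpoly j i).[ln x] / x ^+ j.

Lemma is_derive_lfun i j x : 0 < x -> is_derive x 1 (lfun i j) (lfun i j.+1 x).
Proof.
move=> x0; have pd := is_derive_poly (lpoly j i) (ln x).
have d1 := is_derive1_comp pd (is_derive1_ln x0).
have d0 : 0 != x by rewrite lt_eqF.
have := @is_derive_quot_pow R _ x 0 _ j _ d1; rewrite subr0 => /(_ _)H.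
have {H} := H (lt0r_neq0 x0).
rewrite (_ : (fun y => _) = lfun i j); last by apply/funext => y; rewrite subr0.
set a := (X in is_derive _ _ _ X -> _); rewrite (_ : a = lfun i j.+1 x)//.
rewrite /a /lfun /= deriv_lpoly !hornerE exprS; field.
by rewrite expf_neq0 ?lt0r_neq0.
Qed.

(** The recursion of [lpoly] without signs: the coefficient of [s ^ i] in [exp (s L)] times the
    product of [s + l] over [l < j]. Evaluating at [s = r] bounds the weighted sums. *)
Fixpoint lbound j i (L : R) : R :=
  if j is j'.+1 then
    (if i is i'.+1 then lbound j' i' L else 0) + j'%:R * lbound j' i L
  else L ^+ i / i`!%:R.

Lemma lpoly_le j i L L' : 0 <= L <= L' -> `|(lpoly j i).[L]| <= lbound j i L'.
Proof.
move=> /andP[L0 LL']; elim: j i => [|j IHj] i /=.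
  rewrite hornerZ hornerXn !normrM normrX normrN1 expr1n mul1r.
  rewrite normfV normr_nat normrX ger0_norm// mulrC ler_wpM2r ?invr_ge0//.
  by rewrite lerXn2r// nnegrE// (le_trans L0).
rewrite hornerN hornerD hornerZ normrN; apply: le_trans (ler_normD _ _) _.
rewrite lerD// ?normrM ?normr_nat ?ler_wpM2l//.
by case: i => [|i]; rewrite ?horner0 ?normr0.
Qed.

Lemma lbound_sum_le j n (L : R) (r : nat) : 0 <= L ->
  \sum_(0 <= i < n) lbound j i L * r%:R ^+ i <=
  \prod_(0 <= l < j) (r + l)%:R * expR (r%:R * L).
Proof.
move=> L0; elim: j n => [|j IHj] n /=.
  rewrite big_nil mul1r.
  under eq_bigr do rewrite mulrAC -exprMn mulrC [L * _]mulrC mulrC.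
  by apply: exp_coeff_sum_le; rewrite mulr_ge0.
under eq_bigr do rewrite mulrDl -mulrA.
rewrite big_split /= -mulr_sumr big_nat_recr//= natrD -mulrA mulrCA mulrDl.
apply: lerD; last first.
  by rewrite ler_wpM2l.
case: n => [|n].
  rewrite big_nil mulr_ge0// mulr_ge0 ?expR_ge0//.
  by apply: prodr_ge0 => l _.
rewrite big_nat_recl//= mul0r add0r.
under eq_bigr do rewrite exprS mulrCA.
by rewrite -mulr_sumr ler_wpM2l.
Qed.

(** The [r + 2] derivatives yield [x ^- (r + 2)], and the weighted sum over [i] costs [expR (r * L)
    = (x + r + 2) ^ r <= ((r + 3) * x) ^ r]; a summable [x ^- 2] is left. Here [L] is the logarithm
    at the right end of the interval that the differences reach. *)
Lemma rdiff_log_sum_le (r n k : nat) :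
  \sum_(0 <= i < n) `|iter r.+2 rdiff (lfun i 0) k.+1%:R| * r%:R ^+ i <=
  (\prod_(0 <= l < r.+2) (r + l)%:R * r.+3%:R ^+ r) * rpow k.+1 2.
Proof.
pose x : R := k.+1%:R; have x0 : 0 < x by rewrite ltr0n.
have x1 : 1 <= x by rewrite ler1n.
pose L := ln (x + r.+2%:R).
have L0 : 0 <= L by apply: ln_ge0; rewrite -[leLHS]addr0 lerD.
apply: le_trans (_ : \sum_(0 <= i < n) x ^- r.+2 * (lbound r.+2 i L * r%:R ^+ i) <= _).
  apply: ler_sum => i _; rewrite mulrA ler_wpM2r ?exprn_ge0//.
  apply: (@iter_rdiff_le _ (lfun i)) => //; first by move=> j y; exact: is_derive_lfun.
  move=> y /andP[xy yx]; rewrite /lfun normrM mulrC.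
  have y0 : 0 < y by exact: lt_le_trans xy.
  apply: ler_pM => //.
    rewrite normfV normrX gtr0_norm// lef_pV2 ?posrE ?exprn_gt0//.
    by rewrite lerXn2r// nnegrE ltW.
  apply: lpoly_le; rewrite ln_ge0 ?(le_trans x1)//=.
  by rewrite ler_ln// posrE// addr_gt0.
rewrite -mulr_sumr.
apply: le_trans (ler_wpM2l _ (lbound_sum_le r.+2 n r L0)) _.
  by rewrite invr_ge0 exprn_ge0// ltW.
rewrite mulrCA -[leRHS]mulrA ler_wpM2l//; first by apply: prodr_ge0.
have -> : expR (r%:R * L) = (x + r.+2%:R) ^+ r.
  by rewrite expRM_natl lnK// posrE addr_gt0.
have -> : rpow k.+1 2 = x ^- 2 :> R.
  by rewrite /rpow mulNr expRN expRM_natl lnK.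
have -> : x ^- r.+2 = x ^- r * x ^- 2 by rewrite -invfM -exprD addn2.
rewrite mulrAC ler_wpM2r ?invr_ge0 ?exprn_ge0 ?(ltW x0)//.
have p1 : 0 <= x + r.+2%:R by rewrite addr_ge0// ltW.
have p2 : 0 <= r.+3%:R * x by rewrite mulr_ge0// ltW.
rewrite mulrC ler_pdivrMr ?exprn_gt0// -exprMn lerXn2r//.
rewrite -[r.+3%:R]natr1 mulrDl mul1r addrC lerD2r -[leLHS]mulr1.
by rewrite ler_wpM2l.
Qed.

End IteratedDifferences.

(** * Repeated summation by parts *)

Section SummationByParts.
Variable R : realType.
Local Notation C := (Cplx R).
Implicit Types (e v : nat -> C) (M : nat).

Definition diff v k : C := v k - v k.+1.

Definition mean_zero M e : Prop :=
  (forall k, e (k + M)%N = e k) /\ \sum_(0 <= k < M) e k = 0.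

Definition psums e k : C := \sum_(0 <= j < k.+1) e j.

(* Abel summation replaces the coefficients [e] by their partial sums, which are
   again periodic; subtracting their mean value restores a zero mean, at the
   cost of the telescoping sum [pmean M e * v 0]. *)
Definition pmean M e : C := M%:R^-1 * \sum_(0 <= k < M) psums e k.

Definition parts_coef M e k : C := psums e k - pmean M e.

Lemma natC_neq0 n : (0 < n)%N -> (n%:R : C) != 0.
Proof. by move=> n0; rewrite -absC_eq0 absC_nat pnatr_eq0 -lt0n. Qed.

Lemma parts_coef_mean_zero M e : (0 < M)%N -> mean_zero M e ->
  mean_zero M (parts_coef M e).
Proof.
move=> M0 [eM e0]; split.
  move=> k; rewrite /parts_coef; congr (_ - _); rewrite /psums -addSn addnC.
  rewrite (big_cat_nat (leq0n M) (leq_addr _ _))//= e0 add0r.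
  rewrite -{1}[M]add0n big_addn addKn.
  by apply: eq_bigr => i _; rewrite eM.
rewrite sumrB big_const_nat subn0 iter_addr_0 -mulr_natl /pmean mulrA.
by rewrite mulfV ?natC_neq0// mul1r subrr.
Qed.

Lemma periodic_bounded M e : (0 < M)%N -> (forall k, e (k + M)%N = e k) ->
  exists2 B : R, 0 <= B & forall k, absC (e k) <= B.
Proof.
move=> M0 eM; exists (\sum_(0 <= j < M) absC (e j)); first exact: sumr_ge0.
have eE k : e k = e (k %% M)%N.
  rewrite {1}(divn_eq k M) addnC; elim: (k %/ M)%N => [|q IHq].
    by rewrite mul0n addn0.
  by rewrite mulSn [(M + _)%N]addnC addnA eM.
move=> k; rewrite eE (bigD1_seq (k %% M)%N) ?iota_uniq//=.
  by rewrite lerDl sumr_ge0.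
by rewrite mem_index_iota /= ltn_mod.
Qed.

Lemma has_sum_shift1 (f : nat -> C) S : has_sum f S ->
  has_sum (fun k => f k.+1) (S - f 0%N).
Proof.
move=> fS e e0; have [s0 hs0] := fS e e0.
exists (map predn s0) => s us ss.
have h : absC (\sum_(x <- 0%N :: map succn s) f x - S) < e.
  apply: hs0 => /=.
    rewrite map_inj_uniq ?us ?andbT; last exact: succn_inj.
    by apply/mapP => -[].
  case=> [|x] xs0; rewrite inE//=; apply/mapP; exists x => //.
  by apply: ss; apply/mapP; exists x.+1.
rewrite big_cons big_map /= in h.
by rewrite opprB addrA [_ + f 0%N]addrC.
Qed.

Lemma abs_summable_shift1 (f : nat -> C) : abs_summable f ->
  abs_summable (fun k => f k.+1).
Proof.
move=> [M hM]; exists M => s us.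
have := hM (map succn s); rewrite big_map map_inj_uniq; first exact.
exact: succn_inj.
Qed.

Lemma abs_summableMb e v (B : R) : (forall k, absC (e k) <= B) -> abs_summable v ->
  abs_summable (fun k => e k * v k).
Proof.
by move=> eB; apply: sub_abs_summable (B) _ => k; rewrite absCM ler_wpM2r.
Qed.

Lemma abs_summable_diff v : abs_summable v -> abs_summable (diff v).
Proof.
move=> hv; have := abs_summableD hv (abs_summable_shift1 hv).
have h := abs_summable_shift1 hv.
move=> _; have := abs_summableD hv (sub_abs_summable (g := fun k => - v k.+1) (k := 1) _ h).
by apply=> k; rewrite absCN mul1r.
Qed.

Lemma summation_by_parts M e v S : (0 < M)%N -> mean_zero M e -> abs_summable v ->
  has_sum (fun k => e k * v k) S ->
  has_sum (fun k => parts_coef M e k * diff v k) (S - pmean M e * v 0%N).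
Proof.
move=> M0 em hv eS; set e1 := parts_coef M e.
have [B _ hB] := periodic_bounded M0 (proj1 (parts_coef_mean_zero M0 em)).
have h1 := abs_summableMb hB hv; rewrite -/e1 in h1.
have h2 := abs_summableMb hB (abs_summable_shift1 hv); rewrite -/e1 in h2.
have [G hG] := abs_summable_sum h1; have [H hH] := abs_summable_sum h2.
have GH := has_sumD hG (has_sumN hH).
have e1S k : e1 k.+1 - e1 k = e k.+1.
  by rewrite /e1 /parts_coef /psums big_nat_recr//=; ring.
have e10 : e1 0%N = e 0%N - pmean M e by rewrite /e1 /parts_coef /psums big_nat1.
(* The relation [e1S] starts at index [1], so the zeroth terms are split off here; [e10] turns what
   is left of them into the boundary term. *)
have E : S - e 0%N * v 0%N = (G - e1 0%N * v 0%N) - H.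
  apply: has_sum_unique (has_sum_shift1 eS) _.
  apply: eq_has_sum (has_sumD (has_sum_shift1 hG) (has_sumN hH)) => k.
  by rewrite -e1S; ring.
rewrite (_ : S - _ = G - H).
  by apply: eq_has_sum GH => k; rewrite /diff; ring.
rewrite (_ : G - H = (G - e1 0%N * v 0%N - H) + e1 0%N * v 0%N); last by ring.
by rewrite -E e10; ring.
Qed.

Definition parts_iter M p e := iter p (parts_coef M) e.

Definition parts_boundary M p e v : C :=
  \sum_(0 <= j < p) pmean M (parts_iter M j e) * iter j diff v 0%N.

Lemma parts_iter_mean_zero M p e : (0 < M)%N -> mean_zero M e ->
  mean_zero M (parts_iter M p e).
Proof. by move=> M0 em; elim: p => //= p; exact: parts_coef_mean_zero. Qed.

Lemma iter_diff_summable v p q : (p <= q)%N -> abs_summable (iter p diff v) ->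
  abs_summable (iter q diff v).
Proof.
move=> /subnKC <- h; elim: (q - p)%N => [|j IHj]; first by rewrite addn0.
by rewrite addnS /=; exact: abs_summable_diff.
Qed.

(** For [k ^ (- s)] with [Re s > 1] the start is [p = 0], with empty boundary; for the powers of
    logarithms, which are not summable themselves, it is [p = 3]. *)
Lemma iterated_parts M e v p q S : (0 < M)%N -> mean_zero M e -> (p <= q)%N ->
  abs_summable (iter p diff v) ->
  has_sum (fun k => parts_iter M p e k * iter p diff v k) (S - parts_boundary M p e v) ->
  has_sum (fun k => parts_iter M q e k * iter q diff v k) (S - parts_boundary M q e v).
Proof.
move=> M0 em /subnKC <- hv hS; elim: (q - p)%N => [|j IHj]; first by rewrite addn0.
rewrite addnS /= /parts_boundary big_nat_recr//= opprD addrA.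
apply: summation_by_parts => //; first exact: parts_iter_mean_zero.
by apply: iter_diff_summable hv; exact: leq_addr.
Qed.

End SummationByParts.

(** * The entire function and the continuation *)

Section Continuation.
Variable R : realType.
Local Notation C := (Cplx R).
Implicit Types (e v c : nat -> C) (M : nat) (s z : C).

Definition log_term i k : C := exp_term (- ln (k.+1%:R : R))%:C i.
Definition pow_seq s k : C := npowC k.+1 (- s).

Lemma log_term_lfun i k : log_term i k = (lfun i 0 (k.+1%:R : R))%:C.
Proof.
rewrite /log_term exp_term_real /exp_coeff /= /lfun /= expr0 divr1.
by rewrite hornerZ hornerXn [(- ln _) ^+ i]exprNn; congr (_%:C); exact: mulrAC.
Qed.

Lemma iter_diff_log_term p i k :
  iter p (@diff R) (log_term i) k = (iter p (@rdiff R) (lfun i 0) k.+1%:R)%:C.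
Proof.
elim: p k => [|p IHp] k /=; first exact: log_term_lfun.
rewrite {1}/diff !IHp {3}/rdiff natr1.
exact/esym/(rmorphB (real_complex R)).
Qed.

Lemma pow_seq_expand p s k :
  abs_summable (fun i => iter p (@diff R) (log_term i) k * s ^+ i) /\
  has_sum (fun i => iter p (@diff R) (log_term i) k * s ^+ i)
    (iter p (@diff R) (pow_seq s) k).
Proof.
elim: p k => [|p IHp] k /=.
  have E i : exp_term ((- ln (k.+1%:R : R))%:C * s) i = log_term i k * s ^+ i.
    by rewrite /log_term /exp_term exprMn mulrAC.
  split.
    apply: sub_abs_summable (1) _ (exp_term_summable ((- ln (k.+1%:R : R))%:C * s)).
    by move=> i; rewrite mul1r E.
  rewrite /pow_seq /npowC (_ : - s * _ = (- ln (k.+1%:R : R))%:C * s).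
    by apply: eq_has_sum (expC_sum _) => i; exact: E.
  by rewrite (rmorphN (real_complex R)) /=; ring.
have [a1 h1] := IHp k; have [a2 h2] := IHp k.+1.
split.
  have a3 := sub_abs_summable (g := fun i => - (iter p (@diff R) (log_term i) k.+1 * s ^+ i))
    (k := 1) _ a2.
  apply: sub_abs_summable (1) _ (abs_summableD a1 (a3 _)) => i.
    by rewrite mul1r {1}/diff mulrBl.
  by rewrite absCN mul1r.
by apply: eq_has_sum (has_sumD h1 (has_sumN h2)) => i; rewrite /diff mulrBl.
Qed.

Lemma rpow2_sum_le : exists2 K : R, 0 <= K &
  forall t : seq nat, uniq t -> \sum_(k <- t) rpow k.+1 2 <= K.
Proof.
have [|K K0 hK] := dirichlet_abs_cst (1 : C) (x := 2); first by rewrite ltr1n.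
exists K => // t ut; apply: le_trans (sum_nat_seq_le _ ut) _.
  by move=> k; exact: rpow_ge0.
apply: le_trans (hK (\max_(i <- t) i).+1); apply: ler_sum => k _.
by rewrite absC1 mul1r.
Qed.

Definition logdiff_const (r : nat) : R :=
  \prod_(0 <= l < r.+2) (r + l)%:R * r.+3%:R ^+ r.

Lemma logdiff_const_ge0 r : 0 <= logdiff_const r.
Proof. by rewrite mulr_ge0 ?exprn_ge0//; apply: prodr_ge0. Qed.

Lemma diff_log_sum_le r (t : seq nat) k : uniq t ->
  \sum_(i <- t) absC (iter r.+2 (@diff R) (log_term i) k) * r%:R ^+ i <=
  logdiff_const r * rpow k.+1 2.
Proof.
move=> ut; apply: le_trans (sum_nat_seq_le _ ut) _.
  by move=> i; rewrite mulr_ge0// exprn_ge0.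
rewrite (eq_bigr (fun i => `|iter r.+2 (@rdiff R) (lfun i 0) k.+1%:R| * r%:R ^+ i)).
  exact: rdiff_log_sum_le.
by move=> i _; rewrite (iter_diff_log_term r.+2) absC_real.
Qed.

(** This is [r = 1] in the bound, whence the number [3]: the weight [1 ^ i] isolates any given [i],
    whereas [r = 0] would say nothing about [i > 0]. *)
Lemma diff3_log_summable i : abs_summable (iter 3 (@diff R) (log_term i)).
Proof.
have [K K0 hK] := rpow2_sum_le; exists (logdiff_const 1 * K) => t ut.
apply: le_trans (ler_wpM2l (logdiff_const_ge0 1) (hK t ut)).
rewrite mulr_sumr; apply: ler_sum => k _.
have := @diff_log_sum_le 1 [:: i] k isT.
by rewrite big_seq1 expr1n mulr1.
Qed.

Section MeanZero.
Variables (M : nat) (e : nat -> C).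
Hypotheses (M0 : (0 < M)%N) (em : mean_zero M e).

(* Three summations by parts make the coefficient of [s^i] absolutely summable
   over [k]; further ones do not change its value, but each extends by one the
   radius in which the double sum over [k] and [i] is absolutely convergent. *)
Definition reg_coef i : C :=
  limn (series (fun k => parts_iter M 3 e k * iter 3 (@diff R) (log_term i) k))
  + parts_boundary M 3 e (log_term i).

Lemma parts_iter_bounded p : exists2 B : R, 0 <= B & forall k, absC (parts_iter M p e k) <= B.
Proof. exact: periodic_bounded M0 (proj1 (parts_iter_mean_zero p M0 em)). Qed.

Lemma reg_coef_sum r i : (0 < r)%N ->
  has_sum (fun k => parts_iter M r.+2 e k * iter r.+2 (@diff R) (log_term i) k)
    (reg_coef i - parts_boundary M r.+2 e (log_term i)).
Proof.
move=> r0; apply: (@iterated_parts R M e (log_term i) 3 r.+2) => //.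
  exact: diff3_log_summable.
have [B _ hB] := parts_iter_bounded 3.
have [S hS] := abs_summable_sum (abs_summableMb hB (diff3_log_summable i)).
by rewrite /reg_coef (series_lim (has_sum_series hS)) addrK.
Qed.

Lemma parts_boundary_expand p s :
  abs_summable (fun i => parts_boundary M p e (log_term i) * s ^+ i) /\
  has_sum (fun i => parts_boundary M p e (log_term i) * s ^+ i)
    (parts_boundary M p e (pow_seq s)).
Proof.
rewrite /parts_boundary; elim: p => [|p [a1 h1]].
  have z i : \sum_(0 <= j < 0) pmean M (parts_iter M j e) *
      iter j (@diff R) (log_term i) 0%N * s ^+ i = 0 by rewrite big_nil.
  split.
    by exists 0 => t ut; rewrite big1// => i _; rewrite big_nil mul0r absC0.
  rewrite big_nil; have := @has_sum_finite R nat (fun=> 0) [::] isT.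
  rewrite big_nil => h0; apply: eq_has_sum (h0 _) => // i.
  by rewrite big_nil mul0r.
have [a2 h2] := pow_seq_expand p s 0; set mu := pmean M (parts_iter M p e).
have a3 : abs_summable (fun i => mu * (iter p (@diff R) (log_term i) 0%N * s ^+ i)).
  by apply: sub_abs_summable (absC mu) _ a2 => i; rewrite absCM.
have E i : \sum_(0 <= j < p.+1) pmean M (parts_iter M j e) *
      iter j (@diff R) (log_term i) 0%N * s ^+ i =
    \sum_(0 <= j < p) pmean M (parts_iter M j e) *
      iter j (@diff R) (log_term i) 0%N * s ^+ i +
    mu * (iter p (@diff R) (log_term i) 0%N * s ^+ i).
  by rewrite big_nat_recr//= mulrA.
split.
  apply: sub_abs_summable (1) _ (abs_summableD a1 a3) => i.
  by rewrite mul1r mulr_suml E mulr_suml.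
rewrite big_nat_recr//=; apply: eq_has_sum (has_sumD h1 (has_sumZ mu h2)) => i.
by rewrite [RHS]mulr_suml E mulr_suml.
Qed.

Definition parts_fam p s (x : nat * nat) : C :=
  parts_iter M p e x.1 * (iter p (@diff R) (log_term x.2) x.1 * s ^+ x.2).

Lemma parts_fam_summable r s : absC s <= r%:R -> abs_summable (parts_fam r.+2 s).
Proof.
move=> sr; have [B B0 hB] := parts_iter_bounded r.+2.
have [K K0 hK] := rpow2_sum_le.
apply: (@abs_summable_pair R _ _ _ (fun k => B * (logdiff_const r * rpow k.+1 2))
   (B * (logdiff_const r * K))) => [k t ut|t ut]; last first.
  by rewrite -mulr_sumr -mulr_sumr ler_wpM2l// ler_wpM2l ?logdiff_const_ge0// hK.
apply: le_trans (_ : B * \sum_(i <- t)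
    absC (iter r.+2 (@diff R) (log_term i) k) * r%:R ^+ i <= _).
  rewrite mulr_sumr; apply: ler_sum => i _; rewrite /parts_fam !absCM absCX.
  apply: ler_pM => //; first by rewrite mulr_ge0// exprn_ge0.
  by rewrite ler_wpM2l// lerXn2r// nnegrE.
by rewrite ler_wpM2l// diff_log_sum_le.
Qed.

(** By rows, the double family sums to the series of differences of [k ^ (- s)]; by columns, to the
    coefficients [reg_coef i] less their boundary parts, which are expanded separately. The row
    total enters through [S], so summability, and with it the infinite radius, is available at every
    [s]. *)
Lemma reg_coef_expand r s : (0 < r)%N -> absC s <= r%:R ->
  abs_summable (fun i => reg_coef i * s ^+ i) /\
  forall S, has_sum (fun k => parts_iter M r.+2 e k * iter r.+2 (@diff R) (pow_seq s) k)
      (S - parts_boundary M r.+2 e (pow_seq s)) ->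
    has_sum (fun i => reg_coef i * s ^+ i) S.
Proof.
move=> r0 sr; have Fs := parts_fam_summable sr.
have rows k : has_sum (fun i => parts_fam r.+2 s (k, i))
    (parts_iter M r.+2 e k * iter r.+2 (@diff R) (pow_seq s) k).
  exact: (has_sumZ (parts_iter M r.+2 e k) (proj2 (pow_seq_expand r.+2 s k))).
have cols i : has_sum (fun k => parts_fam r.+2 s (k, i))
    ((reg_coef i - parts_boundary M r.+2 e (log_term i)) * s ^+ i).
  rewrite mulrC; apply: eq_has_sum (has_sumZ (s ^+ i) (reg_coef_sum i r0)) => k.
  by rewrite /parts_fam /=; ring.
have [b1 b2] := parts_boundary_expand r.+2 s.
have E i : (reg_coef i - parts_boundary M r.+2 e (log_term i)) * s ^+ i +
    parts_boundary M r.+2 e (log_term i) * s ^+ i = reg_coef i * s ^+ i by ring.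
split.
  have g1 := fibre_abs_summable (p := snd) Fs (fun i => has_sum_col (cols i)).
  by apply: sub_abs_summable (1) _ (abs_summableD g1 b1) => i; rewrite mul1r E.
move=> S hS; have [_ g2] := has_sum_row_col Fs rows cols hS.
rewrite -[S](subrK (parts_boundary M r.+2 e (pow_seq s))).
by apply: eq_has_sum (has_sumD g2 b2) => i; exact: E.
Qed.

Lemma reg_coef_radius (r : R) : conv_radius reg_coef r.
Proof.
move=> s _; have [n ns] : exists n, absC s <= n.+1%:R.
  exists (Num.truncn (absC s)); apply/ltW; exact: truncnS_gt.
by have [] := @reg_coef_expand n.+1 s isT ns.
Qed.

Lemma mean_zero_entire c s : (forall k, e k = c k.+1) -> 1 < complex.Re s ->
  dirichlet_series c s = psum reg_coef s.
Proof.
move=> ce hs; have [n ns] : exists n, absC s <= n.+1%:R.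
  exists (Num.truncn (absC s)); apply/ltW; exact: truncnS_gt.
have [B B0 hB] := periodic_bounded M0 (proj1 em).
have h1 := dirichlet_abs_cst (1 : C).
have vs : abs_summable (pow_seq s).
  apply: sub_abs_summable (1) _ (dirichlet_summable h1 hs) => k.
  by rewrite mul1r /dirichlet_term mul1r.
have cs : abs_summable (fun k => e k * pow_seq s k) by exact: abs_summableMb hB vs.
have [S hS] := abs_summable_sum cs.
have -> : dirichlet_series c s = S.
  by apply: dirichlet_seriesE; apply: eq_has_sum hS => k; rewrite ce.
have [_ /(_ S) h] := @reg_coef_expand n.+1 s isT ns.
apply/esym/psumE; apply: h.
apply: (@iterated_parts R M e (pow_seq s) 0 n.+3) => //.
by rewrite /parts_boundary big_nil subr0.
Qed.

End MeanZero.

Section Periodic.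
Variables (m : nat) (c : nat -> C).
Hypotheses (m0 : (0 < m)%N) (cm : forall k, c (k + m)%N = c k).

Lemma periodicM k q : c (k + q * m)%N = c k.
Proof.
elim: q => [|q IHq]; first by rewrite mul0n addn0.
by rewrite mulSn [(m + _)%N]addnC addnA cm.
Qed.

(* Since [m.+1 = 1] modulo [m], the twist multiplies the Dirichlet series by
   [1 - m.+1^(1-s)], and it kills the mean value of the coefficients. *)
Definition twist k : C := c k - m.+1%:R * (if (m.+1 %| k)%N then c k else 0).

Lemma sum_period n : \sum_(n <= k < n + m) c k = \sum_(0 <= k < m) c k.
Proof.
elim: n => [|n IHn]; first by rewrite add0n.
case: m m0 cm IHn => // m' _ cm' IHn.
rewrite -IHn addSn (@big_nat_recr _ _ _ (n + m'.+1)) /=; last by lia.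
by rewrite [RHS]big_ltn ?cm' 1?addrC//; lia.
Qed.

Lemma sum_periods q n : \sum_(n <= k < n + q * m) c k = q%:R * \sum_(0 <= k < m) c k.
Proof.
elim: q n => [|q IHq] n; first by rewrite mul0n addn0 big_geq// mul0r.
rewrite (@big_cat_nat _ _ _ (n + m)) ?leq_addr//=; last by rewrite leq_add2l mulSn leq_addr.
by rewrite sum_period mulSn addnA IHq -[q.+1]add1n natrD mulrDl mul1r.
Qed.

Lemma sum_multiples (f : nat -> C) q n : (0 < q)%N ->
  \sum_(1 <= k < (n * q).+1) (if (q %| k)%N then f k else 0) =
  \sum_(1 <= k < n.+1) f (k * q)%N.
Proof.
move=> q0; elim: n => [|n IHn]; first by rewrite !big_geq.
rewrite [RHS]big_nat_recr//= -IHn.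
rewrite (@big_cat_nat _ _ _ (n * q).+1)//=; last by rewrite ltnS leq_mul2r leqnSn orbT.
congr (_ + _); rewrite (@big_nat_recr _ _ _ (n.+1 * q) (n * q).+1) /=; last first.
  by rewrite ltn_pmul2r.
rewrite dvdn_mull// big_nat big1 ?add0r// => k /andP[k1 k2].
case: ifP => // /dvdnP[j kj]; move: k1 k2; rewrite kj.
by rewrite !ltn_pmul2r// ltnS => /leq_trans h /h; rewrite ltnn.
Qed.

(** Among [(m + 1) * m] consecutive integers [c] runs through [m + 1] periods; the multiples of
    [m + 1] run through a single one, as [k * (m + 1) = k] modulo [m], but with weight [m + 1]. *)
Lemma twist_mean_zero : mean_zero (m.+1 * m) (fun k => twist k.+1).
Proof.
split.
  move=> k; rewrite /twist -addSn periodicM dvdn_addl ?dvdn_mulr//.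
rewrite sumrB -mulr_sumr.
rewrite -(big_add1 _ _ 0%N (m.+1 * m).+1 predT c).
rewrite -(big_add1 _ _ 0%N (m.+1 * m).+1 predT (fun k => if (m.+1 %| k)%N then c k else 0)).
rewrite -[(m.+1 * m).+1]add1n sum_periods add1n mulnC sum_multiples//.
have -> : \sum_(1 <= k < m.+1) c (k * m.+1)%N = \sum_(1 <= k < m.+1) c k.
  by apply: eq_bigr => k _; rewrite mulnS periodicM.
have -> : \sum_(1 <= k < m.+1) c k = \sum_(0 <= k < m) c k by exact: (sum_period 1).
by rewrite subrr.
Qed.

Lemma twist_series s : 1 < complex.Re s ->
  dirichlet_series twist s =
  (1 - m.+1%:R * npowC m.+1 (- s)) * dirichlet_series c s.
Proof.
move=> hs; have [B B0 hB] := periodic_bounded m0 cm.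
have h := dirichlet_has_sum (bounded_dirichlet_abs hB) hs.
have h2 : has_sum (dirichlet_term (fun k => if (m.+1 %| k)%N then c k else 0) s)
    (npowC m.+1 (- s) * dirichlet_series c s).
  apply: (@has_sum_inj R _ _ (fun j => (j.+1 * m.+1).-1)%N
    (fun k => if (m.+1 %| k.+1)%N then Some (k.+1 %/ m.+1).-1 else None)) => [j|k|].
  - by rewrite prednK ?muln_gt0// dvdn_mull// mulnK.
  - case: ifP => [|h']; last by rewrite /dirichlet_term h' mul0r.
    move=> dk; have q0 : (0 < k.+1 %/ m.+1)%N by rewrite divn_gt0// dvdn_leq.
    by rewrite prednK// divnK.
  apply: eq_has_sum (has_sumZ (npowC m.+1 (- s)) h) => j.
  have jE : ((j.+1 * m.+1).-1.+1 = j.+1 * m.+1)%N by rewrite prednK// muln_gt0.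
  rewrite /comp /dirichlet_term jE dvdn_mull// npowCM//.
  by rewrite (_ : c (j.+1 * m.+1)%N = c j.+1); [ring|rewrite mulnS periodicM].
apply: dirichlet_seriesE.
rewrite mulrBl mul1r -mulrA.
apply: eq_has_sum (has_sumD h (has_sumN (has_sumZ m.+1%:R h2))) => k.
by rewrite /dirichlet_term /twist; ring.
Qed.

Definition twist_factor s : C := 1 - m.+1%:R * npowC m.+1 (- s).

Lemma mero_twist_factor z : mero_at twist_factor z.
Proof.
pose d := exp_term (- ln (m.+1%:R : R))%:C.
have hE s i : exp_term ((- ln (m.+1%:R : R))%:C * s) i = d i * s ^+ i.
  by rewrite /d /exp_term exprMn mulrAC.
have dr r : conv_radius d r.
  move=> s _; apply: sub_abs_summable (1) _
    (exp_term_summable ((- ln (m.+1%:R : R))%:C * s)) => i.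
  by rewrite mul1r hE.
have nE s : npowC m.+1 (- s) = psum d s.
  apply/esym/psumE; rewrite /npowC (_ : - s * _ = (- ln (m.+1%:R : R))%:C * s).
    by apply: eq_has_sum (expC_sum _) => i; exact: hE.
  by rewrite (rmorphN (real_complex R)) /=; ring.
rewrite (_ : twist_factor = fun s => 1 + (- m.+1%:R) * psum d s); last first.
  by apply/funext => s; rewrite /twist_factor nE mulNr.
apply: mero_atD; first exact: mero_at_cst.
by apply: mero_atM; [exact: mero_at_cst|exact: mero_at_entire].
Qed.

(** A zero forces [|(m + 1) ^ (1 - s)| = 1], that is [Re s = 1]. *)
Lemma twist_factor_neq0 s : complex.Re s != 1 -> twist_factor s != 0.
Proof.
move=> s1; rewrite subr_eq0; apply/eqP => /(congr1 (@absC R)).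
rewrite absC1 absCM absC_nat absC_npowC ReN.
have l0 : 0 < ln (m.+1%:R : R) by rewrite ln_gt0// ltr1n ltnS.
rewrite -{1}[m.+1%:R : R]lnK ?posrE ?ltr0n// -expRD => /esym/(congr1 (@ln R)).
rewrite expRK ln1 -{1}[ln _]mul1r -mulrDl => /eqP.
by rewrite mulf_eq0 [ln _ == 0]gt_eqF// orbF subr_eq0 eq_sym (negPf s1).
Qed.

Lemma twist_factor_near z : \forall s \near z^', twist_factor s != 0.
Proof.
have [/dnear_absCP[r r0 h]|//] := mero_dichotomy (mero_twist_factor z).
exfalso.
(* If the factor vanished near [z], the points [z + r / 2] and [z + r / 3] would both have real part
   [1]. *)
have key (t : R) : 0 < t -> t < r -> complex.Re z + t = 1.
  move=> t0 tr; apply/eqP/negPn/negP => ne.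
  have tC : absC (t%:C : C) = t by rewrite absC_real gtr0_norm.
  have := h (z + t%:C); rewrite -subr_eq0 [z + _]addrC addrK tC => /(_ _ tr).
  rewrite -absC_eq0 tC gt_eqF// => /(_ isT) /eqP.
  by apply/negP; apply: twist_factor_neq0; rewrite ReD addrC.
have k1 := key (r / 2); have k2 := key (r / 3).
have : r / 2 = r / 3.
  apply: (@addrI _ (complex.Re z)); rewrite k1 ?k2 ?divr_gt0//; lra.
lra.
Qed.

Lemma near_Re_gt1 s : 1 < complex.Re s -> \forall z \near s, 1 < complex.Re z.
Proof.
move=> hs; apply/near_absCP; exists (complex.Re s - 1); first by rewrite subr_gt0.
move=> z zs; have := le_lt_trans (Re_le_absC _) zs.
by rewrite ReD ReN ltr_norml => /andP[+ _]; lra.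
Qed.

Lemma periodic_continuation :
  exists F : C -> C, meromorphic_continuation (dirichlet_series c) F.
Proof.
have mM : (0 < m.+1 * m)%N by rewrite muln_gt0.
pose E := psum (reg_coef (m.+1 * m) (fun k => twist k.+1)).
have [B B0 hB] := periodic_bounded m0 cm.
exists (fun s => if 1 < complex.Re s then dirichlet_series c s
          else E s * (twist_factor s)^-1); split; last by move=> s ->.
apply: mero_patch => z.
- exact: near_Re_gt1.
- move=> hz; apply: analytic_mero_at; apply: dirichlet_analytic hz.
  exact: bounded_dirichlet_abs hB.
- move=> _; apply: mero_atM; last exact: mero_atV (mero_twist_factor z).
  by apply: mero_at_entire => r; exact: reg_coef_radius mM twist_mean_zero r.
move=> _; have /dnear_absCP[r r0 h] := twist_factor_near z.
apply/dnear_absCP; exists r => // s sz sr hs.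
rewrite /E -(mean_zero_entire mM twist_mean_zero (c := twist) _ hs)//.
by rewrite (twist_series hs) -/(twist_factor s) mulrC mulKf// h.
Qed.

End Periodic.
End Continuation.

(** * Orthogonality of Dirichlet characters *)

Section SeparatingCharacters.
Variable F : closedFieldType.

Lemma unity_roots n : (n%:R : F) != 0 ->
  exists2 rs : seq F, uniq rs & 'X^n - 1 = \prod_(x <- rs) ('X - x%:P).
Proof.
move=> n0; have n0' : (0 < n)%N by case: n n0 => //; rewrite eqxx.
have [rs rsE] := closed_field_poly_normal ('X^n - 1 : {poly F}).
have lc : lead_coef ('X^n - 1 : {poly F}) = 1.
  by rewrite lead_coefDl ?lead_coefXn// size_polyN size_poly1 size_polyXn ltnS.
rewrite lc scale1r in rsE; exists rs => //.
by rewrite -(separable_prod_XsubC rs) -rsE separable_Xn_sub_1.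
Qed.

(** The minimal polynomial divides [X^e - 1], which has simple roots as [e] is nonzero in [F]. The
    power is written with [iter] because square matrices form a ring only in positive size; size [0]
    is treated apart. *)
Lemma finite_order_diagonalizable n (A : 'M[F]_n) e : (e%:R : F) != 0 ->
  iter e (mulmx A) 1%:M = 1%:M -> diagonalizable A.
Proof.
case: n A => [|n] A e0 Ae.
  by exists 1%:M; rewrite ?unitmx1//; apply/diagonalizable_forP; rewrite ?unitmx1// => -[].
apply/diagonalizableP; have [rs urs rsE] := unity_roots e0.
exists rs => //; rewrite -rsE; apply: mxminpoly_min.
rewrite rmorphB rmorph1 rmorphXn /= horner_mx_X.
have AX j : A ^+ j = iter j (mulmx A) 1%:M.
  by elim: j => [|j IHj]; rewrite ?expr0// exprS IHj.
by rewrite AX Ae subrr.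
Qed.

Variables (gT : finGroupType) (G : {group gT}).
Hypotheses (abG : abelian G) (G0 : (#|G|%:R : F) != 0).

(* The matrices of the regular representation commute and have finite order, so
   they are simultaneously diagonalizable; each diagonal entry is a character,
   and one of them is nontrivial at [b] by faithfulness. *)
Lemma separating_character b : b \in G -> b != 1%g ->
  exists2 X : gT -> F, X 1%g = 1 /\ {in G &, {morph X : x y / (x * y)%g >-> x * y}} &
    X b != 1.
Proof.
move=> bG b1; pose rG := regular_repr F G.
pose As := [seq rG x | x in G].
have /codiagonalizableP[P Pu /allP AsD] :
   {in As &, forall A B, comm_mx A B} /\ {in As, forall A, diagonalizable A}.
  split=> [A B /fintype.imageP[x xG ->] /fintype.imageP[y yG ->]|A /fintype.imageP[x xG ->]].
    by rewrite /comm_mx -!repr_mxM// (centsP abG).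
  apply: (finite_order_diagonalizable G0).
  have -> : iter #|G| (mulmx (rG x)) 1%:M = rG (x ^+ #|G|)%g.
    elim: #|G| => [|k IHk] /=; first by rewrite expg0 repr_mx1.
    by rewrite IHk expgS repr_mxM ?groupX.
  by rewrite expg_cardG// repr_mx1.
pose D x := P *m rG x *m invmx P.
have Doff x (i j : 'I_#|G|) : x \in G -> i != j -> D x i j = 0.
  move=> xG ij; have /AsD : rG x \in As by apply/fintype.imageP; exists x.
  by move/(diagonalizable_forP _ Pu); apply.
have DM x y : x \in G -> y \in G -> D (x * y)%g = D x *m D y.
  by move=> xG yG; rewrite /D repr_mxM// !mulmxA mulmxKV.
have D1 : D 1%g = 1%:M by rewrite /D repr_mx1 mulmx1 mulmxV.
have [i bi] : exists i, D b i i != 1.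
  apply/existsP; rewrite -negb_forall; apply/negP => /forallP Db1.
  have : b \in rker rG.
    rewrite inE bG /=; apply/eqP; rewrite mul1mx.
    have : D b = 1%:M.
      apply/matrixP => i j; rewrite [RHS]mxE; case: (eqVneq i j) => [->|ij].
        exact/eqP/Db1.
      exact: Doff.
    rewrite /D => /(congr1 (mulmx (invmx P))); rewrite !mulmxA mulVmx// mul1mx mulmx1.
    by move=> /(congr1 (mulmx^~ P)); rewrite mulmxKV// mulVmx.
  by move/(fintype.subsetP (regular_mx_faithful F G)); rewrite inE (negPf b1).
exists (fun x => D x i i) => //; split; first by rewrite D1 mxE eqxx.
move=> x y xG yG; rewrite DM// mxE (bigD1 i)//= big1 ?addr0// => j ji.
by rewrite Doff// 1?eq_sym// mul0r.
Qed.

End SeparatingCharacters.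

(** * Dirichlet characters as functions on the integers *)

Section DirichletCharacterTheory.
Variable R : realType.
Local Notation C := (Cplx R).
Variable m : nat.
Hypothesis m2 : (2 <= m)%N.
Implicit Types (chi : int -> C) (a b k l : int).

Lemma intZp_eq k l : (k%:~R = l%:~R :> 'Z_m) <-> (k = l %[mod m])%Z.
Proof.
have mZ : (m%:R : 'Z_m) = 0 by exact: pchar_Zp.
have modE j : (j%:~R : 'Z_m) = (j %% m)%Z%:~R.
  by rewrite {1}(divz_eq j m) rmorphD rmorphM /= -[m%:~R]/(m%:R) mZ mulr0 add0r.
split=> [|E]; last by rewrite modE E -modE.
rewrite modE [RHS]modE.
have m0 : (m%:Z : int) != 0 by rewrite eqz_nat -lt0n ltnW.
have := modz_ge0 k m0; have := modz_ge0 l m0.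
have mm : 0 < m%:Z by rewrite ltz_nat ltnW.
have := ltz_pmod k mm; have := ltz_pmod l mm.
case: (k %% m)%Z => // x; case: (l %% m)%Z => // y.
rewrite !ltz_nat => ym xm _ _.
rewrite -[(Posz x)%:~R]/(x%:R) -[(Posz y)%:~R]/(y%:R) => /(congr1 val) /=.
by rewrite !val_Zp_nat// !modn_small// => ->.
Qed.

Lemma coprimez_unit k : coprimez k m = ((k%:~R : 'Z_m) \is a GRing.unit).
Proof.
have [x kx] : exists x : nat, (k = x %[mod m])%Z.
  have m0 : (m%:Z : int) != 0 by rewrite eqz_nat -lt0n ltnW.
  have := modz_ge0 k m0; case E: (k %% m)%Z => [x|//] _; exists x.
  by rewrite -E modz_mod.
rewrite (proj2 (intZp_eq _ _) kx) -[(Posz x)%:~R]/(x%:R) unitZpE//.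
rewrite coprime_sym -[RHS]/(coprimez x m) /coprimez.
by rewrite -gcdz_modl kx gcdz_modl.
Qed.

Lemma dirichlet_char_mod chi k l : dirichlet_char m chi ->
  (k = l %[mod m])%Z -> chi k = chi l.
Proof.
move=> [_ chiP _].
have chiPn (q : nat) j : chi (j + q%:Z * m%:Z) = chi j.
  elim: q j => [|q IHq] j; first by rewrite mul0r addr0.
  by rewrite -addn1 PoszD mulrDl mul1r addrA chiP IHq.
have chiPz (q : int) j : chi (j + q * m%:Z) = chi j.
  case: q => q; first exact: chiPn.
  by rewrite NegzE -[LHS](chiPn q.+1) -addrA -mulrDl addNr mul0r addr0.
move=> kl; rewrite (divz_eq k m) (divz_eq l m) kl addrC chiPz.
by rewrite addrC chiPz.
Qed.

Lemma dirichlet_char1 chi : dirichlet_char m chi -> chi 1 = 1.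
Proof.
move=> [chiM _ chi0]; have c1 : chi 1 != 0 by apply/chi0; exact: (coprime1n m).
by apply: (mulfI c1); rewrite -chiM !mulr1.
Qed.

Lemma dirichlet_charX chi k n : dirichlet_char m chi -> chi (k ^+ n) = chi k ^+ n.
Proof.
move=> hchi; have [chiM _ _] := hchi; elim: n => [|n IHn].
  by rewrite !expr0 dirichlet_char1.
by rewrite !exprS chiM IHn.
Qed.

Lemma dirichlet_char_eq0 chi k : dirichlet_char m chi -> ~~ coprimez k m -> chi k = 0.
Proof. by move=> [_ _ chi0] kc; apply/eqP/negPn/negP => /chi0; apply/negP. Qed.

Lemma int_Euler k : coprimez k m -> (k ^+ totient m = 1 %[mod m])%Z.
Proof.
move=> kc.
have m0 : (m%:Z : int) != 0 by rewrite eqz_nat -lt0n ltnW.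
have [x kx] : exists x : nat, (k = x %[mod m])%Z.
  have := modz_ge0 k m0; case E: (k %% m)%Z => [x|//] _; exists x.
  by rewrite -E modz_mod.
have xc : coprime x m.
  by move: kc; rewrite /coprimez -gcdz_modl kx gcdz_modl.
rewrite -modzXm kx modzXm.
have -> : x%:Z ^+ totient m = (x ^ totient m)%N%:Z by rewrite -!natz natrX.
by rewrite !modz_nat (Euler_exp_totient xc).
Qed.

Lemma dirichlet_char_root chi k : dirichlet_char m chi -> coprimez k m ->
  chi k ^+ totient m = 1.
Proof.
move=> hchi kc; rewrite -dirichlet_charX//.
by rewrite (dirichlet_char_mod hchi (int_Euler kc)) dirichlet_char1.
Qed.

Lemma totient_m_gt0 : (0 < totient m)%N.
Proof. by rewrite totient_gt0 ltnW. Qed.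

Lemma absC_dirichlet_char chi k : dirichlet_char m chi -> absC (chi k) <= 1.
Proof.
move=> hchi; have [kc|kc] := boolP (coprimez k m); last first.
  by rewrite dirichlet_char_eq0// absC0.
have /(congr1 (@absC R)) := dirichlet_char_root hchi kc.
rewrite absCX absC1 => /eqP; rewrite pexpr_eq1 ?totient_m_gt0//.
by move=> /eqP ->.
Qed.

(** A character is determined by its values at [0, ..., m - 1], each of which is [0] or a root of
    unity of order dividing [totient m]; [g] rebuilds it from the table of indices into this
    list. *)
Lemma finite_dirichlet_chars : finite_set [set chi : int -> C | dirichlet_char m chi].
Proof.
have t0 : ((totient m)%:R : R[i]) != 0 by rewrite pnatr_eq0 -lt0n totient_m_gt0.
have [rs _ rsE] := unity_roots t0.
pose V : seq C := 0 :: rs.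
pose g (f : {ffun 'I_m -> 'I_(size V)}) (k : int) : C :=
  if insub `|k %% m|%Z%N is Some i then nth 0 V (f i) else 0.
apply: (@sub_finite_set _ _ [set g f | f in setT]); last first.
  by apply: finite_image; exact: finite_finset.
move=> chi hchi /=.
have m0 : (m%:Z : int) != 0 by rewrite eqz_nat -lt0n ltnW.
have inV k : chi k \in V.
  rewrite inE; have [kc|kc] := boolP (coprimez k m); last by rewrite dirichlet_char_eq0 ?eqxx.
  apply/orP; right; rewrite -root_prod_XsubC -rsE rootE !hornerE.
  by rewrite dirichlet_char_root// subrr.
have idx k : (index (chi k) V < size V)%N by rewrite index_mem.
exists [ffun i : 'I_m => Ordinal (idx i%:Z)] => //.
apply/funext => k; rewrite /g; case: insubP => [i _ iE|].
  rewrite ffunE /= nth_index//; apply: dirichlet_char_mod hchi _.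
  by rewrite iE gez0_abs ?modz_ge0// modz_mod.
have mm : 0 < m%:Z by rewrite ltz_nat ltnW.
by rewrite -ltz_nat gez0_abs ?modz_ge0// ltz_pmod.
Qed.

Lemma separating_dirichlet_char b : coprimez b m -> ~ (b = 1 %[mod m])%Z ->
  exists2 chi : int -> C, dirichlet_char m chi & chi b != 1.
Proof.
move=> bc b1; pose G : {group {unit 'Z_m}} := [set: {unit 'Z_m}]%G.
have abG : abelian G by exact: units_Zp_abelian.
have G0 : (#|G|%:R : R[i]) != 0 by rewrite pnatr_eq0 -lt0n cardG_gt0.
(* The default [1], taken when [k] is not coprime to [m], is masked by the [if] in the character
   built below. *)
pose u k : {unit 'Z_m} := insubd (1%g : {unit 'Z_m}) (k%:~R : 'Z_m).
have uE k : coprimez k m -> val (u k) = k%:~R.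
  by rewrite coprimez_unit => kc; rewrite val_insubd kc.
have ub : u b != 1%g.
  apply/eqP => /(congr1 val); rewrite uE// => E; apply: b1; apply/intZp_eq.
  by rewrite E rmorph1.
have uG k : u k \in G by rewrite inE.
have [X [X1 XM] Xb] := separating_character abG G0 (uG b) ub.
exists (fun k => if coprimez k m then X (u k) else 0); last by rewrite bc.
split=> [k l|k|k].
- rewrite coprimezMl; case: (boolP (coprimez k m)) => [kc|_]; last by rewrite mul0r.
  case: (boolP (coprimez l m)) => [lc|_]; last by rewrite mulr0.
  rewrite /= -XM ?inE//; congr X; apply: val_inj.
  by rewrite uE ?coprimezMl ?kc//= !uE// rmorphM.
- have km : ((k + m)%:~R : 'Z_m) = k%:~R by apply/intZp_eq; rewrite modzDr.
  by rewrite !coprimez_unit km /u km.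
case: ifP => kc; last by rewrite eqxx.
split=> // _; apply/eqP => Xk.
have := XM (u k) (u k)^-1%g (uG k) (groupVr (uG k)).
by rewrite mulgV X1 Xk mul0r => /eqP; rewrite oner_eq0.
Qed.

Definition chars : seq (int -> C) :=
  finmap.enum_fset (fset_set [set chi : int -> C | dirichlet_char m chi]).

Lemma mem_chars chi : (chi \in chars) <-> dirichlet_char m chi.
Proof.
rewrite /chars in_fset_set; last exact: finite_dirichlet_chars.
by split=> [/set_mem|/mem_set].
Qed.

Lemma uniq_chars : uniq chars. Proof. exact: finmap.fset_uniq. Qed.

Lemma dirichlet_charM chi psi : dirichlet_char m chi -> dirichlet_char m psi ->
  dirichlet_char m (fun k => chi k * psi k).
Proof.
move=> [M1 P1 Z1] [M2 P2 Z2]; split=> [k l|k|k].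
- by rewrite M1 M2; ring.
- by rewrite P1 P2.
rewrite mulf_eq0 negb_or; split=> [/andP[/Z1]//|kc].
by apply/andP; split; [apply/Z1|apply/Z2].
Qed.

Lemma sum_chars_eq0 b : ~ (b = 1 %[mod m])%Z -> \sum_(chi <- chars) chi b = 0.
Proof.
move=> b1; have [bc|bc] := boolP (coprimez b m); last first.
  by rewrite big_seq big1// => chi /mem_chars hchi; exact: dirichlet_char_eq0.
have [psi hpsi psib] := separating_dirichlet_char bc b1.
(* Multiplication by [psi] permutes the characters, so the sum equals [psi b] times itself. Here
   [uniq_min_size] makes a permutation out of an injection of a finite list into itself. *)
pose T chi k := psi k * chi k.
have Tinj : {in chars &, injective T}.
  move=> chi chi' /mem_chars hchi /mem_chars hchi' E; apply/funext => k.
  have [kc|kc] := boolP (coprimez k m); last by rewrite !dirichlet_char_eq0.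
  have pk : psi k != 0 by case: hpsi => _ _ Z; apply/Z.
  by apply: (mulfI pk); exact: (congr1 (fun f => f k) E).
have sub : {subset map T chars <= chars}.
  by move=> _ /mapP[chi /mem_chars hchi ->]; apply/mem_chars; exact: dirichlet_charM.
have Tu : uniq (map T chars) by rewrite map_inj_in_uniq// uniq_chars.
have [_ Teq] := uniq_min_size Tu sub (eq_leq (esym (size_map _ _))).
have : \sum_(chi <- map T chars) chi b = \sum_(chi <- chars) chi b.
  by apply: perm_big; apply: uniq_perm => //; exact: uniq_chars.
rewrite big_map -mulr_sumr => /eqP; rewrite -subr_eq0 -{2}[\sum_(_ <- _) _]mul1r -mulrBl.
by rewrite mulf_eq0 subr_eq0 (negPf psib) => /eqP.
Qed.

Lemma principal_char_dirichlet : dirichlet_char m (principal_char R m).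
Proof.
split=> [k l|k|k]; rewrite /principal_char.
- by rewrite coprimezMl -mulnb natrM.
- by rewrite /coprimez -gcdz_modl modzDr gcdz_modl.
by case: (coprimez k m); rewrite ?oner_eq0 ?eqxx.
Qed.

Lemma sum_dirichlet_char chi : dirichlet_char m chi -> chi <> principal_char R m ->
  \sum_(0 <= k < m) chi k%:Z = 0.
Proof.
move=> hchi chi1; have [chiM _ chi0] := hchi.
have [b [bc cb]] : exists b, coprimez b m /\ chi b != 1.
  apply: contrapT => h; apply: chi1; apply/funext => k; rewrite /principal_char.
  have [kc|kc] := boolP (coprimez k m); last exact: dirichlet_char_eq0.
  by apply/eqP/negPn/negP => ck; apply: h; exists k.
have m0 : (m%:Z : int) != 0 by rewrite eqz_nat -lt0n ltnW.
have mm : 0 < m%:Z by rewrite ltz_nat ltnW.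
(* The dual argument: multiplication by [b] permutes the residues, so the sum equals [chi b] times
   itself. *)
pose T (k : nat) := `|(b * k%:Z %% m)%Z|%N.
have TE (k : nat) : (T k)%:Z = (b * k%:Z %% m)%Z by rewrite /T gez0_abs ?modz_ge0.
have Tlt (k : nat) : (T k < m)%N by rewrite -ltz_nat TE ltz_pmod.
have Tinj : {in iota 0 m &, injective T}.
  move=> x y; rewrite !mem_iota !add0n /= => xm ym /(congr1 Posz); rewrite !TE.
  move=> /eqP; rewrite eqz_mod_dvd -mulrBr Gauss_dvdzr; last by rewrite coprimez_sym.
  by rewrite -eqz_mod_dvd !modz_nat !modn_small// => /eqP[].
have sub : {subset map T (iota 0 m) <= iota 0 m}.
  by move=> _ /mapP[x _ ->]; rewrite mem_iota add0n Tlt.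
have Tu : uniq (map T (iota 0 m)) by rewrite map_inj_in_uniq// iota_uniq.
have [_ Teq] := uniq_min_size Tu sub (eq_leq (esym (size_map _ _))).
have : \sum_(k <- map T (iota 0 m)) chi k%:Z = \sum_(k <- iota 0 m) chi k%:Z.
  by apply: perm_big; apply: uniq_perm => //; exact: iota_uniq.
rewrite big_map (eq_bigr (fun k : nat => chi b * chi k%:Z)); last first.
  move=> k _; rewrite -chiM; apply: dirichlet_char_mod hchi _.
  by rewrite TE modz_mod.
rewrite -mulr_sumr /index_iota subn0 => /eqP.
rewrite -subr_eq0 -{2}[\sum_(_ <- _) _]mul1r -mulrBl.
by rewrite mulf_eq0 subr_eq0 (negPf cb) => /eqP.
Qed.

(** The number of characters, by double counting [chi k]: summing over [k] first leaves only the
    principal character, summing over [chi] first leaves only [k = 1]. *)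
Lemma sum_chars1 : \sum_(chi <- chars) chi 1 = (totient m)%:R.
Proof.
have pm : principal_char R m \in chars by apply/mem_chars; exact: principal_char_dirichlet.
have E1 : \sum_(chi <- chars) \sum_(0 <= k < m) chi k%:Z = (totient m)%:R.
  rewrite (bigD1_seq _ pm uniq_chars) /= [X in _ + X]big_seq_cond [X in _ + X]big1 ?addr0.
    rewrite totient_count_coprime natr_sum; apply: eq_bigr => k _.
    by rewrite /principal_char /coprimez /= coprime_sym.
  by move=> chi /andP[/mem_chars hchi /eqP]; exact: sum_dirichlet_char.
rewrite -E1 exchange_big /= (bigD1_seq 1%N) ?iota_uniq ?mem_index_iota//=.
rewrite [X in _ + X]big_seq_cond.
rewrite [X in _ + X]big1 ?addr0// => k; rewrite mem_index_iota => /andP[/andP[_ km] k1].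
apply: sum_chars_eq0; rewrite !modz_nat !modn_small// => -[]; exact/eqP.
Qed.

Lemma sum_chars b : \sum_(chi <- chars) chi b =
  if (b == 1 %[mod m])%Z then (totient m)%:R else 0.
Proof.
case: eqP => [b1|]; last exact: sum_chars_eq0.
rewrite -sum_chars1 big_seq [RHS]big_seq; apply: eq_bigr => chi /mem_chars hchi.
exact: dirichlet_char_mod hchi b1.
Qed.

Lemma chars_orthogonality n a k : (0 < n)%N -> coprimez a m ->
  \sum_(chi <- chars) (chi a)^-1 * chi k ^+ n =
  if (k ^+ n == a %[mod m])%Z then (totient m)%:R else 0.
Proof.
move=> n0 ac; have /coprimezP[[u v] /= uv] := ac.
(* The Bezout coefficient [u] inverts [a] modulo [m], so [chi u] is [(chi a)^-1] and the sum becomes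
   that of [chi (u * k ^+ n)]. *)
have ua : (u * a = 1 %[mod m])%Z by rewrite -uv addrC modzMDl.
have uc : coprimez u m by apply/coprimezP; exists (a, v); rewrite /= mulrC.
rewrite big_seq (eq_bigr (fun chi : int -> C => chi (u * k ^+ n))); last first.
  move=> chi /mem_chars hchi; have [chiM _ _] := hchi.
  have h : chi u * chi a = 1.
    by rewrite -chiM (dirichlet_char_mod hchi ua) dirichlet_char1.
  have ca : chi a != 0.
    by apply/eqP => ca0; move: h; rewrite ca0 mulr0 => /eqP; rewrite eq_sym oner_eq0.
  rewrite chiM dirichlet_charX//; congr (_ * _); apply: (mulIf ca).
  by rewrite mulVf.
rewrite -big_seq sum_chars; congr (if _ then _ else _).
rewrite !eqz_mod_dvd; rewrite -(Gauss_dvdzr (k ^+ n - a) (n := u)); last first.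
  by rewrite coprimez_sym.
have -> : u * (k ^+ n - a) = (u * k ^+ n - 1) + v * m by rewrite -uv; ring.
by rewrite [RHS]rpredDr//; apply/dvdzP; exists v.
Qed.

End DirichletCharacterTheory.

(** * The logarithmic derivatives and the residue *)

Section LogarithmicDerivative.
Variable R : realType.
Local Notation C := (Cplx R).
Variable m : nat.
Hypothesis m2 : (2 <= m)%N.
Variable psi : int -> C.
Hypothesis hpsi : dirichlet_char m psi.
Implicit Types (s z : C).

Let c (k : nat) : C := psi k%:Z.

Lemma char_coef_le1 k : absC (c k) <= 1.
Proof. exact: absC_dirichlet_char m2 _ _ hpsi. Qed.

Lemma char_coefM k l : c (k * l)%N = c k * c l.
Proof. by rewrite /c PoszM; case: hpsi. Qed.

Lemma char_coef_periodic k : c (k + m)%N = c k.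
Proof. by rewrite /c PoszD; case: hpsi. Qed.

Lemma char_dirichlet_abs : dirichlet_abs c.
Proof. exact: bounded_dirichlet_abs char_coef_le1. Qed.

(* [Lfun] alone would denote the Lebesgue function space of MathComp-Analysis. *)
Lemma LfunP : meromorphic_continuation (dirichlet_series c) (Defs.Lfun psi).
Proof.
have [F hF] := periodic_continuation (ltnW m2) char_coef_periodic.
exact: (xgetI _ hF).
Qed.

Lemma Lfun_mero z : mero_at (Defs.Lfun psi) z. Proof. by have [h _] := LfunP; exact: h. Qed.

(** Vanishing near [z] would spread to a punctured neighbourhood of a point [s0] where the series is
    nonzero; the value at [s0] itself is then reached through the constant coefficient of the
    expansion there. *)
Lemma Lfun_near z : \forall s \near z^', Defs.Lfun psi s != 0.
Proof.
have [h0|//] := mero_dichotomy (Lfun_mero z); exfalso.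
have [s0 hs0] := dirichlet_series_neq0 (dirichlet_char1 hpsi) char_coef_le1.
have /dnear_absCP[r r0 h] := mero_identity s0 Lfun_mero h0.
have [h1 h2] := dirichlet_recentre char_dirichlet_abs hs0.
have d0 : 0 < complex.Re s0 - 1 by rewrite subr_gt0.
pose t := Num.min r (complex.Re s0 - 1).
have t0 : 0 < t by rewrite lt_min r0.
have h1t : conv_radius (dirichlet_coef c s0) t.
  by apply: conv_radiusW h1; rewrite ge_min lexx orbT.
have cz := psum_eq0 t0 h1t.
have c0 : dirichlet_coef c s0 0 = 0.
  apply: cz => w w0; rewrite lt_min => /andP[wr wd].
  rewrite -h2// -(proj2 LfunP); last first.
    rewrite ReD; have := le_lt_trans (Re_le_absC w) wd.
    by rewrite ltr_norml => /andP[]; lra.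
  apply: h; first by rewrite -subr_eq0 [s0 + w]addrC addrK.
  by rewrite [s0 + w]addrC addrK.
have := h2 0; rewrite absC0 addr0 psum_at0 c0 => /(_ d0) ->.
by rewrite eqxx.
Qed.

Definition log_deriv s : C := derive1 (Defs.Lfun psi) s / Defs.Lfun psi s.

Lemma log_deriv_mero z : mero_at log_deriv z.
Proof.
apply: mero_atM; first exact: mero_at_derive1 (Lfun_mero z).
exact: mero_atV (Lfun_mero z).
Qed.

Lemma derive1_Lfun s : 1 < complex.Re s ->
  derive1 (Defs.Lfun psi) s = derive1 (dirichlet_series c) s.
Proof.
move=> hs; have [h1 h2] := dirichlet_recentre char_dirichlet_abs hs.
have r0 : 0 < complex.Re s - 1 by rewrite subr_gt0.
have d := is_derive_pow_expansion r0 h1 h2.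
have d' : is_derive s 1 (Defs.Lfun psi) (dirichlet_coef c s 1).
  apply: near_eq_is_derive d; have /near_absCP[r r1 h] := near_Re_gt1 hs.
  by apply/near_absCP; exists r => // z /h /(proj2 LfunP) ->.
by rewrite !derive1E (@derive_val _ _ _ _ _ _ _ d) (@derive_val _ _ _ _ _ _ _ d').
Qed.

Lemma log_derivE s : 1 < complex.Re s -> Defs.Lfun psi s != 0 ->
  dirichlet_series (fun k => (von_mangoldt R k)%:C * c k) s = - log_deriv s.
Proof.
move=> hs L0; rewrite /log_deriv derive1_Lfun// -mulNr.
rewrite -(dirichlet_log_derivative char_coef_le1 char_coefM hs) (proj2 LfunP)//.
by rewrite mulfK// -(proj2 LfunP).
Qed.

Lemma rhoP :
  is_residue (fun s => derive1 (Defs.Lfun psi) s / (s * Defs.Lfun psi s)) 0 (rho psi).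
Proof.
apply: residueP; apply: mero_atM; first exact: mero_at_derive1 (Lfun_mero 0).
apply: mero_atV; apply: mero_atM; last exact: Lfun_mero.
pose d (k : nat) : C := (k == 1%N)%:R.
have d2 k : (2 <= k)%N -> d k = 0 by case: k => [|[|k]].
rewrite (_ : (fun s => s) = psum d).
  by apply: mero_at_entire => r; exact: conv_radius_poly d2.
apply/funext => s; rewrite (psum_poly _ d2) 2?big_ltn// big_geq//.
by rewrite /d /= mul0r add0r mul1r addr0 expr1.
Qed.

End LogarithmicDerivative.

(** * Continuation of [xi] and its residue *)

Section MainTheorem.
Variable R : realType.
Local Notation C := (Cplx R).
Variables (m n : nat) (a : int).
Hypotheses (m2 : (2 <= m)%N) (ha : coprimez a m) (n1 : (1 <= n)%N).
Implicit Types (s z : C) (chi : int -> C).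

Lemma char_exp_dirichlet chi : dirichlet_char m chi -> dirichlet_char m (char_exp chi n).
Proof.
move=> [chiM chiP chi0]; split=> [k l|k|k]; rewrite /char_exp.
- by rewrite chiM exprMn.
- by rewrite chiP.
by rewrite expf_eq0 n1; exact: chi0.
Qed.

Lemma xi_coef_abs : dirichlet_abs (xi_coef R m n a).
Proof.
have h : forall k, absC (if (k%:Z ^+ n == a %[mod m])%Z then 1 else 0 : C) <= 1.
  by move=> k; case: ifP; rewrite ?absC1 ?absC0.
rewrite (_ : xi_coef R m n a = fun k => (von_mangoldt R k)%:C *
  (if (k%:Z ^+ n == a %[mod m])%Z then 1 else 0 : C)).
  exact: dirichlet_abs_von_mangoldt h.
by apply/funext => k; rewrite /xi_coef; case: ifP; rewrite ?mulr1 ?mulr0.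
Qed.

Definition xi_ext s : C := (totient m)%:R^-1 *
  \sum_(chi <- chars R m) - (chi a)^-1 * log_deriv (char_exp chi n) s.

Lemma totientC_neq0 : ((totient m)%:R : C) != 0.
Proof. by apply: natC_neq0; rewrite totient_gt0 ltnW. Qed.

Lemma xi_eq_ext s : 1 < complex.Re s ->
  (forall chi, chi \in chars R m -> Defs.Lfun (char_exp chi n) s != 0) ->
  xi m n a s = xi_ext s.
Proof.
move=> hs hL; apply: dirichlet_seriesE.
pose f chi (k : nat) : C := (chi a)^-1 *
  dirichlet_term (fun k => (von_mangoldt R k)%:C * char_exp chi n k%:Z) s k.
have fS chi : chi \in chars R m ->
    has_sum (f chi) (- (chi a)^-1 * log_deriv (char_exp chi n) s).
  move=> hchi; have hp := char_exp_dirichlet (proj1 (mem_chars m2 chi) hchi).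
  rewrite mulNr -mulrN -(log_derivE m2 hp hs (hL _ hchi)); apply: has_sumZ.
  apply: dirichlet_has_sum hs.
  exact: dirichlet_abs_von_mangoldt (char_coef_le1 m2 hp).
apply: eq_has_sum (has_sumZ (totient m)%:R^-1 (has_sum_big fS)) => k.
rewrite /dirichlet_term.
have -> : xi_coef R m n a k.+1 = (totient m)%:R^-1 *
    (\sum_(chi <- chars R m) (chi a)^-1 * chi k.+1%:Z ^+ n) * (von_mangoldt R k.+1)%:C.
  rewrite (chars_orthogonality R m2)// /xi_coef; case: ifP => _; last by rewrite mulr0 mul0r.
  by rewrite mulVf ?mul1r// totientC_neq0.
rewrite -!mulrA; congr (_ * _); rewrite mulr_suml; apply: eq_bigr => chi _.
by rewrite /f /dirichlet_term /char_exp; ring.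
Qed.

Lemma xi_ext_near z : \forall s \near z^', 1 < complex.Re s -> xi m n a s = xi_ext s.
Proof.
have /dnear_absCP[r r0 h] : \forall s \near z^', forall chi, chi \in chars R m ->
    Defs.Lfun (char_exp chi n) s != 0.
  apply: near_seq => chi /(mem_chars m2) hchi.
  exact: (Lfun_near m2 (char_exp_dirichlet hchi)).
apply/dnear_absCP; exists r => // s sz sr hs; apply: xi_eq_ext => //.
exact: h.
Qed.

Lemma xi_ext_mero z : mero_at xi_ext z.
Proof.
apply: mero_atM; first exact: mero_at_cst.
apply: mero_at_sum => chi /(mem_chars m2) hchi.
apply: mero_atM; first exact: mero_at_cst.
exact: (log_deriv_mero m2 (char_exp_dirichlet hchi)).
Qed.

Lemma Q_sumE (A : set (int -> C)) : Q_sum m n a A = (totient m)%:R^-1 *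
  \sum_(chi <- chars R m) if `[< A (char_exp chi n) >]
    then (chi a)^-1 * rho (char_exp chi n) else 0.
Proof.
rewrite /Q_sum; congr (_ * _).
have fin : finite_set [set chi : int -> C | dirichlet_char m chi /\ A (char_exp chi n)].
  by apply: sub_finite_set (finite_dirichlet_chars R m2) => chi [].
rewrite fsbig_finite// -big_mkcond -[RHS]big_filter; apply: perm_big.
apply: uniq_perm; first exact: finmap.fset_uniq.
  by rewrite filter_uniq// uniq_chars.
move=> chi; rewrite mem_filter in_fset_set//.
apply/idP/idP => [/set_mem[h1 h2]|/andP[/asboolP h1 /(mem_chars m2) h2]].
  by apply/andP; split; [exact/asboolP|exact/(mem_chars m2)].
by apply/mem_set; split.
Qed.

(** The three sums partition the characters: [psi (-1)] squares to [1], and the principal character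
    is even, so exactly one of the three conditions on [psi = chi ^ n] holds. *)
Lemma sum_Q : - Qplus R m n a - Qminus R m n a - Q0 R m n a =
  (totient m)%:R^-1 * \sum_(chi <- chars R m) - (chi a)^-1 * rho (char_exp chi n).
Proof.
rewrite /Qplus /Qminus /Q0 !Q_sumE -!mulrN -!mulrDr; congr (_ * _).
rewrite -!sumrN -!big_split /= big_seq [RHS]big_seq; apply: eq_bigr => chi.
move=> /(mem_chars m2) hchi; have hp := char_exp_dirichlet hchi.
set psi := char_exp chi n in hp *; set X := _ * rho psi.
have [pM _ _] := hp; have p1 := dirichlet_char1 hp.
have pm1 : (psi (-1) == 1) || (psi (-1) == -1).
  by rewrite -sqrf_eq1 expr2 -pM mulrNN mulr1 p1.
have n11 : (-1 : C) != 1.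
  rewrite -subr_eq0 -opprD oppr_eq0; exact: (natC_neq0 R (isT : (0 < 2)%N)).
have pr : principal_char R m (-1) = 1.
  by rewrite /principal_char /coprimez /gcdz /= gcd1n eqxx.
rewrite mulNr -/X; have [pE|pE] := pselect (psi = principal_char R m).
  have -> : `[< psi (-1) = 1 /\ psi <> principal_char R m >] = false.
    by apply: asboolF => -[].
  have -> : `[< psi (-1) = -1 >] = false.
    by apply: asboolF => /eqP; rewrite pE pr eq_sym (negPf n11).
  have -> : `[< psi = principal_char R m >] by apply: asboolT.
  by rewrite oppr0 !add0r.
have -> : `[< psi = principal_char R m >] = false by exact: asboolF.
case/orP: pm1 => /eqP pE'.
  have -> : `[< psi (-1) = 1 /\ psi <> principal_char R m >] by apply: asboolT.
  have -> : `[< psi (-1) = -1 >] = false.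
    by apply: asboolF => /eqP; rewrite pE' eq_sym (negPf n11).
  by rewrite oppr0 !addr0.
have -> : `[< psi (-1) = 1 /\ psi <> principal_char R m >] = false.
  by apply: asboolF => -[/eqP]; rewrite pE' (negPf n11).
have -> : `[< psi (-1) = -1 >] by apply: asboolT.
by rewrite oppr0 add0r addr0.
Qed.

Lemma xi_residue (F : C -> C) : meromorphic_continuation (xi m n a) F ->
  is_residue (fun s => s^-1 * F s) 0 (- Qplus R m n a - Qminus R m n a - Q0 R m n a).
Proof.
move=> [Fm Fxi].
have Dm z : mero_at (fun s => F s + -1 * xi_ext s) z.
  apply: mero_atD; first exact: Fm.
  by apply: mero_atM; [exact: mero_at_cst|exact: xi_ext_mero].
(* The point [2] serves as a base point inside the half-plane: near it, [F] is the series, which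
   equals [xi_ext] off the isolated zeros of the L-functions. *)
have D2 : zero_near (fun s => F s + -1 * xi_ext s) 2%:R%:C.
  have hs : 1 < complex.Re (2%:R%:C : C) by rewrite /= ltr1n.
  have /near_absCP[r r0 h] := near_Re_gt1 hs.
  have /dnear_absCP[q q0 h'] := xi_ext_near 2%:R%:C.
  apply/dnear_absCP; exists (Num.min r q); first by rewrite lt_min r0.
  move=> s s2; rewrite lt_min => /andP[/h sr sq].
  by rewrite Fxi// (h' s s2 sq sr) mulN1r subrr.
have /dnear_absCP[r r0 h] := mero_identity 0 Dm D2.
have res : is_residue (fun s => (totient m)%:R^-1 * \sum_(chi <- chars R m)
    - (chi a)^-1 * (derive1 (Defs.Lfun (char_exp chi n)) s /
      (s * Defs.Lfun (char_exp chi n) s)))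
    0 (- Qplus R m n a - Qminus R m n a - Q0 R m n a).
  rewrite sum_Q; apply: is_residueZ.
  apply: is_residue_sum => chi /(mem_chars m2) hchi; apply: is_residueZ.
  exact: (rhoP m2 (char_exp_dirichlet hchi)).
apply: is_residue_eq res _; apply/dnear_absCP; exists r => // s s0 sr.
have := h s s0 sr; rewrite mulN1r => /eqP; rewrite subr_eq0 => /eqP ->.
rewrite /xi_ext mulrCA; congr (_ * _); rewrite mulr_sumr; apply: eq_bigr => chi _.
by rewrite /log_deriv invfM; ring.
Qed.

(** A continuation must equal the series at every point of the half-plane, whereas [xi_ext] is known
    to do so only where none of the L-functions vanishes; hence the patching. *)
Lemma xi_continuation :
  exists F : C -> C, meromorphic_continuation (xi m n a) F.
Proof.
exists (fun s => if 1 < complex.Re s then xi m n a s else xi_ext s).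
split; last by move=> s ->.
apply: mero_patch => z.
- exact: near_Re_gt1.
- by move=> hz; apply: analytic_mero_at; exact: dirichlet_analytic xi_coef_abs hz.
- by move=> _; exact: xi_ext_mero.
- by move=> _; exact: xi_ext_near.
Qed.

End MainTheorem.

Theorem theorem4p9 (R : realType) (m n : nat) (a : int)
    (hm : (2 <= m)%N) (ha : coprimez a m) (hn : (1 <= n)%N) :
  [/\ forall s : Cplx R, 1 < complex.Re s ->
        cvgn (series (dirichlet_term (xi_coef R m n a) s)),
      forall s : Cplx R, 1 < complex.Re s -> analytic_at (xi m n a) s,
      exists F : Cplx R -> Cplx R, meromorphic_continuation (xi m n a) F
    & forall F : Cplx R -> Cplx R, meromorphic_continuation (xi m n a) F ->
        is_residue (fun s => s^-1 * F s) 0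
          (- Qplus R m n a - Qminus R m n a - Q0 R m n a)].
Proof.
split=> [s hs|s hs||F hF].
- exact: (cvgP _ (has_sum_series (dirichlet_has_sum (xi_coef_abs m n a) hs))).
- exact: (dirichlet_analytic (xi_coef_abs m n a) hs).
- exact: xi_continuation.
- exact: xi_residue.
Qed.
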